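(* For each $i=1,\dots,d$, all $\mathbf m=(m_1,\dots,m_d)$ and all $n$, there is a short exact sequence $$0\to\left(W_L^T\right)_{\left(\mathbf m-\epsilon_i,\;n+k\frac{\langle\alpha^{(i)}_{(0)},\alpha^{(i)}_{(0)}\rangle}{2}-k\sum_{j=1}^dm_j\langle\alpha^{(i)}_{(0)},\alpha^{(j)}_{(0)}\rangle\right)}\xrightarrow{\;e_{\alpha^{(i)}}\;}\left(W_L^T\right)_{(\mathbf m,n)}\xrightarrow{\;\Delta_c^T(\lambda^{(i)},-x)\;}\left(W_L^T\right)_{(\mathbf m,\,n-\frac{k}{l_i}m_i)}\to0 .$$ Moreover, for each $i=1,\dots,d$, $$\chi'(\mathbf x;q)=\chi'(x_1,\dots,x_{i-1},q^{\frac{k}{l_i}}x_i,x_{i+1},\dots,x_d;q)+x_i\,q^{k\frac{\langle\alpha^{(i)}_{(0)},\alpha^{(i)}_{(0)}\rangle}{2}}\,\chi'\big(q^{k\langle\alpha^{(1)}_{(0)},\alpha^{(i)}_{(0)}\rangle}x_1,\dots,q^{k\langle\alpha^{(d)}_{(0)},\alpha^{(i)}_{(0)}\rangle}x_d;q\big).$$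
   Context: **Lattice data.** $L=\mathbb{Z}\alpha_1\oplus\cdots\oplus\mathbb{Z}\alpha_D$ is a positive definite even lattice with symmetric $\mathbb{Z}$-bilinear form $\langle\cdot,\cdot\rangle$ such that $\langle\alpha_i,\alpha_j\rangle\ge 0$ for all $i,j$. $\nu:L\to L$ is an isometry of finite order $v$ permuting $\alpha_1,\dots,\alpha_D$; $k=2v$; $\eta\in\mathbb{C}$ is a primitive $k$-th root of unity, and for $r\mid k$ we put $\eta_r=\eta^{k/r}$. The permutation has $d$ cycles, of lengths $l_1,\dots,l_d$, and the basis is numbered so that $\nu=(1,\dots,l_1)(l_1+1,\dots,l_1+l_2)\cdots$; put $\alpha^{(r)}=\alpha_{l_1+\cdots+l_{r-1}+1}$ and $\alpha^{(r)}_j=\nu^{j-1}\alpha^{(r)}$ ($1\le j\le l_r$). Let $\mathfrak h=L\otimes_{\mathbb Z}\mathbb{C}$ with the extended form and extended $\nu$; $\mathfrak h_{(n)}=\{h:\nu h=\eta^n h\}$ ($n\in\mathbb Z$), and $h_{(n)}$ is the projection of $h$ to $\mathfrak h_{(n)}$; in particular $h_{(0)}=\frac1k\sum_{j=0}^{k-1}\nu^jh$. Say $\alpha^{(i)}$ satisfies the *evenness condition* if $l_i$ is odd, or $l_i$ is even and $\langle\alpha^{(i)},\nu^{l_i/2}\alpha^{(i)}\rangle\in2\mathbb{Z}$. Put $N=\{\alpha\in L:\langle\alpha,\mathfrak h_{(0)}\rangle=0\}$, $M=(1-\nu)L$, $R=\{\alpha\in N: C_N(\alpha,\beta)=1\ \forall\beta\in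 N\}$ with $C_N(\alpha,\beta)=\eta^{\sum_{j=0}^{k-1}j\langle\nu^j\alpha,\beta\rangle}$. It is assumed that $N=M=R$. **Central extensions.** $\hat L$ is the central extension of $L$ by $\langle\eta\rangle$ with normalized section $\alpha\mapsto e_\alpha$ and $e_\alpha e_\beta=\epsilon(\alpha,\beta)e_{\alpha+\beta}$, where $\epsilon$ is bimultiplicative with $\epsilon(\alpha_i,\alpha_j)=1$ if $i\le j$ and $(-1)^{\langle\alpha_i,\alpha_j\rangle}$ if $i>j$; its commutator map is $(-1)^{\langle\alpha,\beta\rangle}$. $\hat\nu$ is the automorphism of $\hat L$ fixing $\eta$ such that, for $\alpha$ in the orbit of $\alpha^{(r)}$, $\hat\nu e_\alpha=e_{\nu\alpha}$ if $\alpha^{(r)}$ satisfies the evenness condition and $\hat\nu e_\alpha=\eta_{2l_r}e_{\nu\alpha}$ otherwise. $\hat L_\nu$ is the same set as $\hat L$ with product $\times_\nu$ determined by $a\times b=\prod_{0<j<k/2}(-\eta^j)^{\langle\nu^{-j}\bar a,\bar b\rangle}\,a\times_\nu b$ (bar is the projection to $L$); its commutator map is $C(\alpha,\beta)=\prod_{j=0}^{k-1}(-\eta^j)^{\langle\nu^j\alpha,\beta\rangle}$, and $\hat\nu$ is also an automorphism of $\hat L_\nu$. $\hat N\subset\hat L_\nu$ is the preimage of $N$, and $\tau:\hat N\to\mathbb C^\times$ is the unique homomorphism with $\tau(\eta)=\eta$ and $\tau(a\,\hat\nu a^{-1})=\eta^{-\frac12\sum_{j=0}^{k-1}\langle\nu^j\bar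 a,\bar a\rangle}$ for $a\in\hat L_\nu$. **Twisted module.** $\hat{\mathfrak h}[\nu]=\coprod_{n\in\frac1k\mathbb Z}\mathfrak h_{(kn)}\otimes t^n\oplus\mathbb C\mathbf k$ with $\mathbf k$ central and $[\alpha\otimes t^m,\beta\otimes t^n]=\langle\alpha,\beta\rangle m\delta_{m+n,0}\mathbf k$; write $\alpha(n)=\alpha\otimes t^n$. $S[\nu]$ is the $\hat{\mathfrak h}[\nu]$-module induced from the trivial module $\mathbb C$ of $\coprod_{n\ge0}\mathfrak h_{(kn)}\otimes t^n$, with $\mathbf k=1$. $U_T=\mathbb C[\hat L_\nu]\otimes_{\mathbb C[\hat N]}\mathbb C_\tau\cong\mathbb C[L/N]$. $V_L^T=S[\nu]\otimes U_T$: $\hat L_\nu$ acts on $U_T$ by left multiplication, and for $h\in\mathfrak h_{(0)}$ the operator $x^h$ acts on $b\otimes1\in U_T$ by $x^{\langle h,\bar b\rangle}$. Put $1_T=1\otimes(1\otimes1)$. For $\alpha\in\mathfrak h$, $$E^\pm(-\alpha,x)=\exp\Big(\sum_{n\in\pm\frac1k\mathbb Z_+}\frac{-\alpha_{(kn)}(n)}{n}x^{-n}\Big),$$ and for $\alpha\in L$, $\sigma(\alpha)=\prod_{0<j<k/2}(1-\eta^{-j})^{\langle\nu^j\alpha,\alpha\rangle}\,2^{\langle\nu^{k/2}\alpha,\alpha\rangle/2}$ and $$Y^{\hat\nu}(e^\alpha,x)=k^{-\langle\alpha,\alpha\rangle/2}\sigma(\alpha)E^-(-\alpha,x)E^+(-\alpha,x)\,e_\alpha\,x^{\alpha_{(0)}+\frac{\langle\alpha_{(0)},\alpha_{(0)}\rangle}{2}-\frac{\langle\alpha,\alpha\rangle}{2}}=\sum_{m\in\frac1k\mathbb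 Z}(e^\alpha)^{\hat\nu}_m x^{-m-\langle\alpha,\alpha\rangle/2}.$$ These are the operators attached to $e^\alpha\in V_L$ in the $\hat\nu$-twisted module $V_L^T$ for the lattice vertex operator algebra $V_L$. **Principal subspace.** $W_L\subset V_L$ is the vertex subalgebra generated by $e^{\alpha_1},\dots,e^{\alpha_D}$ and $W_L^T=W_L\cdot1_T\subset V_L^T$; concretely $W_L^T$ is the span of all $(e^{\alpha_{i_1}})^{\hat\nu}_{m_1}\cdots(e^{\alpha_{i_s}})^{\hat\nu}_{m_s}1_T$ with $s\ge0$, $m_j\in\frac1k\mathbb Z$. The operators $(e^{\alpha_i})^{\hat\nu}_m$ all commute, and $(e^{\nu^r\alpha^{(i)}})^{\hat\nu}_m$ is a scalar multiple of $(e^{\alpha^{(i)}})^{\hat\nu}_m$, so only the $\alpha^{(i)}$ are needed. **Gradings.** $W_L^T$ is graded by $L^{\hat\nu}(0)$-weight, with $\mathrm{wt}(1_T)=\frac1{4k^2}\sum_{j=1}^{k-1}j(k-j)\dim\mathfrak h_{(j)}$ and $\mathrm{wt}\big((e^{\alpha_{i_1}})^{\hat\nu}_{m_1}\cdots(e^{\alpha_{i_s}})^{\hat\nu}_{m_s}1_T\big)=-(m_1+\cdots+m_s)+\mathrm{wt}(1_T)$, and by charge in $\mathbb Z_{\ge0}^d$: this vector has charge $(c_1,\dots,c_d)$ where $c_r$ is the number of indices $p$ with $\alpha_{i_p}$ in the $\nu$-orbit of $\alpha^{(r)}$. $(W_L^T)_{(\mathbf m,n)}$ is the space of $w\in W_L^T$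 of charge $\mathbf m$ and with $k(\mathrm{wt}(w)-\mathrm{wt}(1_T))=n$ (zero if $\mathbf m\notin\mathbb Z_{\ge0}^d$). $\epsilon_i$ is the $i$-th standard basis vector of $\mathbb Z^d$. The shifted multigraded dimension is $$\chi'(\mathbf x;q)=\sum_{n\in\mathbb Z_{\ge0},\,\mathbf m\in\mathbb Z_{\ge0}^d}\dim(W_L^T)_{(\mathbf m,n)}\,q^n x_1^{m_1}\cdots x_d^{m_d}.$$ **The maps.** $e_{\alpha^{(i)}}:V_L^T\to V_L^T$ is the action of $e_{\alpha^{(i)}}\in\hat L_\nu$ (on the factor $U_T$), restricted to $W_L^T$, which it maps to itself. Let $\{\lambda_1,\dots,\lambda_D\}\subset\mathbb Q\otimes L$ be the basis dual to $\{\alpha_1,\dots,\alpha_D\}$ and $\lambda^{(i)}$ the dual basis element corresponding to $\alpha^{(i)}$. Then $$\Delta^T(\lambda^{(i)},-x)=\Big(\prod_{j=0}^{l_i-1}(-\eta_{l_i}^j)^{-\nu^j\lambda^{(i)}}\Big)x^{\lambda^{(i)}_{(0)}}E^+(-\lambda^{(i)},x),$$ where the first factor acts on vectors of charge $\mathbf m$ in $W_L^T$ as the scalar $(-1)^{m_i}$. $\Delta_c^T(\lambda^{(i)},-x)$ denotes the constant term (coefficient of $x^0$) of $\Delta^T(\lambda^{(i)},-x)$; on $W_L^T$ it is the linear map $$(e^{\alpha^{(i_1)}})^{\hat\nu}_{n_1}\cdots(e^{\alpha^{(i_s)}})^{\hat\nu}_{n_s}1_T\mapsto(e^{\alpha^{(i_1)}})^{\hat\nu}_{n_1+\delta_{i,i_1}/l_i}\cdots(e^{\alpha^{(i_s)}})^{\hat\nu}_{n_s+\delta_{i,i_s}/l_i}1_T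 .$$ *)

(* Defs.v *)
(* Built on Mathematical Components, with the classical layer of
   MathComp-Analysis. *)
From HB Require Import structures.
From mathcomp Require Import all_boot all_order all_algebra all_fingroup.
From mathcomp Require Import generic_quotient ring_quotient archimedean.
From mathcomp Require Import boolp classical_sets cardinality fsbigop reals.
From mathcomp Require Import complex.
From mathcomp Require Import finmap monalg.

Set Implicit Arguments.
Unset Strict Implicit.
Unset Printing Implicit Defensive.

Import Order.TTheory GRing.Theory Num.Theory.
Local Open Scope classical_set_scope.
Local Open Scope ring_scope.
Local Open Scope quotient_scope.

Section Span.
Variables (C : fieldType) (V : lmodType C).
Implicit Types (X W : set V).

Definition lspan X : set V :=
  [set v | exists s : seq (C * V),
    (forall p, p \in s -> X p.2) /\ v = \sum_(p <- s) p.1 *: p.2].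

Definition is_basis W n (b : 'I_n -> V) : Prop :=
  [/\ forall i, W (b i),
      forall c : 'I_n -> C, \sum_i c i *: b i = 0 -> forall i, c i = 0
    & W `<=` lspan (range b)].

(* The dimension of a finite-dimensional subspace W (0 if W is not one). *)
Definition dimS W : nat :=
  xget 0%N [set n | exists b : 'I_n -> V, is_basis W b].

Definition linear_on W (f : V -> V) : Prop :=
  forall (c : C) x y, W x -> W y -> f (c *: x + y) = c *: f x + f y.

(* 0 -> W1 --f--> W2 --g--> W3 -> 0 for subspaces W1, W2, W3 of V. *)
Definition short_exact W1 W2 W3 (f g : V -> V) : Prop :=
  [/\ linear_on W1 f, linear_on W2 g,
      forall x y, W1 x -> W1 y -> f x = f y -> x = y,
      f @` W1 = W2 `&` [set w | g w = 0]
    & g @` W2 = W3].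

(* The subspace spanned by X, as the boolean predicate used for quotients. *)
Definition relspan X : {pred V} := fun v => `[< lspan X v >].

Lemma relspan_zmod_closed X : zmod_closed (relspan X).
Proof.
split=> [|u v].
  by apply/asboolP; exists [::]; split=> //; rewrite big_nil.
move=> /asboolP[s [Xs ->]] /asboolP[t [Xt ->]]; apply/asboolP.
exists (s ++ [seq (- p.1, p.2) | p <- t]); split=> [p|].
  rewrite mem_cat => /orP[/Xs //|/mapP[q /Xt Xq ->]]; exact: Xq.
rewrite big_cat big_map /= -sumrN; congr (_ + _).
by apply: eq_bigr => p _; rewrite scaleNr.
Qed.

HB.instance Definition _ X :=
  GRing.isZmodClosed.Build V (relspan X) (relspan_zmod_closed X).

Definition lquot X := Quotient.quot (relspan X : zmodClosed V).

HB.instance Definition _ X := GRing.Zmodule.on (lquot X).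

Lemma relspanZ X c v : v \in relspan X -> c *: v \in relspan X.
Proof.
move=> /asboolP[s [Xs ->]]; apply/asboolP.
exists [seq (c * p.1, p.2) | p <- s]; split=> [p /mapP[q /Xs Xq ->] //|].
by rewrite big_map scaler_sumr; apply: eq_bigr => p _; rewrite scalerA.
Qed.

Lemma lquotP X u v :
  reflect (\pi_(lquot X) u = \pi_(lquot X) v) (u - v \in relspan X).
Proof.
rewrite (@Quotient.idealrBE _ (relspan X : zmodClosed V)).
by apply: (iffP eqP).
Qed.

Definition lquot_scale X (c : C) (q : lquot X) : lquot X :=
  \pi_(lquot X) (c *: repr q).

Lemma pi_lquotZ X c v :
  \pi_(lquot X) (c *: v) = lquot_scale c (\pi_(lquot X) v).
Proof.
apply/lquotP; rewrite -scalerBr; apply: relspanZ.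
by apply/lquotP; rewrite reprK.
Qed.

Lemma lquot_scaleA X (a b : C) (q : lquot X) :
  lquot_scale a (lquot_scale b q) = lquot_scale (a * b) q.
Proof.
elim/quotW: q => v.
by rewrite -(pi_lquotZ X b v) -(pi_lquotZ X a) -(pi_lquotZ X (a * b)) scalerA.
Qed.

Lemma lquot_scale1 X : left_id 1 (@lquot_scale X).
Proof. by elim/quotW => v; rewrite -(pi_lquotZ X 1) scale1r. Qed.

Lemma pi_lquotD X u v :
  \pi_(lquot X) (u + v) = \pi_(lquot X) u + \pi_(lquot X) v.
Proof. exact: raddfD. Qed.

Lemma lquot_scaleDr X : right_distributive (@lquot_scale X) +%R.
Proof.
move=> c; elim/quotW => u; elim/quotW => v.
rewrite -(pi_lquotZ X c u) -(pi_lquotZ X c v) -!(pi_lquotD X).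
by rewrite -(pi_lquotZ X c) scalerDr.
Qed.

Lemma lquot_scaleDl X (q : lquot X) :
  {morph (@lquot_scale X)^~ q : a b / a + b}.
Proof.
elim/quotW: q => v a b.
rewrite -(pi_lquotZ X (a + b)) -(pi_lquotZ X a) -(pi_lquotZ X b).
by rewrite -(pi_lquotD X) scalerDl.
Qed.

HB.instance Definition _ X := GRing.Zmodule_isLmodule.Build C (lquot X)
  (@lquot_scaleA X) (@lquot_scale1 X) (@lquot_scaleDr X) (@lquot_scaleDl X).

End Span.

Arguments lquot {C V} X.

Section FreeAndTensor.
Variable C : fieldType.

(* The linear map {malg C[T]} -> V extending f. *)
Definition mlift (T : choiceType) (V : lmodType C) (f : T -> V)
  (g : {malg C[T]}) : V := \sum_(x <- msupp g) g@_x *: f x.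

(* The map induced by f on a space presented by generators T and relations X;
   independent of the representative whenever mlift f kills X. *)
Definition qlift (T : choiceType) (X : set {malg C[T]}) (V : lmodType C)
  (f : T -> V) (q : lquot X) : V := mlift f (repr q).

Variables V W : lmodType C.

Inductive tensor_rel : set {malg C[(V * W)%type]} :=
| TensorRelL c v v' w : tensor_rel
    (<< (c *: v + v', w) >> - c *: << (v, w) >> - << (v', w) >>)
| TensorRelR c v w w' : tensor_rel
    (<< (v, c *: w + w') >> - c *: << (v, w) >> - << (v, w') >>).

Definition tensor := lquot tensor_rel.
HB.instance Definition _ := GRing.Lmodule.on tensor.

Definition tens (v : V) (w : W) : tensor := \pi_tensor << (v, w) >>.

(* f \otimes g, for linear maps f and g. *)
Definition tmap (f : V -> V) (g : W -> W) : tensor -> tensor :=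
  qlift (fun p => tens (f p.1) (g p.2)).

End FreeAndTensor.

(* L = Z^D with alpha_i the i-th standard basis (row) vector, 0-based, and form
   given by the Gram matrix; nu maps alpha_i to alpha_(nuP i), i.e. acts on row
   vectors by right multiplication by perm_mx nuP.  Both are extended to F^D for
   any ring F (F = C giving h = L \otimes C). *)
Definition bform (D : nat) (G : 'M[int]_D) (F : comNzRingType)
  (x y : 'rV[F]_D) : F := (x *m map_mx intr G *m y^T) 0 0.

Definition nuact (D : nat) (F : comNzRingType) (g : 'S_D) (x : 'rV[F]_D) :
  'rV[F]_D := x *m perm_mx g.

Record latticeData (C : numClosedFieldType) := LatticeData {
  rkL : nat;
  gram : 'M[int]_rkL;
  nuP : 'S_rkL;
  eta : C;
  ncyc : nat;
  len : 'I_ncyc -> nat;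
  (* rep r is the index of alpha^(r) *)
  rep : 'I_ncyc -> 'I_rkL;
  gram_sym : gram^T = gram;
  gram_posdef : forall x : 'rV[int]_rkL, x != 0 -> 0 < bform gram x x;
  gram_even : forall x : 'rV[int]_rkL, (2 %| bform gram x x)%Z;
  gram_ge0 : forall i j, 0 <= gram i j;
  nu_isometry : forall i j, gram (nuP i) (nuP j) = gram i j;
  eta_prim : (2 * #[nuP]%g)%N.-primitive_root eta;
  (* nuP = (0, ..., l_0 - 1)(l_0, ..., l_0 + l_1 - 1)... *)
  len_gt0 : forall r, (0 < len r)%N;
  len_sum : (\sum_r len r)%N = rkL;
  nu_cycles : forall r j, (j < len r)%N ->
    val ((nuP ^+ j)%g (rep r)) = (\sum_(r' < ncyc | (r' < r)%N) len r' + j)%N;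
  nu_cycles_closed : forall r, (nuP ^+ len r)%g (rep r) = rep r
}.

Arguments len {C} _ _.
Arguments rep {C} _ _.

Section TwistedModule.
Variables (C : numClosedFieldType) (X : latticeData C).
Local Notation D := (rkL X).
Local Notation d := (ncyc X).
Local Notation s := (nuP X).
Local Notation eta := (eta X).
Local Notation L := 'rV[int]_D.
Local Notation h := 'rV[C]_D.

Definition vper : nat := #[s]%g.
Definition kper : nat := (2 * vper)%N.
Local Notation k := kper.

Definition form (F : comNzRingType) (x y : 'rV[F]_D) : F := bform (gram X) x y.
Definition ext (F : comNzRingType) (a : L) : 'rV[F]_D := map_mx intr a.
Definition alpha (i : 'I_D) : L := delta_mx 0 i.
Definition alphar (r : 'I_d) : L := alpha (rep X r).

Definition nu (F : comNzRingType) (j : nat) (x : 'rV[F]_D) := nuact (s ^+ j)%g x.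
Definition nuV (F : comNzRingType) (j : nat) (x : 'rV[F]_D) := nuact (s ^- j)%g x.

Definition homog (n : int) (x : h) : bool := nu 1 x == eta ^ n *: x.

Definition hproj (n : int) (x : h) : h :=
  k%:R^-1 *: \sum_(j < k) eta ^ (- (n * j%:Z)) *: nu j x.

(* x_(0), over any field of characteristic 0 *)
Definition proj0 (F : fieldType) (x : 'rV[F]_D) : 'rV[F]_D :=
  k%:R^-1 *: \sum_(j < k) nu j x.

Lemma nuD (F : comNzRingType) i j (x : 'rV[F]_D) : nu i (nu j x) = nu (i + j) x.
Proof. by rewrite /nu /nuact -mulmxA -perm_mxM -expgD addnC. Qed.

Lemma nu_k (F : comNzRingType) (x : 'rV[F]_D) : nu k x = x.
Proof.
by rewrite /nu /nuact /kper mulnC expgM expg_order expg1n perm_mx1 mulmx1.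
Qed.

Lemma kper_gt0 : (0 < k)%N. Proof. by rewrite muln_gt0 order_gt0. Qed.

Lemma eta_k : eta ^+ k = 1. Proof. exact: (prim_expr_order (eta_prim X)). Qed.

Lemma eta_neq0 : eta != 0.
Proof.
apply: contra_eq_neq eta_k => ->.
by rewrite expr0n gtn_eqF ?kper_gt0 // eq_sym oner_eq0.
Qed.

Lemma hproj_homog n x : homog n (hproj n x).
Proof.
rewrite /homog /hproj; apply/eqP.
rewrite {1}/nu /nuact -scalemxAl mulmx_suml scalerA [_ * _]mulrC -scalerA.
congr (_ *: _); rewrite scaler_sumr.
pose g j := eta ^ (n - n * j%:Z) *: nu j x.
transitivity (\sum_(0 <= j < k) g j.+1).
  rewrite big_mkord; apply: eq_bigr => j _; rewrite -scalemxAl /g.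
  rewrite -[nu j x *m _]/(nu 1 (nu j x)) nuD add1n.
  by rewrite intS mulrDr mulr1 opprD addrA subrr add0r.
transitivity (\sum_(0 <= j < k) g j); last first.
  rewrite big_mkord; apply: eq_bigr => j _.
  by rewrite scalerA -expfzDr // eta_neq0.
rewrite -(prednK kper_gt0) big_nat_recr // [RHS]big_nat_recl // addrC /=.
congr (_ + _); rewrite prednK ?kper_gt0 // /g nu_k mulr0 subr0.
rewrite /nu /nuact expg0 perm_mx1 mulmx1 expfzDr ?eta_neq0 // -mulNr.
by rewrite [- n * _]mulrC -exprz_exp -exprnP eta_k exp1rz mulr1.
Qed.

Definition Nset : set L :=
  [set a | forall x : h, homog 0 x -> form (ext C a) x = 0].
Definition Mset : set L := [set a | exists b : L, a = b - nu 1 b].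
Definition C_N (a b : L) : C := eta ^ (\sum_(j < k) j%:Z * form (nu j a) b).
Definition Rset : set L :=
  [set a | Nset a /\ forall b, Nset b -> C_N a b = 1].

Definition evenness (r : 'I_d) : bool :=
  odd (len X r)
  || (2 %| form (alphar r) (nu (len X r)./2 (alphar r)))%Z.

(* (n, a) stands for \eta^n e_a; note that -1 = \eta^v in <\eta>. *)
Definition Lhat := ('Z_k * L)%type.
HB.instance Definition _ := Choice.on Lhat.

Definition sec (a : L) : Lhat := (0, a).

(* \epsilon(a, b) = (-1) ^ eps_exp a b *)
Definition eps_exp (a b : L) : int :=
  \sum_(i < D) \sum_(j < D | (j < i)%N) a 0 i * b 0 j * gram X i j.

Definition Lhat_mul (a b : Lhat) : Lhat :=
  (a.1 + b.1 + (vper%:Z * eps_exp a.2 b.2)%:~R, a.2 + b.2).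

(* a x b = \eta ^ (nu_exp \bar a \bar b) a x_\nu b *)
Definition nu_exp (a b : L) : int :=
  \sum_(1 <= j < k./2) (vper + j)%:Z * form (nuV j a) b.

Definition Lhat_nu_mul (a b : Lhat) : Lhat :=
  let c := Lhat_mul a b in (c.1 - (nu_exp a.2 b.2)%:~R, c.2).

(* \eta_(2 l) = \eta ^ (k / (2 l)) *)
Definition is_nuhat (f : Lhat -> Lhat) : Prop :=
  [/\ bijective f, forall a b, f (Lhat_mul a b) = Lhat_mul (f a) (f b),
      f (1, 0) = (1, 0)
    & forall (r : 'I_d) (i : 'I_D), i \in porbit s (rep X r) ->
        f (sec (alpha i)) =
          (if evenness r then 0 else (k %/ (2 * len X r))%:R, nu 1 (alpha i))].

(* b is the inverse of \hat\nu a in \hat L_\nu in the last condition; the sum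
   in the exponent is even, since \nu^(k/2) = 1. *)
Definition is_tau (nuhat : Lhat -> Lhat) (tau : Lhat -> C) : Prop :=
  [/\ forall a b, Nset a.2 -> Nset b.2 ->
        tau (Lhat_nu_mul a b) = tau a * tau b,
      tau (1, 0) = eta
    & forall a b, Lhat_nu_mul (nuhat a) b = (0, 0) ->
        tau (Lhat_nu_mul a b)
        = eta ^ (- ((\sum_(j < k) form (nu j a.2) a.2) %/ 2)%Z)].

(* The letter a stands for x \otimes t^(n/k), x in h_(n). *)
Definition letter : Type := {a : h * int | homog a.2 a.1}.
HB.instance Definition _ := Choice.on letter.
Definition lvec (a : letter) : h := (val a).1.
Definition lmode (a : letter) : int := (val a).2.

(* x_(n) \otimes t^(n/k) *)
Definition hletter (x : h) (n : int) : letter :=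
  Sub (hproj n x, n) (hproj_homog n x).

Definition bracket (a b : letter) : C :=
  if lmode a + lmode b == 0
  then form (lvec a) (lvec b) * ((lmode a)%:~R / k%:R) else 0.

(* The word a_1 ... a_p stands for the element a_1 ... a_p \otimes 1 of
   U(\hat h[\nu]) \otimes C, the tensor product being over the enveloping
   algebra of the subalgebra of nonnegative modes and the central element;
   the latter acts by 1. *)
Inductive heis_rel : set {malg C[seq letter]} :=
| HeisLin u w (z : C) a b c :
    lmode a = lmode c -> lmode b = lmode c -> lvec c = z *: lvec a + lvec b ->
    heis_rel (<< u ++ c :: w >> - z *: << u ++ a :: w >> - << u ++ b :: w >>)
| HeisComm u w a b :
    heis_rel (<< u ++ a :: b :: w >> - << u ++ b :: a :: w >>
              - bracket a b *: << u ++ w >>)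
| HeisVac u a : 0 <= lmode a -> heis_rel << rcons u a >>.

Definition Snu := lquot heis_rel.
HB.instance Definition _ := GRing.Lmodule.on Snu.

(* x_(n)(n/k) *)
Definition hact (x : h) (n : int) : Snu -> Snu :=
  qlift (fun w => \pi_Snu << hletter x n :: w >> : Snu).

(* For commuting operators f 1, f 2, ...: the coefficient of z^p in
   exp (\sum_(r >= 1) f r z^r). *)
Definition expcoef (V : lmodType C) (f : nat -> V -> V) (p : nat) (v : V) : V :=
  \sum_(j < p.+1) j`!%:R^-1 *:
    \sum_(t : j.-tuple 'I_p.+1 |
          (0%N \notin map val t) && (sumn (map val t) == p))
       foldr f v (map val t).

(* The coefficient of x^(- q/k) in E^+(-a, x), and that of x^(p/k) in
   E^-(-a, x). *)
Definition Eplus (a : h) (q : nat) : Snu -> Snu :=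
  expcoef (fun r u => - (k%:R / r%:R) *: hact a r%:Z u) q.
Definition Eminus (a : h) (p : nat) : Snu -> Snu :=
  expcoef (fun r u => (k%:R / r%:R) *: hact a (- r%:Z) u) p.

Variable tau : Lhat -> C.

(* C[\hat L_\nu] \otimes_(C[\hat N]) C_\tau; b stands for b \otimes 1 *)
Inductive UT_rel : set {malg C[Lhat]} :=
| UTRel b n : Nset n.2 -> UT_rel (<< Lhat_nu_mul b n >> - tau n *: << b >>).

Definition UT := lquot UT_rel.
HB.instance Definition _ := GRing.Lmodule.on UT.

Definition eact (a : L) : UT -> UT :=
  qlift (fun b => \pi_UT << Lhat_nu_mul (sec a) b >> : UT).

(* The coefficient of x^c in the operator x^y, for y in h_(0). *)
Definition xpow (y : h) (c : C) : UT -> UT :=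
  qlift (fun b =>
    if form y (ext C b.2) == c then \pi_UT << b >> : UT else 0).

Definition VT := tensor Snu UT.
HB.instance Definition _ := GRing.Lmodule.on VT.

Definition vac : VT := tens (\pi_Snu << [::] >> : Snu) (\pi_UT << (0, 0) >> : UT).

(* k/2 = v, \nu^v = 1 and L is even, so the exponents are integers *)
Definition sigma (a : L) : C :=
  \prod_(1 <= j < k./2) (1 - eta ^- j) ^ form (nu j a) a
  * 2 ^ (form (nu k./2 a) a %/ 2)%Z.

Definition Ynorm (a : L) : C := k%:R ^ (- (form a a %/ 2)%Z) * sigma a.

(* The coefficient of x^c in Y(e^a, x); the sum over (p, q), of the terms
   x^(p/k) of E^- and x^(-q/k) of E^+, is finite on each vector. *)
Definition Ycoef (a : L) (c : C) (w : VT) : VT :=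
  let aC := ext C a in let a0 := proj0 aC in
  let shift := form a0 a0 / 2 - form aC aC / 2 in
  Ynorm a *:
  \sum_(pq \in [set: nat * nat])
     tmap (fun u => Eminus aC pq.1 (Eplus aC pq.2 u))
          (fun b => eact a
             (xpow a0 (c - shift - pq.1%:R / k%:R + pq.2%:R / k%:R) b)) w.

(* The coefficient of x^(-m - <a, a>/2) for m = n/k *)
Definition Ymode (a : L) (n : int) : VT -> VT :=
  Ycoef a (- (n%:~R / k%:R) - form (ext C a) (ext C a) / 2).

(* (i, n) stands for the mode of e^(alpha_i) of index n/k *)
Definition mono (t : seq ('I_D * int)) : VT :=
  foldr (fun p w => Ymode (alpha p.1) p.2 w) vac t.

Definition wt_vac : rat :=
  (4 * k%:R ^+ 2)^-1 * \sum_(1 <= j < k)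
    (j * (k - j) * \rank (eigenspace (perm_mx s : 'M[C]_D) (eta ^+ j)))%:R.

Definition wt (t : seq ('I_D * int)) : rat :=
  - (\sum_(p <- t) p.2%:~R / k%:R) + wt_vac.

Definition charge (t : seq ('I_D * int)) : 'rV[int]_d :=
  \row_r (count (fun p => p.1 \in porbit s (rep X r)) t)%:Z.

(* W_L^T is spanned by all monomials, which are homogeneous; this is its
   component of charge m with k (wt - wt(1_T)) = n. *)
Definition Wgr (m : 'rV[int]_d) (n : rat) : set VT :=
  lspan [set w | exists t,
    [/\ w = mono t, charge t = m & k%:R * (wt t - wt_vac) = n]].

(* e_(alpha^(i)) on V_L^T *)
Definition emap (i : 'I_d) : VT -> VT := tmap id (eact (alphar i)).

(* \lambda^(i): the rows of the inverse Gram matrix are the dual basis. *)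
Definition lam (i : 'I_d) : h := row (rep X i) (invmx (map_mx intr (gram X))).

(* The coefficient of x^c in \Delta^T(\lambda^(i), -x), on vectors of charge m;
   only finitely many terms of E^+ act nontrivially on a given vector. *)
Definition DeltaT (i : 'I_d) (c : C) (m : 'rV[int]_d) (w : VT) : VT :=
  (-1) ^ m 0 i *:
  \sum_(q \in [set: nat])
     tmap (Eplus (lam i) q) (xpow (proj0 (lam i)) (c + q%:R / k%:R)) w.

Definition DeltaTc (i : 'I_d) : 'rV[int]_d -> VT -> VT := DeltaT i 0.

End TwistedModule.

Arguments Nset {C} X.
Arguments Mset {C} X.
Arguments Rset {C} X.
Arguments alphar {C} X r.
Arguments Wgr {C X} tau m n.
Arguments emap {C X} tau i.
Arguments DeltaTc {C X} tau i m.

(* <a_(0), b_(0)>, a rational number *)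
Definition form0 (C : numClosedFieldType) (X : latticeData C)
  (a b : 'rV[int]_(rkL X)) : rat :=
  form (proj0 (ext rat a)) (proj0 (ext rat b)).

(* Formal series in x_1, ..., x_d (integer exponents) and q (rational
   exponents), given by their coefficients. *)
Definition series (d : nat) := 'rV[int]_d -> rat -> nat.

Definition series_add d (f g : series d) : series d :=
  fun m n => (f m n + g m n)%N.

(* x_i q^b f, and f(q^(a_1) x_1, ..., q^(a_d) x_d; q) *)
Definition series_shift d (i : 'I_d) (b : rat) (f : series d) : series d :=
  fun m n => f (m - delta_mx 0 i) (n - b).

Definition series_subst d (a : 'I_d -> rat) (f : series d) : series d :=
  fun m n => f m (n - \sum_j a j * (m 0 j)%:~R).

Definition chi' (C : numClosedFieldType) (X : latticeData C)
  (tau : Lhat X -> C) : series (ncyc X) :=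
  fun m n => if [forall j, 0 <= m 0 j] && (n \is a Num.nat)
             then dimS (Wgr tau m n) else 0%N.

(* Main.v *)
(** The span of charge m of the principal subspace lies in S[nu] \otimes e_b,
    where b = \sum_r m_r alpha^(r).  Put h^(r)_p for the coefficient of
    x^(p / l_r) in E^-(- alpha^(r), x).  Commuting the E^+ to the right shows
    that a product of modes applied to the vacuum is a unitriangular
    combination of the products of the E^- coefficients, the correction
    factors being power series; hence the component of charge m is spanned by
    the products of the h^(r)_p with m_r factors of type r, for p >= 0.
    On these products the map e_(alpha^(i)) is the inclusion of those with a
    factor h^(i)_0 = 1, and, since E^+(- lambda^(i), x) only produces the
    factors 1 - (y / x)^(1 / l_i), the map Delta_c lowers by one the index of
    all factors of type i, killing the products with a factor h^(i)_0.
    Applying Delta_c repeatedly down to the vacuum, which is nonzero, shows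
    that the products are linearly independent, whence exactness.  The
    recursion for chi' is the additivity of the dimension. *)
Require Import Defs.
From mathcomp Require Import all_boot all_order all_algebra all_fingroup.
From mathcomp Require Import generic_quotient archimedean zify ring.
From mathcomp Require Import boolp classical_sets fsbigop reals.
From mathcomp Require Import complex finmap monalg.
(* Restores [form], shadowed by the sesquilinear forms of MathComp. *)
Import Defs.

Set Implicit Arguments.
Unset Strict Implicit.
Unset Printing Implicit Defensive.

Import Order.TTheory GRing.Theory Num.Theory.
Local Open Scope classical_set_scope.
Local Open Scope ring_scope.
Local Open Scope quotient_scope.

(** * Linear maps and quotients of free modules *)

(** Both tensor factors are presented by generators and relations, so even the nonvanishing of the
    vacuum has to be proved: functionals are defined on the generators and checked to kill the
    relations, by Wick's theorem on words of letters and by [tau] on a coset of N. The exponentials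
    are handled coefficientwise; Newton's recursion p e_p = \sum_r r f_r e_(p-r) determines the
    coefficients, and the exchange formulas are inductions along it. Independence is wanted for
    words up to reordering only, so it is stated dually: every reordering-invariant function on the
    words of given charge and degree is realized by a linear map. The form enters the gradings only
    through the integers S(a, b) = \sum_(0 <= j < v) <nu^j a, b> = (k/2) <a_(0), b_(0)>. A component
    of charge m and weight n has Heisenberg degree n - S(b, b), the difference being the weight of
    e_b; this quadratic term is the origin of the shift in the exact sequence. *)

Section LinearFunctions.
Variables (C : fieldType) (U V W : lmodType C).

Definition lin (f : U -> V) := forall (c : C) x y, f (c *: x + y) = c *: f x + f y.

Variable f : U -> V.
Hypothesis lf : lin f.

Lemma linD x y : f (x + y) = f x + f y.
Proof. by rewrite -[x in LHS]scale1r lf scale1r. Qed.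

Lemma lin0 : f 0 = 0.
Proof. by apply: (addIr (f 0)); rewrite -linD !add0r. Qed.

Lemma linZ c x : f (c *: x) = c *: f x.
Proof. by rewrite -[c *: x]addr0 lf lin0 addr0. Qed.

Lemma linN x : f (- x) = - f x.
Proof. by rewrite -scaleN1r linZ scaleN1r. Qed.

Lemma linB x y : f (x - y) = f x - f y.
Proof. by rewrite linD linN. Qed.

Lemma lin_sum (I : Type) (r : seq I) (P : pred I) (F : I -> U) :
  f (\sum_(i <- r | P i) F i) = \sum_(i <- r | P i) f (F i).
Proof. by elim/big_rec2: _ => [|i y1 y2 _ <-]; rewrite ?lin0 ?linD. Qed.

End LinearFunctions.

Lemma lin_comp (C : fieldType) (U V W : lmodType C) (f : V -> W) (g : U -> V) :
  lin f -> lin g -> lin (fun x => f (g x)).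
Proof. by move=> lf lg c x y; rewrite lg lf. Qed.

Lemma lin_lsum (C : fieldType) (U V : lmodType C) (I : Type) (r : seq I)
  (P : pred I) (f : I -> U -> V) (lf : forall i, P i -> lin (f i)) :
  lin (fun x => \sum_(i <- r | P i) f i x).
Proof.
by move=> c x y; rewrite scaler_sumr -big_split; apply: eq_bigr => i /lf ->.
Qed.

Lemma lin_scale (C : fieldType) (U V : lmodType C) (a : C) (f : U -> V) :
  lin f -> lin (fun x => a *: f x).
Proof. by move=> lf c x y; rewrite lf scalerDr !scalerA mulrC. Qed.

Lemma lin_add (C : fieldType) (U V : lmodType C) (f g : U -> V) :
  lin f -> lin g -> lin (fun x => f x + g x).
Proof. by move=> lf lg c x y; rewrite lf lg scalerDr addrACA. Qed.

Lemma lin_id (C : fieldType) (U : lmodType C) : lin (@id U).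
Proof. by []. Qed.

Section Spans.
Variables (C : fieldType) (V : lmodType C).
Implicit Types (X Y : set V).

Lemma mem_lspan X v : X v -> lspan X v.
Proof.
move=> Xv; exists [:: (1, v)]; split=> [p|]; first by rewrite inE => /eqP ->.
by rewrite big_seq1 scale1r.
Qed.

Lemma lspan_lin X c u v : lspan X u -> lspan X v -> lspan X (c *: u + v).
Proof.
move=> [s [Xs ->]] [t [Xt ->]].
exists ([seq (c * p.1, p.2) | p <- s] ++ t); split=> [p|].
  by rewrite mem_cat => /orP[/mapP[q /Xs Xq ->]|/Xt].
rewrite big_cat big_map /= scaler_sumr; congr (_ + _).
by apply: eq_bigr => p _; rewrite scalerA.
Qed.

Lemma lspan0 X : lspan X 0.
Proof. by exists [::]; rewrite big_nil. Qed.

Lemma lspanZ X c u : lspan X u -> lspan X (c *: u).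
Proof. by move=> Xu; rewrite -[_ *: _]addr0; apply: lspan_lin => //; apply: lspan0. Qed.

Lemma lspanD X u v : lspan X u -> lspan X v -> lspan X (u + v).
Proof. by move=> Xu Xv; rewrite -[u]scale1r; apply: lspan_lin. Qed.

Lemma lspanB X u v : lspan X u -> lspan X v -> lspan X (u - v).
Proof. by move=> Xu Xv; rewrite addrC -scaleN1r; apply: lspan_lin. Qed.

Lemma lspan_sum X (I : eqType) (r : seq I) (P : pred I) (F : I -> V) :
  (forall i, i \in r -> P i -> lspan X (F i)) ->
  lspan X (\sum_(i <- r | P i) F i).
Proof.
move=> XF; rewrite big_seq_cond; apply: big_ind => [||i /andP[ri Pi]].
- exact: lspan0.
- by move=> x y; apply: lspanD.
- exact: XF.
Qed.

Lemma lspan_sub X Y : X `<=` lspan Y -> lspan X `<=` lspan Y.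
Proof.
move=> XY _ [s [Xs ->]]; apply: lspan_sum => p ps _.
by apply: lspanZ; apply/XY/Xs.
Qed.

Lemma lspan_set0 v : lspan (@set0 V) v -> v = 0.
Proof.
move=> [s [Xs ->]]; rewrite big_seq big1 // => p /Xs [].
Qed.

End Spans.

Section SpanImages.
Variables (C : fieldType) (V : lmodType C).
Implicit Types (X Y : set V).

Lemma lspan_lin_ind (W : lmodType C) (f : V -> W) X (Y : set W) :
  lin f -> (forall x, X x -> lspan Y (f x)) ->
  forall x, lspan X x -> lspan Y (f x).
Proof.
move=> lf XY _ [s [Xs ->]]; rewrite (lin_sum lf); apply: lspan_sum => p ps _.
by rewrite (linZ lf); apply/lspanZ/XY/Xs.
Qed.

Lemma lin_eq_lspan (W : lmodType C) (f g : V -> W) X :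
  lin f -> lin g -> (forall x, X x -> f x = g x) ->
  forall x, lspan X x -> f x = g x.
Proof.
move=> lf lg XY _ [s [Xs ->]]; rewrite (lin_sum lf) (lin_sum lg).
apply: eq_big_seq => p ps; rewrite (linZ lf) (linZ lg); congr (_ *: _).
exact/XY/Xs.
Qed.

Lemma lspan_image (W : lmodType C) (f : V -> W) X :
  lin f -> lspan (f @` X) = f @` lspan X.
Proof.
move=> lf; apply/seteqP; split=> [_ [s [Xs ->]]|_ [x Xx <-]].
  elim: s Xs => [|p s IHs] Xs.
    by exists 0; rewrite ?big_nil ?(lin0 lf) //; apply: lspan0.
  have [x Xx Ex] := IHs (fun q qs => Xs q (mem_behead (s := p :: s) qs)).
  have [y Xy Ey] := Xs p (mem_head _ _).
  exists (p.1 *: y + x); first by apply: lspan_lin => //; apply: mem_lspan.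
  by rewrite lf big_cons Ex Ey.
apply: (lspan_lin_ind lf _ Xx) => y Xy.
by apply: mem_lspan; exists y.
Qed.

End SpanImages.

Section Lifts.
Variables (C : fieldType) (T : choiceType) (V : lmodType C) (f : T -> V).

Lemma mlift_wide (g : {malg C[T]}) (S : {fset T}) :
  (msupp g `<=` S)%fset -> mlift f g = \sum_(x <- S) g@_x *: f x.
Proof.
move=> gS; rewrite /mlift.
rewrite (big_fset_incl _ gS) // => x xS /mcoeff_outdom ->.
by rewrite scale0r.
Qed.

Lemma mlift_lin : lin (mlift f).
Proof.
move=> c x y.
pose S := (msupp x `|` msupp y `|` msupp (c *: x + y))%fset.
have xS : (msupp x `<=` S)%fset by rewrite /S -fsetUA fsubsetUl.
have yS : (msupp y `<=` S)%fset by rewrite /S fsetUAC fsubsetUr.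
rewrite (mlift_wide xS) (mlift_wide yS) (@mlift_wide _ S (fsubsetUr _ _)).
rewrite scaler_sumr -big_split; apply: eq_bigr => t _.
by rewrite mcoeffD mcoeffZ scalerDl scalerA.
Qed.

Lemma mliftU x : mlift f << x >> = f x.
Proof.
rewrite (@mlift_wide _ [fset x]%fset) ?msuppU_le //.
by rewrite big_seq_fset1 mcoeffUU scale1r.
Qed.

Lemma mliftB t x y : mlift f (<< x >> - t *: << y >>) = f x - t *: f y.
Proof. by rewrite (linB mlift_lin) (linZ mlift_lin) !mliftU. Qed.

Lemma mlift_span (X : set {malg C[T]}) :
  (forall x, X x -> mlift f x = 0) -> forall x, lspan X x -> mlift f x = 0.
Proof.
move=> X0 x Xx; apply: (lin_eq_lspan mlift_lin _ X0 Xx) => c u v.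
by rewrite scaler0 addr0.
Qed.

Variable X : set {malg C[T]}.
Hypothesis X0 : forall x, X x -> mlift f x = 0.

Lemma qlift_pi (g : {malg C[T]}) : qlift f (\pi_(lquot X) g) = mlift f g.
Proof.
apply/subr0_eq; rewrite -(linB mlift_lin); apply: (mlift_span X0).
by apply/asboolP/lquotP; rewrite reprK.
Qed.

Lemma qliftU x : qlift f (\pi_(lquot X) << x >>) = f x.
Proof. by rewrite qlift_pi mliftU. Qed.

Lemma qlift_lin : lin (@qlift C T X V f).
Proof.
move=> c; elim/quotW => x; elim/quotW => y.
have -> : c *: (\pi_(lquot X) x : lquot X) + (\pi_(lquot X) y : lquot X)
          = \pi_(lquot X) (c *: x + y).
  by rewrite (pi_lquotD X) (pi_lquotZ X).
by rewrite !qlift_pi mlift_lin.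
Qed.

End Lifts.

Section Quotients.
Variables (C : fieldType) (T : choiceType) (X : set {malg C[T]}).

Lemma pi_lin : lin (fun v => \pi_(lquot X) v : lquot X).
Proof. by move=> c x y; rewrite (pi_lquotD X) (pi_lquotZ X). Qed.

Lemma pi_eq0 g : X g -> \pi_(lquot X) g = 0 :> lquot X.
Proof.
move=> Xg; rewrite -(lin0 pi_lin); apply/lquotP; rewrite subr0.
exact/asboolP/mem_lspan.
Qed.

Lemma lquot_eq_lin (V : lmodType C) (f g : lquot X -> V) :
  lin f -> lin g ->
  (forall x : T, f (\pi_(lquot X) << x >>) = g (\pi_(lquot X) << x >>)) ->
  forall q, f q = g q.
Proof.
move=> lf lg fg; elim/quotW => u; rewrite [u]monalgE.
have -> : \sum_(k <- msupp u) << u@_k *g k >>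
  = \sum_(k <- msupp u) u@_k *: (<< k >> : {malg C[T]}).
  apply: eq_bigr => k _; apply/malgP => x.
  by rewrite mcoeffZ !mcoeffU mulr_natr.
rewrite (lin_sum pi_lin) (lin_sum lf) (lin_sum lg); apply: eq_bigr => k _.
by rewrite (linZ pi_lin) (linZ lf) (linZ lg) fg.
Qed.

End Quotients.

Section Tensors.
Variables (C : fieldType) (V W : lmodType C).

Lemma tens_linl (w : W) : lin (fun v : V => tens v w).
Proof.
move=> c x y; apply/eqP; rewrite -subr_eq0 opprD addrA; apply/eqP.
have := pi_eq0 (TensorRelL c x y w).
by rewrite (linB (pi_lin _)) (linB (pi_lin _)) (linZ (pi_lin _)).
Qed.

Lemma tens_linr (v : V) : lin (fun w : W => tens v w).
Proof.
move=> c x y; apply/eqP; rewrite -subr_eq0 opprD addrA; apply/eqP.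
have := pi_eq0 (TensorRelR c v x y).
by rewrite (linB (pi_lin _)) (linB (pi_lin _)) (linZ (pi_lin _)).
Qed.

Section Elim.
Variables (Z : lmodType C) (b : V -> W -> Z).
Hypothesis bl : forall w, lin (b^~ w).
Hypothesis br : forall v, lin (b v).

Lemma tensor_rel_killed x :
  tensor_rel x -> mlift (fun p : V * W => b p.1 p.2) x = 0.
Proof.
by case=> [c v v' w|c v w w'];
  rewrite !(linB (mlift_lin _)) !(linZ (mlift_lin _)) !mliftU /= ?bl ?br
  addrAC addrK subrr.
Qed.

Definition tensor_lift : tensor V W -> Z :=
  qlift (fun p : V * W => b p.1 p.2).

Lemma tensor_lift_lin : lin tensor_lift.
Proof. exact: (qlift_lin tensor_rel_killed). Qed.

Lemma tensor_liftE v w : tensor_lift (tens v w) = b v w.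
Proof. exact: (qliftU tensor_rel_killed (v, w)). Qed.

End Elim.

Variables (f : V -> V) (g : W -> W).
Hypotheses (lf : lin f) (lg : lin g).

Let bl w : lin (fun v => tens (f v) (g w)).
Proof. exact: (lin_comp (tens_linl _) lf). Qed.
Let br v : lin (fun w => tens (f v) (g w)).
Proof. exact: (lin_comp (tens_linr _) lg). Qed.

Lemma tmapE v w : tmap f g (tens v w) = tens (f v) (g w).
Proof. exact: (tensor_liftE bl br). Qed.

Lemma tmap_lin : lin (tmap f g).
Proof. exact: (tensor_lift_lin bl br). Qed.

End Tensors.

(** * Exponentials of commuting operators *)

Section Exponentials.
Variables (C : numClosedFieldType) (V : lmodType C) (f : nat -> V -> V).
Hypothesis lf : forall r, lin (f r).

(** The coefficient of z^p in (\sum_(r >= 1) f r z^r)^j, a sum over the compositions of p into j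
    positive parts. *)
Fixpoint comps (j p : nat) (v : V) : V :=
  if j is j'.+1 then \sum_(r < p) f r.+1 (comps j' (p - r.+1) v)
  else if p == 0%N then v else 0.

Lemma compsS j p v :
  comps j.+1 p v = \sum_(r < p) f r.+1 (comps j (p - r.+1) v).
Proof. by []. Qed.

Lemma comps0 p v : comps 0 p v = if p == 0%N then v else 0.
Proof. by []. Qed.

Arguments comps : simpl never.

(** Splitting off the first entry of a tuple matches the recursion of [comps]. Any N > p bounds the
    entries, which lets the tail keep the same index type. *)
Lemma comps_tuple N j p v : (p < N)%N ->
  \sum_(t : j.-tuple 'I_N |
        (0%N \notin map val t) && (sumn (map val t) == p))
     foldr f v (map val t) = comps j p v.
Proof.
elim: j p => [|j IHj] p ltpN.
  rewrite comps0; case: (p =P 0%N) => [->|/eqP p0] /=; last first.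
    rewrite big_pred0 // => t.
    by rewrite tuple0 /= eq_sym (negPf p0) ?andbF.
  rewrite (big_pred1 [tuple]) // => t.
  by rewrite [t]tuple0 /=; apply/esym/eqP.
case: N ltpN IHj => // N ltpN IHj.
rewrite (reindex (fun q : 'I_N.+1 * j.-tuple 'I_N.+1 => cons_tuple q.1 q.2)); last first.
  exists (fun t => (thead t, behead_tuple t)) => t _.
    by case: t => x t; congr (_, _) => //; apply: val_inj.
  by rewrite [RHS]tuple_eta; apply: val_inj.
rewrite big_mkcond -(pair_bigA _ (fun i t =>
  if (0%N \notin map val (cons_tuple i t)) &&
     (sumn (map val (cons_tuple i t)) == p)
  then foldr f v (map val (cons_tuple i t)) else 0)) /=.
rewrite big_ord_recl /= [X in X + _]big1 ?add0r; last by [].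
rewrite compsS (big_ord_widen N (fun r => f r.+1 (comps j (p - r.+1) v))) //= [RHS]big_mkcond.
apply: eq_bigr => r _; rewrite /bump /= add1n -big_mkcond /=.
case: ifP => lerp; last first.
  rewrite big_pred0 // => t; apply/negP => /andP[_ /eqP E].
  by move: lerp; rewrite -E leq_addr.
rewrite -IHj; last by apply: leq_ltn_trans (leq_subr _ _) _.
rewrite (lin_sum (lf _)); apply: eq_bigl => t.
rewrite in_cons negb_or /=; congr (_ && _).
by set S := sumn _; apply/eqP/eqP; lia.
Qed.

Lemma expcoefE p v :
  expcoef f p v = \sum_(j < p.+1) j`!%:R^-1 *: comps j p v.
Proof. by apply: eq_bigr => j _; rewrite comps_tuple. Qed.

Lemma comps_gt j p v : (p < j)%N -> comps j p v = 0.
Proof.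
elim: j p => // j IHj p ltpj; rewrite compsS big1 // => r _.
by rewrite IHj ?(lin0 (lf _)) //; have := ltn_ord r; lia.
Qed.

Lemma comps_lin j p : lin (comps j p).
Proof.
elim: j p => [|j IHj] p.
  by move=> c x y; rewrite !comps0; case: ifP => _ //; rewrite scaler0 addr0.
apply: (@lin_lsum _ _ _ _ _ _ (fun (r : 'I_p) x => f r.+1 (comps j (p - r.+1) x))).
by move=> r _; apply: lin_comp.
Qed.

Lemma expcoef_lin p : lin (expcoef f p).
Proof.
move=> c x y; rewrite !expcoefE scaler_sumr -big_split; apply: eq_bigr => j _.
by rewrite comps_lin scalerDr !scalerA mulrC.
Qed.

Hypothesis fC : forall r s v, f r (f s v) = f s (f r v).

(* Multiplying by the weight p = r + (p - r) and using that all parts of a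
   composition play the same role. *)
Lemma comps_weight j p v :
  p%:R *: comps j.+1 p v =
  j.+1%:R *: \sum_(r < p) r.+1%:R *: f r.+1 (comps j (p - r.+1) v).
Proof.
elim: j p => [|j IHj] p.
  rewrite scale1r compsS scaler_sumr; apply: eq_bigr => r _; rewrite comps0.
  case: ifP => [/eqP|_]; last by rewrite (lin0 (lf _)) !scaler0.
  by move: (ltn_ord r) => lrp E; congr (_%:R *: _); lia.
pose F r s := f r (f s (comps j (p - r - s) v)).
pose bd p (r s : 'I_p) := (r.+1 + s.+1 <= p)%N.
have FF (g : nat -> C) (r : 'I_p) :
  \sum_(s < p - r.+1) g s.+1 *: f r.+1 (f s.+1 (comps j (p - r.+1 - s.+1) v)) =
  \sum_(s < p | bd _ r s) g s.+1 *: F r.+1 s.+1.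
  rewrite (big_ord_widen_cond p xpredT (fun s => g s.+1 *: F r.+1 s.+1));
    last by rewrite leq_subr.
  by apply: eq_bigl => s; rewrite /bd; have := ltn_ord r; lia.
transitivity (\sum_(r < p) r.+1%:R *: f r.+1 (comps j.+1 (p - r.+1) v)
   + \sum_(r < p) f r.+1 ((p - r.+1)%:R *: comps j.+1 (p - r.+1) v)).
  rewrite compsS scaler_sumr -big_split; apply: eq_bigr => r _.
  by rewrite /= (linZ (lf _)) -scalerDl -natrD subnKC.
rewrite -[j.+2]addn1 addrC natrD scalerDl scale1r; congr (_ + _).
transitivity (j.+1%:R *: \sum_(r < p) \sum_(s < p | bd _ r s) s.+1%:R *: F r.+1 s.+1).
  rewrite scaler_sumr; apply: eq_bigr => r _.
  rewrite -FF IHj !(linZ (lf _)) (lin_sum (lf _)); congr (_ *: _).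
  by apply: eq_bigr => s _; rewrite (linZ (lf _)).
congr (_ *: _); rewrite (exchange_big_dep xpredT) //=; apply: eq_bigr => s _.
rewrite (lin_sum (lf _)) scaler_sumr.
have := FF (fun=> s.+1%:R) s.
rewrite -!scaler_sumr => ->; rewrite !scaler_sumr.
apply: eq_big => r; first by rewrite /bd addnC.
by move=> _; rewrite /F fC subnAC.
Qed.

(** This is z d/dz applied to exp(\sum_r f r z^r). In characteristic 0 it determines all the
    coefficients from the one of index 0. *)
Lemma expcoef_newton p v :
  p%:R *: expcoef f p v =
  \sum_(r < p) r.+1%:R *: f r.+1 (expcoef f (p - r.+1) v).
Proof.
rewrite expcoefE big_ord_recl comps0 scalerDr.
have -> : p%:R *: (0`!%:R^-1 *: (if p == 0%N then v else 0)) = 0 :> V.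
  by case: ifP => [/eqP ->|_]; rewrite ?scale0r ?scaler0.
rewrite add0r scaler_sumr.
transitivity (\sum_(j < p) \sum_(r < p)
   j`!%:R^-1 *: (r.+1%:R *: f r.+1 (comps j (p - r.+1) v))).
  apply: eq_bigr => j _; rewrite lift0 scalerA mulrC -scalerA comps_weight.
  rewrite scalerA factS natrM invfM mulrAC mulVf ?pnatr_eq0 // mul1r.
  by rewrite scaler_sumr.
rewrite exchange_big; apply: eq_bigr => r _.
rewrite expcoefE (lin_sum (lf _)) scaler_sumr.
rewrite (big_ord_widen p (fun j => r.+1%:R *: f r.+1 (j`!%:R^-1 *:
   comps j (p - r.+1) v))); last by have := ltn_ord r; lia.
rewrite [RHS]big_mkcond; apply: eq_bigr => j _.
rewrite (linZ (lf _)) !scalerA mulrC; case: ifP => // lt.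
by rewrite comps_gt ?(lin0 (lf _)) ?scaler0 //; have := ltn_ord r; lia.
Qed.

(* The exponents are integers, with zero coefficients for the negative ones:
   this removes all bounds from the convolution identities. *)
Definition expz (n : int) (v : V) : V :=
  if n is Posz p then expcoef f p v else 0.

Lemma expz_lin n : lin (expz n).
Proof.
case: n => p /=; first exact: expcoef_lin.
by move=> c x y; rewrite scaler0 addr0.
Qed.

Lemma expz_neg n v : n < 0 -> expz n v = 0.
Proof. by case: n. Qed.

Lemma expz0 v : expz 0 v = v.
Proof. by rewrite -[LHS]/(expcoef f 0 v) expcoefE big_ord1 comps0 invr1 scale1r. Qed.

(** The terms with r + 1 > n vanish, so one bound B can serve recursions at several indices at
    once. *)
Lemma expz_newton (B : nat) (n : int) v : n <= B%:Z ->
  n%:~R *: expz n v =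
  \sum_(r < B) r.+1%:R *: f r.+1 (expz (n - r.+1%:Z) v).
Proof.
case: n => p leB; last first.
  rewrite scaler0 big1 // => r _.
  by rewrite expz_neg ?(lin0 (lf _)) ?scaler0 //; lia.
rewrite /= expcoef_newton.
rewrite (big_ord_widen_cond B xpredT
  (fun r => r.+1%:R *: f r.+1 (expcoef f (p - r.+1) v))) //=.
rewrite big_mkcond; apply: eq_bigr => r _; case: ifP => rp.
  by rewrite subzn.
by rewrite expz_neg ?(lin0 (lf _)) ?scaler0 //; lia.
Qed.

End Exponentials.

Arguments comps : simpl never.
Arguments expz : simpl never.

Lemma int_strong_ind (P : int -> Prop) :
  (forall n, n < 0 -> P n) ->
  (forall n : int, 0 <= n -> (forall m, m < n -> P m) -> P n) -> forall n, P n.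
Proof.
move=> Pneg Ppos n.
have [N nN] : exists N : nat, n < N%:Z by exists (absz n).+1; lia.
elim: N n nN => [|N IHN] n nN; first exact: Pneg.
case: (ltP n 0) => n0; first exact: Pneg.
by apply: Ppos => // m mn; apply: IHN; lia.
Qed.

Lemma int_ltind (P : int -> Prop) :
  (forall n, n < 0 -> P n) -> P 0 ->
  (forall n : int, 0 < n -> (forall m, m < n -> P m) -> P n) -> forall n, P n.
Proof.
move=> Pneg P0 Ppos; apply: int_strong_ind => // n n0 IHn.
by case: (ltrgtP n 0) n0 => [|n0 _|-> _] //; apply: Ppos.
Qed.

Lemma scaler_injZ (C : numClosedFieldType) (V : lmodType C) (n : int) (u v : V) :
  n != 0 -> (n%:~R : C) *: u = n%:~R *: v -> u = v.
Proof. by move=> n0; apply: scalerI; rewrite intr_eq0. Qed.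

(** * Commutation relations between exponentials *)

Section ExpCommutation.
Variables (C : numClosedFieldType) (V : lmodType C).

(** If g has commutator c z^(r+1) with the exponent F(z), then [g, exp F(z)] = c z^(r+1) exp F(z).
    Both sides are compared through Newton's recursion. *)
Lemma expz_heis (f : nat -> V -> V) (lf : forall r, lin (f r))
    (fC : forall r s v, f r (f s v) = f s (f r v))
    (g : V -> V) (lg : lin g) (r : nat) (c : C) :
  (forall s v, g (f s.+1 v) = f s.+1 (g v) + (if s == r then c *: v else 0)) ->
  forall n v,
  g (expz f n v) = expz f n (g v) + c *: expz f (n - r.+1%:Z) v.
Proof.
move=> gf n v; elim/int_ltind: n => [n n0||n n0 IHn].
- by rewrite !expz_neg ?(lin0 lg) ?scaler0 ?addr0 //; lia.
- by rewrite !(expz0 lf) expz_neg ?scaler0 ?addr0 //; lia.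
apply: (@scaler_injZ _ _ n); first by lia.
pose B := absz n; have nB : n <= B%:Z by lia.
rewrite -(linZ lg) (expz_newton lf fC _ nB) (lin_sum lg) scalerDr.
rewrite (expz_newton lf fC _ nB).
transitivity (\sum_(s < B) (s.+1%:R *: f s.+1 (expz f (n - s.+1%:Z) (g v))
   + s.+1%:R *: f s.+1 (c *: expz f ((n - r.+1%:Z) - s.+1%:Z) v)
   + (if s == r :> nat then (r.+1%:R * c) *: expz f (n - r.+1%:Z) v else 0))).
  apply: eq_bigr => s _; rewrite (linZ lg) gf IHn; last by lia.
  rewrite (linD (lf _)) !scalerDr [n - _ - _]addrAC.
  by case: eqP => [->|_]; rewrite ?scalerA // scaler0.
rewrite !big_split /= -addrA; congr (_ + _).
have nB' : n - r.+1%:Z <= B%:Z by lia.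
have -> : \sum_(s < B) s.+1%:R *: f s.+1 (c *: expz f ((n - r.+1%:Z) - s.+1%:Z) v)
   = c *: ((n - r.+1%:Z)%:~R *: expz f (n - r.+1%:Z) v).
  rewrite (expz_newton lf fC _ nB') scaler_sumr; apply: eq_bigr => s _.
  by rewrite (linZ (lf _)) !scalerA mulrC.
have -> : \sum_(s < B) (if s == r :> nat
      then (r.+1%:R * c) *: expz f (n - r.+1%:Z) v else 0)
   = (r.+1%:R * c) *: expz f (n - r.+1%:Z) v.
  case: (ltnP r B) => rB.
    by rewrite -big_mkcond (big_pred1 (Ordinal rB)).
  rewrite expz_neg ?scaler0; last by lia.
  by rewrite big1 // => s _; case: ifP.
rewrite !scalerA -scalerDl; congr (_ *: _).
by rewrite intrB -pmulrn; ring.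
Qed.

(** The case c = 0 of [expz_heis], used once for each exponential. *)
Lemma expz_commute (f g : nat -> V -> V)
    (lf : forall r, lin (f r)) (lg : forall r, lin (g r))
    (fC : forall r s v, f r (f s v) = f s (f r v))
    (gC : forall r s v, g r (g s v) = g s (g r v)) :
  (forall r s v, g r (f s v) = f s (g r v)) ->
  forall m n v, expz g m (expz f n v) = expz f n (expz g m v).
Proof.
move=> gf m n v; apply/esym.
rewrite (@expz_heis g lg gC _ (expz_lin lf n) 0 0).
  by rewrite scale0r addr0.
move=> s u; rewrite scale0r if_same addr0; apply/esym.
rewrite (@expz_heis f lf fC _ (lg s.+1) 0 0).
  by rewrite scale0r addr0.
by move=> s' u'; rewrite gf scale0r if_same addr0.
Qed.

Lemma expz_annihilated (f : nat -> V -> V) (lf : forall r, lin (f r))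
    (fC : forall r s v, f r (f s v) = f s (f r v)) v :
  (forall r, f r.+1 v = 0) ->
  forall n, expz f n v = if n == 0 then v else 0.
Proof.
move=> fv; elim/int_ltind => [n n0||n n0 IHn].
- by rewrite expz_neg // ifF //; apply/eqP; lia.
- by rewrite (expz0 lf).
rewrite ifF; last by apply/eqP; lia.
apply: (@scaler_injZ _ _ n); first by lia.
have nB : n <= (absz n)%:Z by lia.
rewrite (expz_newton lf fC _ nB) scaler0 big1 // => r _.
rewrite IHn; last by lia.
by case: ifP => _; rewrite ?fv ?(lin0 (lf _)) scaler0.
Qed.

(** Rescaling the operator of index r by z^r amounts to rescaling the formal variable. *)
Lemma expcoef_dilate (f g : nat -> V -> V)
    (lf : forall r, lin (f r)) (lg : forall r, lin (g r))
    (fC : forall r s v, f r (f s v) = f s (f r v))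
    (gC : forall r s v, g r (g s v) = g s (g r v)) (z : C) :
  (forall r v, g r.+1 v = z ^+ r.+1 *: f r.+1 v) ->
  forall p v, expcoef g p v = z ^+ p *: expcoef f p v.
Proof.
move=> gf p v; elim/ltn_ind: p => -[|p] IHp.
  by rewrite expr0 scale1r -[LHS]/(expz g 0 v) -[RHS]/(expz f 0 v) (expz0 lg) (expz0 lf).
apply: (@scaler_injZ _ _ p.+1%:Z) => //.
rewrite scalerA mulrC -scalerA -pmulrn !expcoef_newton // scaler_sumr.
apply: eq_bigr => r _; rewrite gf IHp; last by lia.
rewrite (linZ (lf _)) !scalerA; congr (_ *: _).
by rewrite mulrAC -mulrA -exprD mulrC subnK.
Qed.

Lemma expcoef_support (f : nat -> V -> V) (lf : forall r, lin (f r))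
    (fC : forall r s v, f r (f s v) = f s (f r v)) (M : nat) :
  (forall r v, ~~ (M %| r.+1)%N -> f r.+1 v = 0) ->
  forall p v, ~~ (M %| p)%N -> expcoef f p v = 0.
Proof.
move=> fM p v; elim/ltn_ind: p => -[|p] IHp Mp; first by rewrite dvdn0 in Mp.
apply: (@scaler_injZ _ _ p.+1%:Z) => //.
rewrite -pmulrn expcoef_newton // scaler0 big1 // => r _.
have [Mr|/fM ->] := boolP (M %| r.+1)%N; last by rewrite scaler0.
rewrite IHp ?(lin0 (lf _)) ?scaler0 //; first by lia.
by rewrite dvdn_subl ?ltn_ord.
Qed.

(** A Cauchy product: since G vanishes from B on, summing over the square or over the triangle gives
    the same result. *)
Lemma sum_convolution (B : nat) (a b : nat -> C) (G : nat -> V) :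
  (forall l, (B <= l)%N -> G l = 0) ->
  \sum_(r < B) \sum_(j < B) (a r * b j) *: G (j + r.+1)%N =
  \sum_(l < B) (\sum_(r < l) a r * b (l - r.+1)%N) *: G l.
Proof.
move=> GB.
transitivity (\sum_(r < B) \sum_(l < B | (r < l)%N) (a r * b (l - r.+1)%N) *: G l).
  apply: eq_bigr => r _.
  rewrite -(big_mkord (fun l => (r < l)%N) (fun l => (a r * b (l - r.+1)%N) *: G l)).
  rewrite -(big_mkord xpredT (fun j => (a r * b j) *: G (j + r.+1)%N)).
  rewrite (big_cat_nat (n := (B - r.+1)%N)) ?leq_subr //=.
  rewrite [X in _ + X]big_nat_cond [X in _ + X]big1 ?addr0; last first.
    by move=> j /andP[/andP[h _] _]; rewrite GB ?scaler0 //; lia.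
  rewrite [RHS](big_cat_nat (n := r.+1)) //=.
  rewrite [X in X + _]big_nat_cond [X in X + _]big1 ?add0r; last first.
    by move=> j /andP[/andP[_ h] h2]; move: h2; rewrite ltnNge -ltnS h.
  rewrite -[X in _ = \big[_/_]_(X <= _ < _ | _) _]add0n [RHS]big_addn [RHS]big_mkcond.
  by apply: eq_bigr => j _; rewrite addnK ifT // addnS ltnS leq_addl.
rewrite (exchange_big_dep xpredT) //=; apply: eq_bigr => l _.
rewrite scaler_suml (big_ord_widen B (fun r => (a r * b (l - r.+1)%N) *: G l)) //.
exact: ltnW.
Qed.

Section TwoExponentials.
Variables (f g : nat -> V -> V) (gam : nat -> C).
Hypotheses (lf : forall r, lin (f r)) (lg : forall r, lin (g r)).
Hypothesis fC : forall r s v, f r (f s v) = f s (f r v).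
Hypothesis gC : forall r s v, g r (g s v) = g s (g r v).
Hypothesis gf : forall r s v,
  g r.+1 (f s.+1 v) = f s.+1 (g r.+1 v) + (if s == r then gam r *: v else 0).

(** Exchanging exp G(w) and exp F(z) produces the scalar series exp(\sum_r gam r (zw)^(r+1)); its
    coefficients [kap] are characterized by their own Newton recursion. *)
Lemma expz_exchange (kap : nat -> C) : kap 0%N = 1 ->
  (forall p, p%:R * kap p = \sum_(r < p) (r.+1%:R * gam r) * kap (p - r.+1)%N) ->
  forall (q : int) (B : nat) (p : int) v, q < B%:Z ->
  expz g q (expz f p v) =
  \sum_(j < B) kap j *: expz f (p - j%:Z) (expz g (q - j%:Z) v).
Proof.
move=> kap0 kapN; elim/int_ltind => [q q0|/=|q q0 IHq] B p v qB.
- rewrite expz_neg // big1 // => j _; rewrite [X in expz f _ X]expz_neg; last by lia.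
  by rewrite (lin0 (expz_lin lf _)) scaler0.
- case: B qB => // B _; rewrite big_ord_recl big1 => [|j _].
    by rewrite !subr0 !(expz0 lg) addr0 kap0 scale1r.
  have jn : 0 - (lift ord0 j)%:Z < 0 by rewrite lift0; lia.
  by rewrite (expz_neg g _ jn) (lin0 (expz_lin lf _)) scaler0.
apply: (@scaler_injZ _ _ q); first by lia.
pose G l := expz f (p - l%:Z) (expz g (q - l%:Z) v).
have G0 l : (B <= l)%N -> G l = 0.
  by move=> Bl; rewrite /G [X in expz f _ X]expz_neg ?(lin0 (expz_lin lf _)) //; lia.
rewrite (expz_newton (B := B) lg gC) ?ltW //.
(* Newton's recursion in q and the induction hypothesis leave one operator g (r+1) to move past an
   exponential; [expz_heis] then creates the terms in [gam]. *)
transitivity (\sum_(r < B) \sum_(j < B)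
  ((kap j * r.+1%:R) *:
     expz f (p - j%:Z) (g r.+1 (expz g (q - j%:Z - r.+1%:Z) v))
   + (r.+1%:R * gam r * kap j) *: G (j + r.+1)%N)).
  apply: eq_bigr => r _; rewrite (IHq _ _ B) ?(lin_sum (lg _)); try by lia.
  rewrite scaler_sumr; apply: eq_bigr => j _.
  rewrite (linZ (lg _)) (expz_heis lf fC (lg _) (gf r)) !scalerDr !scalerA.
  rewrite /G PoszD !opprD !addrA (mulrC (kap j)) [q - r.+1%:Z - _]addrAC.
  by rewrite [_ * kap j * _]mulrAC.
rewrite exchange_big /=.
under eq_bigr do rewrite big_split /=.
rewrite big_split /= [X in _ + X]exchange_big /=.
rewrite (@sum_convolution B (fun r => r.+1%:R * gam r) kap G G0).
rewrite scaler_sumr -big_split; apply: eq_bigr => j _ /=.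
have -> : \sum_(i < B) (kap j * i.+1%:R) *:
     expz f (p - j%:Z) (g i.+1 (expz g (q - j%:Z - i.+1%:Z) v))
  = (kap j * (q - j%:Z)%:~R) *: G j.
  rewrite -scalerA -(linZ (expz_lin lf _)).
  rewrite (expz_newton (B := B) lg gC); last by lia.
  rewrite (lin_sum (expz_lin lf _)) scaler_sumr; apply: eq_bigr => i _.
  by rewrite (linZ (expz_lin lf _)) scalerA.
rewrite -kapN -scalerDl scalerA; congr (_ *: _).
by rewrite intrB -pmulrn; ring.
Qed.

(** The scalar series is itself an operator exponential, on the one-dimensional space. *)
Lemma kappa_exists : exists kap : nat -> C, kap 0%N = 1 /\
  (forall p, p%:R * kap p = \sum_(r < p) (r.+1%:R * gam r) * kap (p - r.+1)%N).
Proof.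
pose F r (z : C^o) : C^o := gam r.-1 * z.
have lF r : lin (F r).
  by move=> c x y; rewrite /F /GRing.scale /= mulrDr mulrCA.
exists (fun p => expcoef F p 1); split; first by rewrite -[LHS]/(expz F 0 1) (expz0 lF).
move=> p; rewrite -[LHS]/(p%:R *: expcoef F p (1 : C^o)) expcoef_newton //.
  by apply: eq_bigr => r _; rewrite /F /GRing.scale /= mulrA.
by move=> r s v; rewrite /F mulrCA.
Qed.

End TwoExponentials.
End ExpCommutation.

(** * The lattice and its isometry *)

Section LatticeFacts.
Variables (C : numClosedFieldType) (X : latticeData C).
Local Notation D := (rkL X).
Local Notation d := (ncyc X).
Local Notation s := (nuP X).
Local Notation eta := (eta X).
Local Notation k := (kper X).
Local Notation v := (vper X).
Local Notation L := 'rV[int]_D.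

Section AnyRing.
Variable F : comNzRingType.
Implicit Types x y z : 'rV[F]_D.

Lemma formDl x y z : form (x + y) z = form x z + form y z.
Proof. by rewrite /form /bform !mulmxDl mxE. Qed.

Lemma formDr x y z : form x (y + z) = form x y + form x z.
Proof. by rewrite /form /bform linearD mulmxDr mxE. Qed.

Lemma formZl c x y : form (c *: x) y = c * form x y.
Proof. by rewrite /form /bform -!scalemxAl mxE. Qed.

Lemma formZr c x y : form x (c *: y) = c * form x y.
Proof. by rewrite /form /bform linearZ /= -!scalemxAr mxE. Qed.

Lemma form0l y : form (0 : 'rV[F]_D) y = 0.
Proof. by rewrite -(scale0r 0) formZl mul0r. Qed.

Lemma form0r x : form x (0 : 'rV[F]_D) = 0.
Proof. by rewrite -(scale0r 0) formZr mul0r. Qed.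

Lemma form_suml (I : Type) (r : seq I) (P : pred I) (f : I -> 'rV[F]_D) y :
  form (\sum_(i <- r | P i) f i) y = \sum_(i <- r | P i) form (f i) y.
Proof. by elim/big_rec2: _ => [|i y1 y2 _ <-]; rewrite ?form0l ?formDl. Qed.

Lemma form_sumr (I : Type) (r : seq I) (P : pred I) x (f : I -> 'rV[F]_D) :
  form x (\sum_(i <- r | P i) f i) = \sum_(i <- r | P i) form x (f i).
Proof. by elim/big_rec2: _ => [|i y1 y2 _ <-]; rewrite ?form0r ?formDr. Qed.

Lemma formC x y : form x y = form y x.
Proof.
rewrite /form /bform -[in LHS](trmxK (x *m _ *m _)) mxE !trmx_mul trmxK mulmxA.
by rewrite map_trmx gram_sym.
Qed.

Lemma nu_add j x y : nu j (x + y) = nu j x + nu j y.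
Proof. exact: mulmxDl. Qed.

Lemma nuZ j c x : nu j (c *: x) = c *: nu j x.
Proof. by rewrite /nu /nuact -scalemxAl. Qed.

Lemma nu_sum j (I : Type) (r : seq I) (P : pred I) (f : I -> 'rV[F]_D) :
  nu j (\sum_(i <- r | P i) f i) = \sum_(i <- r | P i) nu j (f i).
Proof. exact: mulmx_suml. Qed.

Lemma nu0 x : nu 0 x = x.
Proof. by rewrite /nu /nuact expg0 perm_mx1 mulmx1. Qed.

Lemma nu_v x : nu v x = x.
Proof. by rewrite /nu /nuact expg_order perm_mx1 mulmx1. Qed.

Lemma form_nu j x y : form (nu j x) (nu j y) = form x y.
Proof.
elim: j x y => [|j IHj] x y; first by rewrite !nu0.
rewrite -add1n -!nuD -[RHS]IHj; move: (nu j x) (nu j y) => {}x {}y.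
rewrite /form /bform /nu /nuact expg1 trmx_mul !mulmxA; congr (fun_of_matrix (_ *m _) _ _).
rewrite -!mulmxA; congr (_ *m _); rewrite mulmxA tr_perm_mx -row_permE -col_permE.
by apply/matrixP => i j'; rewrite !mxE nu_isometry.
Qed.

End AnyRing.

Lemma form_ext (F : comNzRingType) (a b : L) :
  form (ext F a) (ext F b) = (form a b)%:~R.
Proof.
rewrite /form /bform /ext map_trmx -!map_mxM /= mxE.
congr (_%:~R); congr (fun_of_matrix (_ *m _ *m _) _ _).
by apply/matrixP => i j; rewrite mxE intz.
Qed.

Lemma ext_nu (F : comNzRingType) j (a : L) : ext F (nu j a) = nu j (ext F a).
Proof. by rewrite /ext /nu /nuact map_mxM map_perm_mx. Qed.

Lemma ext_add (F : comNzRingType) (a b : L) : ext F (a + b) = ext F a + ext F b.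
Proof. by apply/matrixP => i j; rewrite !mxE intrD. Qed.

Lemma ext0 (F : comNzRingType) : ext F (0 : L) = 0.
Proof. by apply/matrixP => i j; rewrite !mxE. Qed.

Lemma v_gt0 : (0 < v)%N. Proof. exact: order_gt0. Qed.

Lemma sum_periodic (V : zmodType) (n : nat) (g : nat -> V) :
  g n = g 0%N -> \sum_(j < n) g j.+1 = \sum_(j < n) g j.
Proof.
case: n => [|n] gn; first by rewrite !big_ord0.
by rewrite big_ord_recr big_ord_recl /= gn addrC.
Qed.

(** Equal to v <a_(0), b_(0)>, hence to half of k <a_(0), b_(0)>; it keeps all exponents and weights
    integral. *)
Definition Sv (a b : L) : int := \sum_(j < v) form (nu j a) b.

Lemma SvDl a b c : Sv (a + b) c = Sv a c + Sv b c.
Proof. by rewrite -big_split; apply: eq_bigr => j _; rewrite nu_add formDl. Qed.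

Lemma SvDr a b c : Sv a (b + c) = Sv a b + Sv a c.
Proof. by rewrite -big_split; apply: eq_bigr => j _; rewrite formDr. Qed.

Lemma Sv0r a : Sv a 0 = 0.
Proof. by rewrite /Sv big1 // => j _; rewrite form0r. Qed.

(** The isometry carries nu^j to the other argument as nu^(v-j), which permutes a period. *)
Lemma SvC a b : Sv a b = Sv b a.
Proof.
transitivity (\sum_(j < v) form (nu (v - j) b) a).
  apply: eq_bigr => j _; rewrite -[in RHS](form_nu j) nuD subnKC ?nu_v 1?formC //.
  exact: ltnW.
rewrite (reindex_inj rev_ord_inj) /=.
rewrite -[RHS](@sum_periodic _ v (fun i => form (nu i b) a)) ?nu_v ?nu0 //.
apply: eq_bigr => j _; congr (form (nu _ _) _).
by have := ltn_ord j; lia.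
Qed.

Lemma sum_k (V : zmodType) (g : nat -> V) :
  (forall j, g (v + j)%N = g j) -> \sum_(j < k) g j = (\sum_(j < v) g j) *+ 2.
Proof.
move=> gv; rewrite -(big_mkord xpredT g) /kper mul2n -addnn.
rewrite (big_cat_nat (n := v)) ?leq_addr //= mulr2n !big_mkord; congr (_ + _).
rewrite -[X in \big[_/_]_(X <= _ < _) _]add0n big_addn addnK big_mkord.
by apply: eq_bigr => j _; rewrite addnC gv.
Qed.

Section Fields.
Variable F : numFieldType.
Implicit Types x y : 'rV[F]_D.

Lemma kF : (k%:R : F) != 0. Proof. by rewrite pnatr_eq0 -lt0n kper_gt0. Qed.
Lemma vF : (v%:R : F) != 0. Proof. by rewrite pnatr_eq0 -lt0n v_gt0. Qed.

Lemma nu_proj0 j x : nu j (proj0 x) = proj0 x.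
Proof.
elim: j => [|j IHj]; first by rewrite nu0.
rewrite -[j.+1]addn1 -nuD nuZ nu_sum -[in RHS]IHj; congr (nu _ (_ *: _)).
rewrite -[RHS](@sum_periodic _ k (fun i => nu i x)) ?nu_k ?nu0 //.
by apply: eq_bigr => i _; rewrite nuD add1n.
Qed.

Lemma form_proj0 x y : form (proj0 x) (proj0 y) = form (proj0 x) y.
Proof.
rewrite [proj0 y]/proj0 formZr form_sumr.
rewrite (eq_bigr (fun=> form (proj0 x) y)); last first.
  by move=> j _; rewrite -[in LHS](nu_proj0 j x) form_nu.
by rewrite big_const_ord iter_addr_0 -[form _ _ *+ _]mulr_natl mulrA mulVf ?mul1r // kF.
Qed.

Lemma form_proj0_ext a b :
  form (proj0 (ext F a)) (ext F b) = (Sv a b)%:~R / v%:R.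
Proof.
rewrite /proj0 formZl form_suml.
have -> : \sum_(i < k) form (nu i (ext F a)) (ext F b)
        = (\sum_(i < k) form (nu i a) b)%:~R.
  by rewrite rmorph_sum; apply: eq_bigr => i _ /=; rewrite -ext_nu form_ext.
rewrite (@sum_k _ (fun i => form (nu i a) b)).
  rewrite /kper natrM rmorphMn /= -[X in _ * X]mulr_natl; field.
  exact: vF.
by move=> j; rewrite addnC -nuD nu_v.
Qed.

End Fields.

Lemma form0E (a b : L) : form0 a b = (Sv a b)%:~R / v%:R.
Proof. by rewrite /form0 form_proj0 form_proj0_ext. Qed.

Lemma homog_proj0 (x : 'rV[C]_D) : homog 0 (proj0 x).
Proof. by rewrite /homog nu_proj0 expr0z scale1r. Qed.

Lemma Nset_form_proj0 a (x : 'rV[C]_D) : Nset X a -> form (proj0 x) (ext C a) = 0.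
Proof. by move=> Na; rewrite formC; apply/Na/homog_proj0. Qed.

Lemma Nset_Sv a b : Nset X a -> Sv b a = 0.
Proof.
move=> Na; have := Nset_form_proj0 (ext C b) Na; rewrite form_proj0_ext => /eqP.
by rewrite mulf_eq0 invr_eq0 (negPf (vF _)) orbF intr_eq0 => /eqP.
Qed.

Lemma Nset0 : Nset X 0.
Proof. by move=> x _; rewrite ext0 form0l. Qed.

Lemma NsetD a b : Nset X a -> Nset X b -> Nset X (a + b).
Proof. by move=> Na Nb x hx; rewrite ext_add formDl Na ?Nb ?addr0. Qed.

Lemma NsetN a : Nset X a -> Nset X (- a).
Proof.
move=> Na x hx; rewrite -[RHS]oppr0 -(Na x hx) -[RHS]mulN1r -formZl scaleN1r.
by congr (form _ _); apply/matrixP => i j; rewrite !mxE mulrNz.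
Qed.

(** A vector fixed by nu pairs equally with a and nu^j a. Hence a basis element may be replaced by
    its orbit representative modulo N. *)
Lemma Nset_nu j a : Nset X (nu j a - a).
Proof.
move=> x /eqP hx.
have hj : nu j x = x.
  elim: j => [|j IHj]; first by rewrite nu0.
  by rewrite -[j.+1]addn1 -nuD hx expr0z scale1r IHj.
rewrite ext_add formDl ext_nu -[in form (nu j _) x]hj form_nu -formDl -ext_add.
by rewrite subrr ext0 form0l.
Qed.

Section Projections.
Implicit Types (x y : 'rV[C]_D) (n : int).

Lemma hproj_lin n : lin (@hproj C X n).
Proof.
move=> c x y; rewrite /hproj scalerA mulrC -scalerA -scalerDr; congr (_ *: _).
rewrite scaler_sumr -big_split; apply: eq_bigr => j _ /=.
by rewrite nu_add nuZ scalerDr !scalerA mulrC.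
Qed.

Lemma hproj_nu n j x : hproj n (nu j x) = nu j (hproj n x).
Proof.
rewrite /hproj nuZ nu_sum; congr (_ *: _); apply: eq_bigr => i _.
by rewrite nuZ !nuD addnC.
Qed.

Lemma nu_hproj n j x : nu j (hproj n x) = eta ^ (n * j%:Z) *: hproj n x.
Proof.
elim: j => [|j IHj]; first by rewrite nu0 mulr0 expr0z scale1r.
rewrite -[j.+1]addn1 -nuD (eqP (hproj_homog n x)) nuZ IHj scalerA.
by rewrite -expfzDr ?eta_neq0 // PoszD mulrDr mulr1 addrC.
Qed.

(** Distinct eigenspaces are orthogonal unless their degrees are opposite, so a vector of degree n
    sees only the component of y of degree -n. *)
Lemma form_hproj n x y :
  form (hproj n x) (hproj (- n) y) = form (hproj n x) y.
Proof.
rewrite {2}/hproj formZr form_sumr.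
rewrite (eq_bigr (fun=> form (hproj n x) y)); last first.
  move=> j _; rewrite formZr -[RHS](form_nu j) nu_hproj (formZl (eta ^ _)).
  by rewrite mulNr opprK.
by rewrite big_const_ord iter_addr_0 -[form _ _ *+ _]mulr_natl mulrA mulVf ?mul1r // kF.
Qed.

Lemma form_hprojl n x y : form (hproj n x) y =
  k%:R^-1 * \sum_(j < k) eta ^ (- (n * j%:Z)) * form (nu j x) y.
Proof.
by rewrite formZl form_suml; congr (_ * _); apply: eq_bigr => j _; rewrite formZl.
Qed.

End Projections.

Lemma nu_alpha j i : nu j (alpha i : L) = alpha ((s ^+ j)%g i).
Proof. by rewrite /nu /nuact /alpha -rowE; apply/rowP => i'; rewrite !mxE eqxx eq_sym. Qed.

(** * Cycles of the isometry and sums of roots of unity *)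

Section Cycles.

Lemma rep_val r : val (rep X r) = (\sum_(r' < d | (r' < r)%N) len X r')%N.
Proof. by have := nu_cycles (len_gt0 r); rewrite expg0 perm1 addn0. Qed.

Lemma cycle_pow r j : ((s ^+ j)%g (rep X r) = (s ^+ (j %% len X r))%g (rep X r)).
Proof.
rewrite {1}(divn_eq j (len X r)) expgD permM mulnC expgM.
congr (_ _); elim: (_ %/ _)%N => [|q IHq]; first by rewrite expg0 perm1.
by rewrite expgSr permM IHq nu_cycles_closed.
Qed.

Lemma offset_mono (r r' : 'I_d) : (r < r')%N ->
  (\sum_(i < d | (i < r)%N) len X i + len X r <=
   \sum_(i < d | (i < r')%N) len X i)%N.
Proof.
move=> rr'; rewrite [leqRHS](bigD1 r) //= addnC leq_add2l.
rewrite big_mkcond [leqRHS]big_mkcond /=; apply: leq_sum => i _.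
case: ifP => // ir; rewrite ifT // (ltn_trans ir rr') /=.
by apply: contraTneq ir => ->; rewrite ltnn.
Qed.

(** The cycles occupy disjoint consecutive blocks of indices, and after reducing j modulo l_r the
    position inside the block is the remainder. *)
Lemma cycle_pow_eq r r' j : ((s ^+ j)%g (rep X r) == rep X r') =
  (r == r') && (len X r %| j)%N.
Proof.
apply/eqP/andP => [/(congr1 val)|[/eqP <- /eqP E]]; last first.
  by rewrite cycle_pow E expg0 perm1.
have jl := ltn_pmod j (len_gt0 r).
rewrite cycle_pow nu_cycles // rep_val => E.
have [rr'|rr'|/val_inj rr'] := ltngtP r r'.
- by have := offset_mono rr'; lia.
- have := offset_mono rr'; have := len_gt0 r'; lia.
by split; [rewrite rr'|rewrite /dvdn; move: E; rewrite rr'; lia].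
Qed.

(** The blocks have total length D, so some block contains i, and its offset in the block is the
    exponent. *)
Lemma cycle_cover (i : 'I_D) : exists r j, i = (s ^+ j)%g (rep X r).
Proof.
pose off (n : nat) := (\sum_(r' < d | (r' < n)%N) len X r')%N.
have offS (r : 'I_d) : off r.+1 = (off r + len X r)%N.
  rewrite /off (bigD1 r) //= addnC; congr (_ + _)%N; apply: eq_bigl => r'.
  by rewrite ltnS leq_eqVlt -val_eqE /=; case: ltngtP.
have off0 : off 0%N = 0%N by rewrite /off big_pred0.
have offd : off d = D.
  by rewrite -(len_sum X); apply: eq_bigl => r; rewrite ltn_ord.
have [n [nd oi io]] : exists n, [/\ (n < d)%N, (off n <= i)%N & (i < off n.+1)%N].
  have : (i < off d)%N by rewrite offd ltn_ord.
  elim: {1 2}d => [|n IHn]; first by rewrite off0.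
  case: (ltnP i (off n)) => [/IHn [m [mn h1 h2]] _|oi io]; last by exists n.
  by exists m; split => //; exact: ltnW.
exists (Ordinal nd), (i - off n)%N; apply: val_inj.
rewrite nu_cycles /= -/(off n) ?subnKC //.
by rewrite -(ltn_add2l (off n)) subnKC // -(offS (Ordinal nd)).
Qed.

Lemma len_dvd_v r : (len X r %| v)%N.
Proof.
by have := cycle_pow_eq r r v; rewrite expg_order perm1 !eqxx /= => <-.
Qed.

(** The step 1 / l_r measured in units of 1 / k: the component of degree n of alpha^(r) vanishes
    unless this number divides n. *)
Definition Mper (r : 'I_d) : nat := (k %/ len X r)%N.

Lemma Mper_len r : (Mper r * len X r)%N = k.
Proof. by rewrite divnK // dvdn_mull // len_dvd_v. Qed.

Lemma Mper_gt0 r : (0 < Mper r)%N.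
Proof. by have := kper_gt0 X; rewrite -(Mper_len r) muln_gt0 => /andP[]. Qed.

Lemma eta_Mper r (n : int) : (eta ^ (n * (len X r)%:Z) == 1) = (Mper r %| absz n)%N.
Proof.
have e1 (m : nat) : (eta ^ (m%:Z * (len X r)%:Z) == 1) = (Mper r %| m)%N.
  rewrite -PoszM -exprnP -(prim_order_dvd (eta_prim X)) -[(2 * _)%N]/k.
  by rewrite -(Mper_len r) dvdn_pmul2r // len_gt0.
case: (intP n) => [|m|m]; rewrite ?e1 //.
by rewrite mulNr -invr_expz invr_eq1 e1 abszN.
Qed.

(** On the component of degree n, nu^(l_r) is both the identity and the scalar eta^(n l_r), which
    differs from 1. *)
Lemma hproj_support r n (x : 'rV[C]_D) : nu (len X r) x = x ->
  ~~ (Mper r %| absz n)%N -> hproj n x = 0.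
Proof.
move=> xl; rewrite -eta_Mper => e1; apply/eqP; apply: contraNT e1 => x0.
have := nu_hproj n (len X r) x; rewrite -hproj_nu xl => /esym/eqP.
by rewrite -subr_eq0 -{2}[hproj _ _]scale1r -scalerBl scaler_eq0 (negPf x0) orbF subr_eq0.
Qed.

Lemma nu_len_alphar r : nu (len X r) (alphar X r) = alphar X r.
Proof. by rewrite /alphar nu_alpha nu_cycles_closed. Qed.

(** What remains is a geometric sum of powers of z = eta^(- n l_r), a root of unity of order
    dividing [Mper r]. *)
Lemma sum_eta r (n : int) :
  \sum_(j < k) (if (len X r %| j)%N then eta ^ (- (n * j%:Z)) else 0) =
  if (Mper r %| absz n)%N then (Mper r)%:R else 0.
Proof.
pose z := eta ^ (- (n * (len X r)%:Z)).
have -> : \sum_(j < k) (if (len X r %| j)%N then eta ^ (- (n * j%:Z)) else 0)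
  = \sum_(q < Mper r) z ^+ q.
  rewrite -big_mkcond -(big_mkord (fun j => len X r %| j)%N
    (fun j => eta ^ (- (n * j%:Z)))).
  rewrite -(Mper_len r) mulnC.
  elim: (Mper r) => [|M IHM]; first by rewrite muln0 big_nil big_ord0.
  rewrite big_ord_recr /= -IHM mulnS addnC (big_cat_nat (n := (len X r * M)%N)) ?leq_addr //=.
  congr (_ + _); rewrite big_ltn_cond; last by rewrite -[ltnLHS]addn0 ltn_add2l len_gt0.
  rewrite dvdn_mulr // [X in _ + X]big_nat_cond [X in _ + X]big_pred0 ?addr0.
    by rewrite /z exprnP exprz_exp PoszM mulNr mulrA.
  move=> j; apply/negP => /andP[/andP[h1 h2]] /dvdnP[q E].
  move: h1 h2; rewrite E [(q * _)%N]mulnC -mulnSr !ltn_pmul2l ?len_gt0 //; lia.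
have zM : z ^+ Mper r = 1.
  rewrite exprnP exprz_exp.
  have -> : - (n * (len X r)%:Z) * (Mper r)%:Z = k%:Z * - n.
    by rewrite -(Mper_len r) PoszM; ring.
  by rewrite -exprz_exp -exprnP eta_k exp1rz.
rewrite -eta_Mper -(invr_eq1 (eta ^ _)) invr_expz -/z.
case: eqP => [->|/eqP z1].
  by rewrite (eq_bigr (fun=> 1)) => [|q _]; rewrite ?expr1n // sumr_const card_ord.
apply/(mulfI (x := z - 1)); first by rewrite subr_eq0.
by rewrite -subrX1 zM subrr mulr0.
Qed.

End Cycles.
End LatticeFacts.

(** * Nondegeneracy and the dual basis *)

Section DualBasis.
Variables (C : numClosedFieldType) (X : latticeData C).
Local Notation D := (rkL X).

(** A rational vector in the kernel, cleared of denominators, would be a nonzero lattice vector of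
    norm 0. *)
Lemma gram_det_neq0 : \det (gram X) != 0.
Proof.
apply/negP => /eqP det0.
have : \det (map_mx intr (gram X) : 'M[rat]_D) == 0 by rewrite det_map_mx det0.
move=> /det0P[x x0 xG].
pose N := \prod_(j < D) denq (x 0 j).
have N0 : (N%:~R : rat) != 0.
  by rewrite intr_eq0; apply/prodf_neq0 => j _; apply: denq_neq0.
pose w : 'rV[int]_D := \row_j (numq (x 0 j) * \prod_(i < D | i != j) denq (x 0 i)).
have wE : ext rat w = N%:~R *: x.
  apply/rowP => j; rewrite !mxE /N [in RHS](bigD1 j) //=.
  rewrite !intrM mulrAC; congr (_ * _).
  by rewrite -[X in _ = _ * X]divq_num_den mulrCA divff ?mulr1 // intr_eq0 denq_neq0.
have w0 : w != 0.
  apply: contraNneq x0 => w0; move: wE; rewrite w0 ext0 => /esym/eqP.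
  by rewrite scaler_eq0 (negPf N0).
have : form w w = 0.
  apply/eqP; rewrite -(intr_eq0 rat) -form_ext wE formZl formZr /form /bform xG.
  by rewrite mul0mx mxE !mulr0.
by have := gram_posdef w0 => /[swap]; rewrite /form => ->; rewrite ltxx.
Qed.

Lemma form_lam (i : 'I_(ncyc X)) j :
  form (lam i) (ext C (alpha j)) = (rep X i == j)%:R.
Proof.
rewrite /form /bform /lam -row_mul mulVmx; last first.
  by rewrite unitmxE det_map_mx unitfE intr_eq0 gram_det_neq0.
rewrite mxE (bigD1 j) //= big1 ?addr0 => [|j' j'j].
  by rewrite !mxE !eqxx mulr1.
by rewrite !mxE (negPf j'j) andbF mulr0.
Qed.

End DualBasis.

(** * The Heisenberg module *)

Section Heisenberg.
Variables (C : numClosedFieldType) (X : latticeData C).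
Local Notation D := (rkL X).
Local Notation k := (kper X).
Local Notation h := 'rV[C]_D.
Local Notation letter := (letter X).
Local Notation Snu := (Snu X).

(* Locked so that unification does not compare words by unfolding the
   free module. *)
Definition word : seq letter -> Snu :=
  locked (fun w => \pi_Snu << w >> : Snu).

Lemma wordE w : word w = \pi_Snu << w >>.
Proof. by rewrite /word -lock. Qed.

Lemma word_lin u w (z : C) (a b c : letter) :
  lmode a = lmode c -> lmode b = lmode c -> lvec c = z *: lvec a + lvec b ->
  word (u ++ c :: w) = z *: word (u ++ a :: w) + word (u ++ b :: w).
Proof.
move=> ac bc E; apply/eqP; rewrite -subr_eq0 opprD addrA; apply/eqP.
have := pi_eq0 (HeisLin u w ac bc E).
by rewrite !(linB (pi_lin _)) (linZ (pi_lin _)) !wordE.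
Qed.

Lemma word_comm u w (a b : letter) :
  word (u ++ a :: b :: w) = word (u ++ b :: a :: w) + bracket a b *: word (u ++ w).
Proof.
apply/eqP; rewrite -subr_eq0 opprD addrA; apply/eqP.
have := pi_eq0 (HeisComm u w a b).
by rewrite !(linB (pi_lin _)) (linZ (pi_lin _)) !wordE.
Qed.

Lemma word_vac u (a : letter) : 0 <= lmode a -> word (rcons u a) = 0.
Proof. by rewrite wordE => /(HeisVac u)/pi_eq0. Qed.

Definition svac : Snu := word [::].

Section Action.
Implicit Types (x y : h) (n m : int) (u : Snu).

(** The relations are stable under adding a letter in front, so left multiplication descends to the
    quotient. *)
Lemma heis_prefix (a : letter) g : heis_rel g ->
  mlift (fun w => word (a :: w)) g = 0.
Proof.
case=> [u w z b c e be ce E|u w b c|u b b0].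
- rewrite !(linB (mlift_lin _)) (linZ (mlift_lin _)) !mliftU.
  by rewrite (@word_lin (a :: u) _ _ _ _ _ be ce E) addrAC addrK subrr.
- rewrite !(linB (mlift_lin _)) (linZ (mlift_lin _)) !mliftU.
  by rewrite (@word_comm (a :: u)) addrAC addrK subrr.
by rewrite mliftU (@word_vac (a :: u)).
Qed.

Lemma hact_qlift x n : hact x n = qlift (fun w => word (hletter x n :: w)).
Proof. by apply/funext => u; congr (qlift _ u); apply/funext => w; rewrite wordE. Qed.

Lemma hactE x n w : hact x n (word w) = word (hletter x n :: w).
Proof. by rewrite hact_qlift [word w]wordE (qliftU (@heis_prefix (hletter x n))). Qed.

Lemma hact_lin x n : lin (hact x n).
Proof. by rewrite hact_qlift; apply: (qlift_lin (@heis_prefix (hletter x n))). Qed.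

Lemma lmode_hletter x n : lmode (hletter x n) = n.
Proof. by rewrite /lmode /hletter SubK. Qed.

Lemma lvec_hletter x n : lvec (hletter x n) = hproj n x.
Proof. by rewrite /lvec /hletter SubK. Qed.

Lemma hact_linl c x y n u :
  hact (c *: x + y) n u = c *: hact x n u + hact y n u.
Proof.
apply: (lquot_eq_lin (f := hact (c *: x + y) n)
  (g := fun u => c *: hact x n u + hact y n u)).
- exact: hact_lin.
- exact: (lin_add (lin_scale _ (hact_lin _ _)) (hact_lin _ _)).
move=> w; rewrite -wordE !hactE (@word_lin [::] w c (hletter x n) (hletter y n)) //;
  by rewrite ?lmode_hletter // !lvec_hletter hproj_lin.
Qed.

Lemma hact0 n u : hact 0 n u = 0.
Proof.
have := hact_linl 1 0 0 n u; rewrite !scale1r add0r => E.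
by apply: (addrI (hact 0 n u)); rewrite -E addr0.
Qed.

Lemma hactZ c x n u : hact (c *: x) n u = c *: hact x n u.
Proof. by rewrite -[c *: x]addr0 hact_linl hact0 addr0. Qed.

Lemma hact_hproj x y n u : hproj n x = hproj n y -> hact x n u = hact y n u.
Proof.
move=> E; have El : hletter x n = hletter y n.
  by apply: val_inj; rewrite /hletter !SubK E.
by rewrite !hact_qlift El.
Qed.

Lemma hact_comm x y m n u : hact x m (hact y n u) = hact y n (hact x m u) +
  (if m + n == 0 then form (hproj m x) (hproj n y) * (m%:~R / k%:R) else 0) *: u.
Proof.
apply: (lquot_eq_lin (f := fun u => hact x m (hact y n u)) (g := fun u =>
  hact y n (hact x m u) +
  (if m + n == 0 then form (hproj m x) (hproj n y) * (m%:~R / k%:R) else 0) *: u)).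
- exact: (lin_comp (hact_lin _ _) (hact_lin _ _)).
- exact: (lin_add (lin_comp (hact_lin _ _) (hact_lin _ _))
                  (lin_scale _ (@lin_id _ _))).
move=> w; rewrite -wordE !hactE (@word_comm [::]).
by rewrite /bracket !lmode_hletter !lvec_hletter.
Qed.

Lemma hact_vac x n : 0 <= n -> hact x n svac = 0.
Proof. by move=> n0; rewrite hactE (@word_vac [::]) // lmode_hletter. Qed.

End Action.

(* The vacuum expectation value, computed by Wick's theorem: a letter of
   positive mode is contracted with each of the letters to its right. *)
Section Wick.
Implicit Types (a b c x y : letter) (u w : seq letter) (phi psi : seq letter -> C).

Definition wick a b : C := if 0 < lmode a then bracket a b else 0.

Fixpoint contract a phi w : C :=
  if w is b :: w' then wick a b * phi w' + contract a (fun r => phi (b :: r)) w'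
  else 0.

(** Contraction passes on words that are shorter but not subterms, hence the fuel; the default 0 is
    never reached when the fuel exceeds the length. *)
Fixpoint wick_fuel n w : C :=
  if n is n'.+1 then (if w is a :: w' then contract a (wick_fuel n') w' else 1)
  else 0.

Definition vev w := wick_fuel (size w).+1 w.

Lemma eq_contract a phi psi w :
  (forall r, (size r < size w)%N -> phi r = psi r) ->
  contract a phi w = contract a psi w.
Proof.
elim: w phi psi => [|b w IHw] phi psi E //=.
by rewrite E //; congr (_ + _); apply: IHw => r rw; apply: E.
Qed.

Lemma wick_fuelE n m w : (size w < n)%N -> (size w < m)%N ->
  wick_fuel n w = wick_fuel m w.
Proof.
elim: n m w => // n IHn [|m] [|a w] //= wn wm.
by apply: eq_contract => r rw; apply: IHn; lia.
Qed.

Lemma vev_cons a w : vev (a :: w) = contract a vev w.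
Proof.
rewrite -[LHS]/(contract a (wick_fuel (size w).+1) w).
by apply: eq_contract => r rw; apply: wick_fuelE => //; apply: ltnW.
Qed.

Lemma contract_lin a z phi psi w :
  contract a (fun r => z * phi r + psi r) w =
  z * contract a phi w + contract a psi w.
Proof.
elim: w phi psi => [|b w IHw] phi psi /=; first by rewrite mulr0 addr0.
by rewrite IHw; ring.
Qed.

Lemma contractC a b phi w :
  contract a (contract b phi) w = contract b (contract a phi) w.
Proof.
elim: w phi => [|c w IHw] phi //=.
rewrite !(@contract_lin _ (wick _ c) phi) IHw; ring.
Qed.

Section Linearity.
Variables (z : C) (a b c : letter).
Hypotheses (ac : lmode a = lmode c) (bc : lmode b = lmode c).
Hypothesis E : lvec c = z *: lvec a + lvec b.

Lemma wick_linl x : wick c x = z * wick a x + wick b x.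
Proof.
rewrite /wick /bracket ac bc E formDl formZl.
case: (0 < lmode c); last by rewrite mulr0 addr0.
by case: (_ + _ == 0); ring.
Qed.

Lemma wick_linr x : wick x c = z * wick x a + wick x b.
Proof.
rewrite /wick /bracket ac bc E formDr formZr.
case: (0 < lmode x); last by rewrite mulr0 addr0.
by case: (_ + _ == 0); ring.
Qed.

Lemma contract_linl phi w :
  contract c phi w = z * contract a phi w + contract b phi w.
Proof.
elim: w phi => [|x w IHw] phi /=; first by rewrite mulr0 addr0.
by rewrite wick_linl IHw; ring.
Qed.

(** Bounding the prefix u allows an induction on its length: contracting the first letter of a word
    refers only to values on shorter prefixes. *)
Let linear_upto n phi := forall u w, (size u <= n)%N ->
  phi (u ++ c :: w) = z * phi (u ++ a :: w) + phi (u ++ b :: w).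

Lemma contract_linear n phi x : linear_upto n phi -> linear_upto n (contract x phi).
Proof.
move=> + u; elim: u n phi => [|y u IHu] n phi lphi w un /=.
  rewrite wick_linr (@eq_contract x _ (fun r => z * phi (a :: r) + phi (b :: r))).
    by rewrite contract_lin; ring.
  by move=> r _; apply: (lphi [::]).
case: n lphi un => // n lphi un.
rewrite lphi; last exact: ltnW.
rewrite (IHu n (fun r => phi (y :: r))) //; first by ring.
by move=> u' w' u'n; apply: (lphi (y :: u')).
Qed.

Lemma vev_linear u w :
  vev (u ++ c :: w) = z * vev (u ++ a :: w) + vev (u ++ b :: w).
Proof.
have : linear_upto (size u) vev; last by apply.
elim: (size u) => [|n IHn] {w}[|x {}u] w //= un; rewrite !vev_cons.
- exact: contract_linl.
- exact: contract_linl.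
exact: contract_linear IHn _ _ _.
Qed.

End Linearity.

(** The bracket is antisymmetric and vanishes unless the modes are opposite; then at most one is
    positive, and if both are 0 the bracket is 0. *)
Lemma wick_bracket a b : wick a b = wick b a + bracket a b.
Proof.
rewrite /wick /bracket [_ b + _ a]addrC; case: eqP => [E|_]; last by rewrite !if_same addr0.
rewrite (formC (lvec b)); have [a0|a0|a0] := ltrgtP (lmode a) 0.
- have -> : lmode b = - lmode a by lia.
  by rewrite oppr_gt0 a0 mulrNz; ring.
- by rewrite ifF ?add0r //; apply/negP; lia.
by rewrite ifF ?add0r ?a0 ?mul0r ?mulr0 //; apply/negP; lia.
Qed.

Let comm_upto a b n phi := forall u w, (size u <= n)%N ->
  phi (u ++ a :: b :: w) = phi (u ++ b :: a :: w) + bracket a b * phi (u ++ w).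

Lemma contract_comm a b n phi x :
  comm_upto a b n phi -> comm_upto a b n (contract x phi).
Proof.
move=> + u; elim: u n phi => [|y u IHu] n phi cphi w un /=.
  rewrite (@eq_contract x _ (fun r => bracket a b * phi r + phi [:: b, a & r])).
    by rewrite contract_lin; ring.
  by move=> r _; rewrite (cphi [::]) // addrC.
case: n cphi un => // n cphi un.
rewrite cphi; last exact: ltnW.
rewrite (IHu n (fun r => phi (y :: r))) //; first by ring.
by move=> u' w' u'n; apply: (cphi (y :: u')).
Qed.

Lemma vev_comm a b u w :
  vev (u ++ a :: b :: w) = vev (u ++ b :: a :: w) + bracket a b * vev (u ++ w).
Proof.
have : comm_upto a b (size u) vev; last by apply.
(* Contractions of a and b with letters further right may be done in either order; only the pairing
   of a with b distinguishes the two words. *)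
have base w' : vev [:: a, b & w'] = vev [:: b, a & w'] + bracket a b * vev w'.
  rewrite !vev_cons /= (@eq_contract a _ (contract b vev)); last first.
    by move=> r _; rewrite vev_cons.
  rewrite [contract b _ w'](@eq_contract b _ (contract a vev)); last first.
    by move=> r _; rewrite vev_cons.
  by rewrite contractC wick_bracket; ring.
elim: (size u) => [|n IHn] {w}[|x {}u] w //= un; rewrite !vev_cons.
exact: contract_comm IHn _ _ _.
Qed.

(** A last letter of nonnegative mode has nothing to its right, and a letter of positive mode to its
    left has zero bracket with it. *)
Lemma vev_vac u a : 0 <= lmode a -> vev (rcons u a) = 0.
Proof.
move=> a0; have wa x : wick x a = 0.
  by rewrite /wick /bracket; case: ifP => // x0; rewrite ifF //; apply/eqP; lia.
pose vac_upto n phi := forall u, (size u <= n)%N -> phi (rcons u a) = 0.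
have cvac n phi x : vac_upto n phi -> vac_upto n (contract x phi).
  move=> + {}u; elim: u n phi => [|y u IHu] n phi vphi un /=.
    by rewrite wa mul0r addr0.
  case: n vphi un => // n vphi un; rewrite vphi ?mulr0 ?add0r; last exact: ltnW.
  by apply: (IHu n) => // u' u'n; apply: (vphi (y :: u')).
have : vac_upto (size u) vev; last by apply.
elim: (size u) => [|n IHn] [|x {}u] //= un; rewrite vev_cons //.
exact: cvac IHn _ _.
Qed.

Lemma vev_rel g : heis_rel g -> mlift (V := C^o) vev g = 0.
Proof.
case=> [u w z b c e be ce E|u w b c|u b b0].
- rewrite !(linB (mlift_lin _)) (linZ (mlift_lin _)) !mliftU.
  rewrite (vev_linear be ce E) /GRing.scale /=; ring.
- rewrite !(linB (mlift_lin _)) (linZ (mlift_lin _)) !mliftU.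
  rewrite vev_comm /GRing.scale /=; ring.
by rewrite mliftU vev_vac.
Qed.

(** This certifies that the relations do not collapse the vacuum to 0. *)
Lemma vacuum_functional : exists2 psi : Snu -> C^o, lin psi & psi svac = 1.
Proof.
exists (qlift (V := C^o) vev); first exact: (qlift_lin vev_rel).
by rewrite /svac wordE; exact: (qliftU vev_rel).
Qed.

End Wick.
End Heisenberg.

(** Membership is [List.In] because the index type carries no decidable equality. *)
Lemma lspan_family (C : fieldType) (V : lmodType C) (I : Type) (T : set I)
    (f : I -> V) v : lspan (f @` T) v ->
  exists s : seq (C * I), (forall i, List.In i s -> T i.2) /\
    v = \sum_(p <- s) p.1 *: f p.2.
Proof.
move=> [s [Ts ->]]; elim: s Ts => [|p s IHs] Ts.
  by exists [::]; rewrite !big_nil.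
have [s' [Ts' E]] := IHs (fun q qs => Ts q (mem_behead (s := p :: s) qs)).
have [i Ti Ei] := Ts p (mem_head _ _).
exists ((p.1, i) :: s'); split=> [q /= [<-|/Ts']|] //.
by rewrite !big_cons E Ei.
Qed.

Lemma perm_foldr (T : eqType) (Z : Type) (f : T -> Z -> Z) (z : Z) :
  (forall x y u, f x (f y u) = f y (f x u)) ->
  forall s t, perm_eq s t -> foldr f z s = foldr f z t.
Proof.
move=> fC; elim=> [|x s IHs] t; first by rewrite perm_sym => /perm_nilP ->.
move=> st; have xt : x \in t by rewrite -(perm_mem st) mem_head.
move: st; case/splitPr: xt => u w; rewrite perm_sym perm_catC /= perm_cons => st.
rewrite /= (IHs (u ++ w)); last by rewrite perm_sym perm_catC.
by elim: u {st} => //= y u <-; rewrite fC.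
Qed.

(** * Products of the modes of E^- *)

Section FockSpace.
Variables (C : numClosedFieldType) (X : latticeData C).
Local Notation D := (rkL X).
Local Notation d := (ncyc X).
Local Notation eta := (eta X).
Local Notation k := (kper X).
Local Notation h := 'rV[C]_D.
Local Notation Snu := (Snu X).
Implicit Types (a b : h) (u : Snu) (p q n : int).

(** With these exponents [Ep] and [Em] at a natural index are convertible to [Eplus] and
    [Eminus]. *)
Definition fplus a (r : nat) u : Snu := - (k%:R / r%:R) *: hact a r%:Z u.
Definition fminus a (r : nat) u : Snu := (k%:R / r%:R) *: hact a (- r%:Z) u.
Definition Ep a : int -> Snu -> Snu := expz (fplus a).
Definition Em a : int -> Snu -> Snu := expz (fminus a).

Lemma fplus_lin a r : lin (fplus a r).
Proof. exact/lin_scale/hact_lin. Qed.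

Lemma fminus_lin a r : lin (fminus a r).
Proof. exact/lin_scale/hact_lin. Qed.

Lemma Ep_lin a q : lin (Ep a q).
Proof. exact: (expz_lin (fplus_lin a)). Qed.

Lemma Em_lin a q : lin (Em a q).
Proof. exact: (expz_lin (fminus_lin a)). Qed.

Lemma Ep0 a u : Ep a 0 u = u. Proof. exact: (expz0 (fplus_lin a)). Qed.
Lemma Em0 a u : Em a 0 u = u. Proof. exact: (expz0 (fminus_lin a)). Qed.
Lemma Ep_neg a q u : q < 0 -> Ep a q u = 0. Proof. exact: expz_neg. Qed.
Lemma Em_neg a q u : q < 0 -> Em a q u = 0. Proof. exact: expz_neg. Qed.

Lemma fplusC a b r s u : fplus a r (fplus b s u) = fplus b s (fplus a r u).
Proof.
rewrite /fplus !(linZ (hact_lin _ _)) !scalerA mulrC hact_comm.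
case: eqP => [E|_]; last by rewrite scale0r addr0.
have -> : r = 0%N by lia.
by rewrite mul0r mulr0 scale0r addr0.
Qed.

Lemma fminusC a b r s u : fminus a r (fminus b s u) = fminus b s (fminus a r u).
Proof.
rewrite /fminus !(linZ (hact_lin _ _)) !scalerA mulrC hact_comm.
case: eqP => [E|_]; last by rewrite scale0r addr0.
have -> : r = 0%N by lia.
by rewrite oppr0 mul0r mulr0 scale0r addr0.
Qed.

Definition gam a b (r : nat) : C :=
  - (k%:R / r.+1%:R) * form (hproj r.+1%:Z a) b.

Lemma fplus_fminus a b r s u : fplus a r.+1 (fminus b s.+1 u) =
  fminus b s.+1 (fplus a r.+1 u) + (if s == r then gam a b r *: u else 0).
Proof.
rewrite /fplus /fminus !(linZ (hact_lin _ _)) hact_comm !scalerDr !scalerA.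
rewrite [in X in X + _]mulrC; congr (_ + _).
have -> : (r.+1%:Z - s.+1%:Z == 0) = (s == r) by apply/eqP/eqP; lia.
case: eqP => [->|_]; last by rewrite mulr0 scale0r.
rewrite form_hproj /gam; congr (_ *: _).
by field; rewrite nat1r pnatr_eq0 kF.
Qed.

Lemma Ep_vac a q : Ep a q (svac X) = if q == 0 then svac X else 0.
Proof.
apply: (expz_annihilated (fplus_lin a)) => [r s u|r].
  exact: fplusC.
by rewrite /fplus hact_vac ?scaler0.
Qed.

Lemma Em_commute a b p q u : Em a p (Em b q u) = Em b q (Em a p u).
Proof.
by apply: (expz_commute (fminus_lin b) (fminus_lin a)) => *; apply: fminusC.
Qed.

Lemma Ep_Em a b (kap : nat -> C) : kap 0%N = 1 ->
  (forall p : nat, p%:R * kap p =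
     \sum_(r < p) (r.+1%:R * gam a b r) * kap (p - r.+1)%N) ->
  forall q (B : nat) p u, q < B%:Z -> Ep a q (Em b p u) =
  \sum_(j < B) kap j *: Em b (p - j%:Z) (Ep a (q - j%:Z) u).
Proof.
move=> kap0 kapN q B p u; apply: (expz_exchange _ _ _ _ (fplus_fminus a b) kap0 kapN).
- exact: fminus_lin.
- exact: fplus_lin.
- by move=> *; apply: fminusC.
by move=> *; apply: fplusC.
Qed.

(** On the component of degree -r, nu^j is the scalar eta^(- j r), that is, a rescaling of the
    formal variable. *)
Lemma Em_nu a j (p : nat) u :
  Em (nu j a) p u = (eta ^ (- j%:Z)) ^+ p *: Em a p u.
Proof.
apply: (expcoef_dilate (fminus_lin a) (fminus_lin (nu j a))).
- by move=> *; apply: fminusC.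
- by move=> *; apply: fminusC.
move=> r v; rewrite /fminus scalerA [_ * (k%:R / _)]mulrC -[RHS]scalerA; congr (_ *: _).
rewrite -hactZ; apply: hact_hproj.
rewrite (linZ (@hproj_lin _ X _)) hproj_nu nu_hproj exprnP exprz_exp.
by congr (eta ^ _ *: _); ring.
Qed.

Lemma Em_support r (p : nat) u : ~~ (Mper r %| p)%N ->
  Em (ext C (alphar X r)) p u = 0.
Proof.
apply: (expcoef_support (fminus_lin _)) => [*|s v Ms]; first exact: fminusC.
rewrite /fminus (@hact_hproj _ _ _ 0) ?hact0 ?scaler0 //.
rewrite (lin0 (@hproj_lin _ X _)); apply: (@hproj_support _ _ r).
  by rewrite -ext_nu nu_len_alphar.
by rewrite abszN.
Qed.

Section Monomials.

Definition hmono (t : seq (h * nat)) : Snu :=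
  foldr (fun (x : h * nat) u => Em x.1 x.2 u) (svac X) t.

(** Here the vectors and their order are remembered and the indices are arbitrary, as needed while
    modes are applied one at a time; [Fock] keeps only the charge. *)
Definition FS (c : seq h) n : set Snu :=
  lspan (hmono @` [set t | unzip1 t = c /\ (sumn (unzip2 t))%:Z = n]).

Lemma Em_FS a c n p u : FS c n u -> FS (a :: c) (n + p) (Em a p u).
Proof.
case: p => p; last by move=> _; apply: lspan0.
apply: (lspan_lin_ind (Em_lin _ _)) => _ [t [tc tn] <-]; apply: mem_lspan.
by exists ((a, p) :: t) => //=; split; [rewrite tc|lia].
Qed.

Lemma FS_vac : FS [::] 0 (svac X).
Proof. by apply: mem_lspan; exists [::]. Qed.

(** Each exchange with a coefficient of E^- lowers both indices by the same j, so the total degree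
    falls by q; on the vacuum only index 0 survives. *)
Lemma Ep_FS a c n q u : FS c n u -> FS c (n - q) (Ep a q u).
Proof.
apply: (lspan_lin_ind (Ep_lin _ _)) => _ [t [<- <-] <-] {u n}.
elim: t q => [|[b p] t IHt] q /=.
  rewrite Ep_vac; case: eqP => [->|_]; last exact: lspan0.
  exact: FS_vac.
have [kap [kap0 kapN]] := kappa_exists (gam a b).
rewrite (Ep_Em kap0 kapN (B := (absz q).+1)); last by lia.
apply: lspan_sum => j _ _; apply: lspanZ.
have -> : (p + sumn (unzip2 t))%N%:Z - q =
  (sumn (unzip2 t))%:Z - (q - j%:Z) + (p%:Z - j%:Z) by lia.
exact/Em_FS/IHt.
Qed.

Lemma FS_neg c n u : n < 0 -> FS c n u -> u = 0.
Proof.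
move=> n0 H; apply: lspan_set0; move: u H; apply: lspan_sub => x [t [_ tn] _].
by exfalso; lia.
Qed.

End Monomials.

(** * Products indexed by cycles, and the operator lowering their indices *)

Section CycleMonomials.
Implicit Types (t : seq ('I_d * nat)) (m : 'rV[int]_d).

(* The modes of E^-(-alpha^(r), x) vanish outside (k / l_r) Z. *)
Definition hd (x : 'I_d * nat) : Snu -> Snu :=
  Em (ext C (alphar X x.1)) (Mper x.1 * x.2)%N.

Definition hmd t : Snu := foldr hd (svac X) t.

Definition cnt r t : nat := count (fun x => x.1 == r) t.
Definition wd t : nat := (\sum_(x <- t) Mper x.1 * x.2)%N.

Definition shape m n : set (seq ('I_d * nat)) :=
  [set t | (forall r, (cnt r t)%:Z = m 0 r) /\ (wd t)%:Z = n].

Definition Fock m n : set Snu := lspan (hmd @` shape m n).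

Lemma hd_lin x : lin (hd x). Proof. exact: Em_lin. Qed.

Lemma hmd_perm t t' : perm_eq t t' -> hmd t = hmd t'.
Proof. by apply: perm_foldr => x y u; apply: Em_commute. Qed.

Lemma hd0 r u : hd (r, 0%N) u = u.
Proof. by rewrite /hd muln0 Em0. Qed.

(** Moved to the other side, nu^j becomes nu^(k-j), and nu^(k-j) alpha^(r) equals alpha^(i) only if
    r = i and l_r divides j. *)
Lemma form_nu_lam i r (j : 'I_k) :
  form (nu j (lam i)) (ext C (alphar X r)) = ((r == i) && (len X r %| j)%N)%:R.
Proof.
have jk := ltnW (ltn_ord j).
have -> : ext C (alphar X r) = nu j (nu (k - j) (ext C (alphar X r))).
  by rewrite nuD subnKC // nu_k.
rewrite form_nu -ext_nu nu_alpha form_lam eq_sym cycle_pow_eq.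
have lk : (len X r %| k)%N by rewrite -(Mper_len r) dvdn_mull.
by rewrite dvdn_subr.
Qed.

(** For r = i and M = [Mper i] these are the coefficients of log(1 - z^M). *)
Lemma gam_lam i r (n : nat) : gam (lam i) (ext C (alphar X r)) n =
  if (r == i) && (Mper r %| n.+1)%N then - ((Mper r)%:R / n.+1%:R) else 0.
Proof.
rewrite /gam form_hprojl.
rewrite (eq_bigr (fun j : 'I_k => if r == i then (if (len X r %| j)%N
    then eta ^ (- (n.+1%:Z * j%:Z)) else 0) else 0)); last first.
  by move=> j _; rewrite form_nu_lam; case: (r == i); case: (_ %| _)%N; rewrite ?mulr1 ?mulr0.
case: (r == i); last by rewrite big1 ?mulr0.
rewrite sum_eta /=; case: ifP => _; last by rewrite !mulr0.
by field; rewrite nat1r pnatr_eq0 kF.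
Qed.

(** The exchange series is exactly 1 - z^M when r = i and 1 otherwise, so at most the terms 0 and M
    survive. *)
Lemma Ep_lam_hd i q r (n : nat) u : Ep (lam i) q (hd (r, n) u) =
  hd (r, n) (Ep (lam i) q u) - (if r == i then
    Em (ext C (alphar X r)) ((Mper r * n)%N%:Z - (Mper r)%:Z)
       (Ep (lam i) (q - (Mper r)%:Z) u) else 0).
Proof.
set M := Mper r; have M0 : (0 < M)%N := Mper_gt0 r.
pose kap (j : nat) : C :=
  if j == 0%N then 1 else if (r == i) && (j == M) then -1 else 0.
have kapN (p : nat) : p%:R * kap p =
    \sum_(j < p) (j.+1%:R * gam (lam i) (ext C (alphar X r)) j) * kap (p - j.+1)%N.
  (* The coefficients of z d/dz log(1 - z^M). *)
  pose g (j : nat) : C := if (r == i) && (M %| j)%N then - M%:R else 0.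
  transitivity (\sum_(j < p) g j.+1 * kap (p - j.+1)%N); last first.
    apply: eq_bigr => j _; congr (_ * _); rewrite gam_lam /g -/M.
    case: ifP => _; last by rewrite mulr0.
    by field; rewrite nat1r pnatr_eq0.
  rewrite /g /kap; case: (r == i) => /=; last first.
    rewrite big1 => [|j _]; last by rewrite mul0r.
    by case: p => [|p]; rewrite ?mul0r ?mulr0.
  case: p => [|p]; first by rewrite big_ord0 mul0r.
  rewrite big_ord_recr /= subnn eqxx mulr1.
  have F (j : 'I_p) : (if (p.+1 - j.+1)%N == 0%N then 1 else
      if (p.+1 - j.+1)%N == M then -1 else 0 : C) =
      (if (p - j)%N == M then -1 else 0).
    by rewrite subSS ifF //; apply/eqP; have := ltn_ord j; lia.
  under eq_bigr do rewrite F.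
  (* The degree is now p + 1. Up to degree M only the last term, with [kap] equal to 1, can
     contribute; beyond M it is cancelled by the term p - j = M. *)
  have [pM|pM] := ltnP p M.
    rewrite big1 ?add0r => [|j _]; last first.
      by rewrite [X in _ * X]ifN ?mulr0 //; apply/eqP; have := ltn_ord j; lia.
    have [->|pM1] := eqVneq p.+1 M; first by rewrite dvdnn mulrN1.
    by rewrite gtnNdvd ?mulr0 //; lia.
  have pMp : (p - M < p)%N by lia.
  rewrite (bigD1 (Ordinal pMp)) //= subKn // eqxx big1 ?addr0 => [|j jp]; last first.
    rewrite [X in _ * X]ifN ?mulr0 //; apply: contraNneq jp => E; apply/eqP/val_inj => /=.
    by have := ltn_ord j; lia.
  rewrite gtn_eqF ?ltnS // mulr0 -subSn // dvdn_subl //; last by lia.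
  by case: ifP => _; rewrite ?mul0r ?addr0 // mulrN1 opprK subrr.
(* The bound has to exceed q and to include the term of index M. *)
pose B := (absz q + M).+1.
have qB : q < B%:Z by rewrite /B; lia.
rewrite /hd (@Ep_Em _ _ kap (erefl _) kapN q B) //=.
have B0 : (0 < B)%N by []. have BM : (M < B)%N by rewrite /B; lia.
rewrite (bigD1 (Ordinal B0)) //= !subr0 scale1r; congr (_ + _).
rewrite (bigD1 (Ordinal BM)) /=; last by rewrite -val_eqE /= -lt0n.
rewrite big1 => [|j /andP[j0 jM]]; last first.
  rewrite /kap; move: j0 jM; rewrite -!val_eqE /= => /negPf -> /negPf ->.
  by rewrite andbF scale0r.
rewrite addr0 /kap eqxx andbT (gtn_eqF M0).
by case: ifP => _; rewrite ?scaleN1r // scale0r oppr0.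
Qed.

(** Each factor of type i absorbs at most [Mper i], the other factors nothing, and what is left over
    kills the vacuum. *)
Lemma Ep_lam_gt i q t : (Mper i * cnt i t)%N%:Z < q -> Ep (lam i) q (hmd t) = 0.
Proof.
elim: t q => [|[r n] t IHt] q /=.
  by rewrite muln0 Ep_vac => q0; rewrite ifF //; apply/eqP; lia.
rewrite Ep_lam_hd /cnt /= -/(cnt i t); case: eqP => [->|_] tq; last first.
  by rewrite IHt ?(lin0 (hd_lin _)) ?subr0.
rewrite add1n mulnS PoszD in tq; have M0 := Mper_gt0 i.
rewrite !IHt; try lia.
by rewrite (lin0 (hd_lin _)) (lin0 (Em_lin _ _)) subr0.
Qed.

(** The predecessor truncates at 0, so this is inverted by [up] only on words without (i, 0). *)
Definition down (i : 'I_d) t := [seq (x.1, if x.1 == i then x.2.-1 else x.2) | x <- t].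
Definition up (i : 'I_d) t := [seq (x.1, if x.1 == i then x.2.+1 else x.2) | x <- t].

(** For c factors of type i this is the extreme coefficient of E^+ that can act; the sign cancels
    the -1 of each factor 1 - z^M. *)
Definition Dlam i (c : int) u : Snu := (-1) ^ c *: Ep (lam i) ((Mper i)%:Z * c) u.

Lemma Dlam_lin i c : lin (Dlam i c).
Proof. exact/lin_scale/Ep_lin. Qed.

(** At the extreme degree every factor of type i must absorb its full share, so each of their
    indices drops by one. *)
Lemma Dlam_hmd i t : Dlam i (cnt i t) (hmd t) =
  if (i, 0%N) \in t then 0 else hmd (down i t).
Proof.
elim: t => [|[r n] t IHt].
  by rewrite /Dlam mulr0 Ep0 expr0z scale1r.
rewrite in_cons /= xpair_eqE /Dlam /= Ep_lam_hd /cnt /= -/(cnt i t).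
rewrite eq_sym (eq_sym 0%N); case: (eqVneq i r) => [<-|ir] /=; last first.
  rewrite add0n subr0 -(linZ (hd_lin _)) -/(Dlam i (cnt i t) _) IHt.
  by case: ifP => _ //; rewrite (lin0 (hd_lin _)).
(* If this factor absorbs nothing, the degree left is too large for the remaining factors. *)
rewrite Ep_lam_gt ?(lin0 (hd_lin _)) ?sub0r; last first.
  by rewrite -PoszM ltz_nat add1n mulnS -[ltnLHS]add0n ltn_add2r Mper_gt0.
have -> : (Mper i)%:Z * (1 + cnt i t)%N%:Z - (Mper i)%:Z = (Mper i)%:Z * (cnt i t)%:Z.
  by rewrite PoszD mulrDr mulr1 addrC addKr.
rewrite add1n exprSzr mulrN1 scaleNr scalerN opprK -(linZ (Em_lin _ _)).
rewrite -/(Dlam i (cnt i t) _) IHt; case: n => [|n] /=.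
  (* Lowering index 0 gives a coefficient of negative index, which is 0. *)
  by rewrite muln0 sub0r Em_neg //; have := Mper_gt0 i; lia.
rewrite mulnS PoszD addrC addKr; case: ifP => _; first by rewrite (lin0 (Em_lin _ _)).
by rewrite /= ?eqxx.
Qed.

Lemma upK i t : down i (up i t) = t.
Proof.
by rewrite /down /up -map_comp -[RHS]map_id; apply: eq_map => -[r n] /=; case: eqP.
Qed.

Lemma downK i t : (i, 0%N) \notin t -> up i (down i t) = t.
Proof.
move=> it; rewrite /down /up -map_comp -[RHS]map_id; apply/eq_in_map => -[r n] rt /=.
by case: eqP => [E|//]; case: n rt => // rt; rewrite -E rt in it.
Qed.

Lemma up_notin i t : (i, 0%N) \notin up i t.
Proof. by apply/mapP => -[[r n] _ /= [->]]; rewrite eqxx. Qed.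

Lemma cnt_up i r t : cnt r (up i t) = cnt r t.
Proof. by rewrite /cnt count_map; apply: eq_count => x. Qed.

Lemma cnt_down i r t : cnt r (down i t) = cnt r t.
Proof. by rewrite /cnt count_map; apply: eq_count => x. Qed.

Lemma wd_up i t : wd (up i t) = (wd t + Mper i * cnt i t)%N.
Proof.
rewrite /wd /up big_map; elim: t => [|[r n] t IHt]; first by rewrite !big_nil muln0.
by rewrite !big_cons IHt /cnt /=; case: eqP => [->|_]; rewrite ?mulnS ?mulnDr; lia.
Qed.

Lemma wd_down i t : (i, 0%N) \notin t -> (wd (down i t) + Mper i * cnt i t)%N = wd t.
Proof. by move=> it; rewrite -[in RHS](downK it) wd_up cnt_down. Qed.

Lemma up_perm i t t' : perm_eq t t' -> perm_eq (up i t) (up i t').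
Proof. exact: perm_map. Qed.

Lemma sub_deltaE m i r : (m - delta_mx 0 i) 0 r = m 0 r - (r == i)%:Z.
Proof. by rewrite !mxE eqxx; case: (r == i). Qed.

(* Dual form of the linear independence of the hmd t, up to reordering t. *)
Lemma hmd_functional (Z : lmodType C) (c : seq ('I_d * nat) -> Z) m n :
  (forall t t', perm_eq t t' -> c t = c t') ->
  exists2 phi : Snu -> Z, lin phi & forall t, shape m n t -> phi (hmd t) = c t.
Proof.
(* The measure adds charge and degree: removing a factor of type i lowers the first, lowering the
   indices of the m_i > 0 factors lowers the second. *)
have [N] : exists N : nat, (\sum_r absz (m 0%R r) + absz n < N)%N.
  by exists (\sum_r absz (m 0%R r) + absz n).+1.
elim: N m n c => // N IHN m n c mnN cP.
(* Without a positive entry of m only the empty word can occur, and the vacuum functional settles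
   it. *)
have [[i mi]|m0] := pselect (exists i, 0 < m 0 i); last first.
  have [psi lpsi psi1] := vacuum_functional X.
  exists (fun u => psi u *: c [::]).
    by move=> z u v; rewrite lpsi scalerDl scalerA.
  move=> t [tm _]; suff -> : t = [::] by rewrite psi1 scale1r.
  case: t tm => // x t /(_ x.1); rewrite /cnt /= eqxx => tm.
  by case: m0; exists x.1; rewrite -tm.
have Mi := Mper_gt0 i.
pose m' := m - delta_mx 0 i.
have sm' : (\sum_r absz (m' 0%R r) < \sum_r absz (m 0%R r))%N.
  rewrite (bigD1 i) //= [ltnRHS](bigD1 i) //= -addSn leq_add //.
    by rewrite /m' sub_deltaE eqxx; lia.
  apply: leq_sum => r ri; by rewrite /m' sub_deltaE (negPf ri) subr0.
(* [phi1] is right on the words containing (i, 0). Its error on the others is corrected by [phi2]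
   after [Dlam], which kills the former words and lowers the latter, [up] recovering them. *)
have [||phi1 lphi1 phi1E] := IHN m' n (fun t => c ((i, 0%N) :: t)).
- by apply: leq_trans (_ : _ <= N)%N; [|exact: mnN]; rewrite ltn_add2r.
- by move=> t t' tt'; apply: cP; rewrite perm_cons.
pose n' := n - (Mper i)%:Z * m 0 i.
have [phi2 lphi2 phi2E] : exists2 phi : Snu -> Z, lin phi &
    forall t, shape m n' t -> phi (hmd t) = c (up i t) - phi1 (hmd (up i t)).
  (* No word has negative degree. The case is separate because [absz] need not decrease there. *)
  have [n'0|n'0] := ltP n' 0.
    exists (fun=> 0) => [z u v|t [_ tn]]; first by rewrite scaler0 addr0.
    by lia.
  apply: IHN => [|t t' tt'].
    apply: leq_trans (_ : _ <= N)%N; [|exact: mnN]; rewrite ltn_add2l.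
    by move: n'0; rewrite /n'; nia.
  by rewrite (cP _ _ (up_perm i tt')) (hmd_perm (up_perm i tt')).
exists (fun u => phi1 u + phi2 (Dlam i (m 0 i) u)).
  exact: (lin_add lphi1 (lin_comp lphi2 (Dlam_lin _ _))).
move=> t [tm tn]; rewrite -tm Dlam_hmd; case: ifP => [it|/negbT it].
  have tt := perm_to_rem it.
  rewrite (lin0 lphi2) addr0 (hmd_perm tt) (cP _ _ tt) /= hd0 phi1E //.
  split=> [r|].
    rewrite /m' sub_deltaE -tm /cnt; move/seq.permP: (tt) => ->.
    by rewrite /= [i == r]eq_sym; lia.
  by rewrite -tn /wd [in RHS](perm_big _ tt) /= big_cons muln0.
rewrite phi2E; first by rewrite downK // addrC subrK.
split=> [r|]; first by rewrite cnt_down.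
by rewrite /n' -tn -(wd_down it) -tm; lia.
Qed.

Lemma shape_down i m n t : (i, 0%N) \notin t -> shape m n t ->
  shape m (n - (Mper i)%:Z * m 0 i) (down i t).
Proof.
move=> it [tm tn]; split=> [r|]; first by rewrite cnt_down.
by rewrite -tn -(wd_down it) -tm; lia.
Qed.

Lemma shape_up i m n t : shape m (n - (Mper i)%:Z * m 0 i) t ->
  shape m n (up i t).
Proof.
move=> [tm tn]; split=> [r|]; first by rewrite cnt_up.
by rewrite wd_up -[n](subrK ((Mper i)%:Z * m 0 i)) -tn -tm; lia.
Qed.

Lemma shape_cons0 i m n t : shape (m - delta_mx 0 i) n t <->
  shape m n ((i, 0%N) :: t).
Proof.
rewrite /shape /= /wd big_cons muln0 add0n.
by split=> -[tm tn]; split=> // r; have := tm r; rewrite sub_deltaE /cnt /= [i == r]eq_sym; lia.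
Qed.

Lemma Fock_sub i m n : Fock (m - delta_mx 0 i) n `<=` Fock m n.
Proof.
apply: lspan_sub => _ [t /shape_cons0 st <-]; apply: mem_lspan.
by exists ((i, 0%N) :: t) => //=; rewrite hd0.
Qed.

Lemma Dlam_shape i m n t : shape m n t ->
  Dlam i (m 0 i) (hmd t) = if (i, 0%N) \in t then 0 else hmd (down i t).
Proof. by move=> [tm _]; rewrite -tm Dlam_hmd. Qed.

Lemma Dlam_sub i m n u : Fock (m - delta_mx 0 i) n u -> Dlam i (m 0 i) u = 0.
Proof.
move=> Fu; apply: (lin_eq_lspan (g := fun=> 0) (Dlam_lin _ _) _ _ Fu).
  by move=> z x y; rewrite scaler0 addr0.
move=> _ [t /shape_cons0 st <-].
by have := Dlam_shape i st; rewrite /= hd0 mem_head.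
Qed.

(** Words containing (i, 0) lie in the smaller space and are killed; the combination of the other
    words is recovered from its image, hence is 0. *)
Lemma Dlam_ker i m n u : Fock m n u -> Dlam i (m 0 i) u = 0 ->
  Fock (m - delta_mx 0 i) n u.
Proof.
move=> /lspan_family[s [sm ->]].
rewrite (bigID (fun x : C * seq ('I_d * nat) => (i, 0%N) \in x.2)) /=.
set u0 := (X in X + _); set u1 := (X in _ + X).
have F0 : Fock (m - delta_mx 0 i) n u0.
  rewrite /u0; elim: s sm {u0 u1} => [|x s IHs] sm; first by rewrite big_nil; apply: lspan0.
  rewrite big_cons; case: ifP => [ix|_]; last by apply: IHs => y sy; apply: sm; right.
  apply: lspanD; last by apply: IHs => y sy; apply: sm; right.
  apply/lspanZ/mem_lspan; exists (rem (i, 0%N) x.2); last first.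
    by rewrite (hmd_perm (perm_to_rem ix)) /= hd0.
  apply/shape_cons0; have [xm xn] := sm x (or_introl erefl).
  have tt := perm_to_rem ix; split=> [r|].
    by rewrite -xm; rewrite /cnt; move/seq.permP: tt => ->.
  by rewrite -xn; congr Posz; apply/esym/perm_big.
rewrite (linD (Dlam_lin _ _)) (Dlam_sub F0) add0r => D0.
suff -> : u1 = 0 by rewrite addr0.
(* With values prescribed in the Fock space itself, this is a left inverse of [Dlam] on the words
   without (i, 0). *)
have [phi lphi phiE] := @hmd_functional Snu (fun t => hmd (up i t)) m
  (n - (Mper i)%:Z * m 0 i) (fun t t' tt' => hmd_perm (up_perm i tt')).
have <- : phi (Dlam i (m 0 i) u1) = u1; last by rewrite D0 (lin0 lphi).
rewrite /u1; elim: s sm {u0 u1 F0 D0} => [|x s IHs] sm.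
  by rewrite big_nil (lin0 (Dlam_lin _ _)) (lin0 lphi).
have sx := sm x (or_introl erefl).
rewrite big_cons; case: ifP => [ix|_]; last by apply: IHs => y sy; apply: sm; right.
rewrite (linD (Dlam_lin i (m 0 i))) (linD lphi); congr (_ + _); last first.
  by apply: IHs => y sy; apply: sm; right.
rewrite (linZ (Dlam_lin i (m 0 i))) (linZ lphi) (Dlam_shape i sx) (negPf ix).
by rewrite phiE ?downK //; apply: shape_down.
Qed.

Lemma Dlam_image i m n :
  Dlam i (m 0 i) @` Fock m n = Fock m (n - (Mper i)%:Z * m 0 i).
Proof.
rewrite /Fock -(lspan_image _ (Dlam_lin _ _)); apply/seteqP; split.
  apply: lspan_sub => _ [_ [t st <-] <-]; rewrite (Dlam_shape i st).
  case: ifP => [_|/negbT it]; first exact: lspan0.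
  by apply: mem_lspan; exists (down i t) => //; apply: shape_down.
apply: lspan_sub => _ [t st <-]; apply: mem_lspan.
exists (hmd (up i t)); first by exists (up i t) => //; apply: shape_up.
by rewrite (Dlam_shape i (shape_up st)) (negPf (up_notin i t)) upK.
Qed.

End CycleMonomials.
End FockSpace.

(** * The twisted group module and the vertex operators *)

Section Cocycle.
Variables (C : numClosedFieldType) (X : latticeData C).
Local Notation D := (rkL X).
Local Notation k := (kper X).
Local Notation v := (vper X).
Local Notation L := 'rV[int]_D.
Implicit Types a b c : L.

(** The exponent of eta in the product of the sections of a and b in \hat L_\nu; the factor v
    appears because -1 = eta^v. *)
Definition cocycle a b : 'Z_k := (v%:Z * eps_exp a b)%:~R - (nu_exp a b)%:~R.

Lemma Lhat_nu_mulE (x y : Lhat X) :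
  Lhat_nu_mul x y = (x.1 + y.1 + cocycle x.2 y.2, x.2 + y.2).
Proof. by rewrite /Lhat_nu_mul /Lhat_mul /cocycle /= !addrA. Qed.

Lemma cocycleDl a b c : cocycle (a + b) c = cocycle a c + cocycle b c.
Proof.
rewrite /cocycle.
have -> : eps_exp (a + b) c = eps_exp a c + eps_exp b c :> int.
  rewrite -big_split; apply: eq_bigr => i _; rewrite -big_split.
  by apply: eq_bigr => j _ /=; rewrite !mxE !mulrDl.
have -> : nu_exp (a + b) c = nu_exp a c + nu_exp b c :> int.
  rewrite -big_split; apply: eq_bigr => j _ /=.
  by rewrite -mulrDr -formDl /nuV /nuact mulmxDl.
by rewrite mulrDr !intrD opprD addrACA.
Qed.

Lemma cocycleDr a b c : cocycle a (b + c) = cocycle a b + cocycle a c.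
Proof.
rewrite /cocycle.
have -> : eps_exp a (b + c) = eps_exp a b + eps_exp a c :> int.
  rewrite -big_split; apply: eq_bigr => i _; rewrite -big_split.
  by apply: eq_bigr => j _ /=; rewrite !mxE !mulrDr mulrDl.
have -> : nu_exp a (b + c) = nu_exp a b + nu_exp a c :> int.
  by rewrite -big_split; apply: eq_bigr => j _ /=; rewrite -mulrDr -formDr.
by rewrite mulrDr !intrD opprD addrACA.
Qed.

Lemma cocycle0l a : cocycle 0 a = 0.
Proof. by apply: (addIr (cocycle 0 a)); rewrite -cocycleDl !add0r. Qed.

Lemma cocycle0r a : cocycle a 0 = 0.
Proof. by apply: (addIr (cocycle a 0)); rewrite -cocycleDr !add0r. Qed.

Lemma cocycleNr a b : cocycle a (- b) = - cocycle a b.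
Proof. by apply/eqP; rewrite -subr_eq0 opprK -cocycleDr addNr cocycle0r. Qed.

Lemma cocycleNl a b : cocycle (- a) b = - cocycle a b.
Proof. by apply/eqP; rewrite -subr_eq0 opprK -cocycleDl addNr cocycle0l. Qed.

Lemma Lhat_nu_mulA (x y z : Lhat X) :
  Lhat_nu_mul x (Lhat_nu_mul y z) = Lhat_nu_mul (Lhat_nu_mul x y) z.
Proof.
rewrite !Lhat_nu_mulE /= cocycleDl cocycleDr; congr (_, _); last by rewrite addrA.
by ring.
Qed.

End Cocycle.

Section TwistedGroupModule.
Variables (C : numClosedFieldType) (X : latticeData C).
Local Notation D := (rkL X).
Local Notation k := (kper X).
Local Notation v := (vper X).
Local Notation L := 'rV[int]_D.
Variable tau : Lhat X -> C.
Hypothesis tauM : forall a b : Lhat X, Nset X a.2 -> Nset X b.2 ->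
  tau (Lhat_nu_mul a b) = tau a * tau b.
Hypothesis tau_eta : tau (1, 0) = eta X.
Local Notation UT := (UT tau).
Implicit Types (a b : L) (x y n : Lhat X).

Definition uword : Lhat X -> UT := locked (fun x => \pi_UT << x >> : UT).

Lemma uwordE x : uword x = \pi_UT << x >>.
Proof. by rewrite /uword -lock. Qed.

Definition ub a : UT := uword (sec a).

Lemma uword_mul x n : Nset X n.2 -> uword (Lhat_nu_mul x n) = tau n *: uword x.
Proof.
move=> Nn; apply/eqP; rewrite -subr_eq0; apply/eqP.
have := pi_eq0 (UTRel tau x Nn).
by rewrite (linB (pi_lin _)) (linZ (pi_lin _)) !uwordE.
Qed.

Lemma tau0 : tau (0, 0) = 1.
Proof.
have := tauM (a := (0, 0)) (b := (1, 0)) (@Nset0 _ X) (@Nset0 _ X).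
rewrite Lhat_nu_mulE /= cocycle0l !addr0 add0r tau_eta => /esym.
by rewrite -[RHS]mul1r => /(mulIf (eta_neq0 X)).
Qed.

Lemma tau_neq0 n : Nset X n.2 -> tau n != 0.
Proof.
(* The inverse of n in \hat L_\nu. *)
move=> Nn; pose n' : Lhat X := (- n.1 + cocycle n.2 n.2, - n.2).
have := tauM (a := n) (b := n') Nn (NsetN Nn).
rewrite Lhat_nu_mulE /n' /= cocycleNr addrA subrr add0r subrr subrr tau0.
by move=> E; apply: contra_eq_neq E => ->; rewrite mul0r oner_neq0.
Qed.

(** Over the coset of b, x factors as the section of b times an element n over N, and n acts by the
    nonzero scalar [tau n]. *)
Lemma uword_coset x b : Nset X (x.2 - b) ->
  exists2 z : C, z != 0 & uword x = z *: ub b.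
Proof.
move=> Nx; pose n : Lhat X := (x.1 - cocycle b (x.2 - b), x.2 - b).
exists (tau n); first exact: (tau_neq0 (n := n)).
rewrite /ub -uword_mul // Lhat_nu_mulE /= add0r subrK.
by rewrite addrC subrK; case: (x).
Qed.

(** The functional is [tau] of the N-part on the coset b + N and 0 elsewhere; multiplicativity of
    [tau] makes it respect the relations. *)
Lemma ub_functional b : exists2 psi : UT -> C^o, lin psi & psi (ub b) = 1.
Proof.
pose n x : Lhat X := (x.1 - cocycle b (x.2 - b), x.2 - b).
pose f x : C^o := if `[< Nset X (x.2 - b) >] then tau (n x) else 0.
have fX g : UT_rel tau g -> mlift f g = 0.
  case=> x m Nm; rewrite mliftB /f.
  have E2 : (Lhat_nu_mul x m).2 - b = (x.2 - b) + m.2.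
    by rewrite Lhat_nu_mulE /= addrAC.
  rewrite E2; have [Nx|Nx] := asboolP (Nset X (x.2 - b)).
    rewrite asboolT; last exact: NsetD.
    suff -> : n (Lhat_nu_mul x m) = Lhat_nu_mul (n x) m.
      by rewrite tauM // mulrC /GRing.scale /= subrr.
    rewrite [RHS]Lhat_nu_mulE /n E2 Lhat_nu_mulE /=; congr (_, _).
    by rewrite cocycleDr (cocycleDl x.2) cocycleNl; ring.
  rewrite asboolF ?scaler0 ?subr0 // => Nxm; apply: Nx.
  by rewrite -[x.2 - b](addrK m.2); apply: NsetD => //; apply: NsetN.
exists (qlift f); first exact: (qlift_lin fX).
rewrite /ub uwordE (qliftU fX) /f /= subrr asboolT; last exact: Nset0.
by rewrite /n /= subrr cocycle0r subr0 tau0.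
Qed.

Section Operators.

Lemma eact_qlift a : eact a = qlift (fun x => uword (Lhat_nu_mul (sec a) x)) :> (UT -> UT).
Proof. by apply/funext => w; congr (qlift _ w); apply/funext => x; rewrite uwordE. Qed.

Lemma eact_killed a g : UT_rel tau g ->
  mlift (fun x => uword (Lhat_nu_mul (sec a) x)) g = 0.
Proof.
case=> x m Nm; rewrite mliftB.
by rewrite Lhat_nu_mulA uword_mul // subrr.
Qed.

Lemma eact_lin a : lin (eact a : UT -> UT).
Proof. by rewrite eact_qlift; apply: (qlift_lin (@eact_killed a)). Qed.

Lemma eact_ub a b : exists2 z : C, z != 0 & eact a (ub b) = z *: ub (a + b).
Proof.
rewrite eact_qlift {1}/ub uwordE (qliftU (@eact_killed a)).
by apply: uword_coset; rewrite Lhat_nu_mulE /= subrr; apply: Nset0.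
Qed.

Variable y : 'rV[C]_D.
Hypothesis hy : homog 0 y.

Let xpow_fun (c : C) x : UT := if form y (ext C x.2) == c then uword x else 0.

Lemma xpow_qlift c : xpow y c = qlift (xpow_fun c) :> (UT -> UT).
Proof.
apply/funext => w; congr (qlift _ w); apply/funext => x.
by rewrite /xpow_fun uwordE.
Qed.

Lemma xpow_killed c g : UT_rel tau g -> mlift (xpow_fun c) g = 0.
Proof.
case=> x m Nm; rewrite mliftB /xpow_fun.
rewrite uword_mul // Lhat_nu_mulE /= ext_add formDr.
rewrite (formC _ (ext C m.2)) (Nm _ hy) addr0.
by case: ifP => _; rewrite ?scaler0 subrr.
Qed.

Lemma xpow_lin c : lin (xpow y c : UT -> UT).
Proof. by rewrite xpow_qlift; apply: (qlift_lin (@xpow_killed c)). Qed.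

Lemma xpow_ub c b :
  xpow y c (ub b) = if form y (ext C b) == c then ub b else 0.
Proof. by rewrite xpow_qlift {1}/ub uwordE (qliftU (@xpow_killed c)). Qed.

End Operators.
End TwistedGroupModule.

(** * Modes of the vertex operators and the constant term of Delta *)

Section TwistedModes.
Variables (C : numClosedFieldType) (X : latticeData C).
Local Notation D := (rkL X).
Local Notation d := (ncyc X).
Local Notation k := (kper X).
Local Notation v := (vper X).
Local Notation L := 'rV[int]_D.
Variable tau : Lhat X -> C.
Hypothesis tauM : forall a b : Lhat X, Nset X a.2 -> Nset X b.2 ->
  tau (Lhat_nu_mul a b) = tau a * tau b.
Hypothesis tau_eta : tau (1, 0) = eta X.
Local Notation VT := (VT tau).
Local Notation Snu := (Snu X).
Implicit Types (a b : L) (u : Snu) (w : VT).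

Definition tn b : Snu -> VT := locked (fun u => tens u (ub tau b) : VT).

Lemma tnE b u : tn b u = tens u (ub tau b).
Proof. by rewrite /tn -lock. Qed.

Lemma tn_lin b : lin (tn b).
Proof. by move=> c x y; rewrite !tnE; apply: tens_linl. Qed.

(** A functional equal to 1 on the group factor gives a left inverse on the tensor product. *)
Lemma tn_inj b : injective (tn b).
Proof.
have [psi lpsi psi1] := ub_functional tauM tau_eta b.
pose f (u : Snu) (x : UT tau) : Snu := psi x *: u.
have fl x : lin (f^~ x) by exact: (lin_scale _ (@lin_id _ _)).
have fr u : lin (f u) by move=> z x y; rewrite /f lpsi scalerDl scalerA.
apply: (can_inj (g := tensor_lift f)) => u.
rewrite tnE; apply: etrans (tensor_liftE fl fr u (ub tau b)) _.
by rewrite /f psi1 scale1r.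
Qed.

Lemma tn_coset b b' : Nset X (b - b') ->
  exists2 z : C, z != 0 & forall u, tn b u = z *: tn b' u.
Proof.
move=> Nb; have [z z0 E] := uword_coset tauM tau_eta (x := sec b) Nb.
exists z => // u; rewrite !tnE {1}/ub E.
exact: (linZ (tens_linr u)).
Qed.

(** For 0 < j < k/2 the power eta^j differs from 1. The leading term of a mode can therefore be
    solved for. *)
Lemma Ynorm_neq0 a : Ynorm a != 0 :> C.
Proof.
rewrite /Ynorm /sigma mulf_neq0 ?expfz_neq0 ?kF // mulf_neq0 //; last first.
  by rewrite expfz_neq0 // pnatr_eq0.
rewrite prodf_seq_neq0; apply/allP => j; rewrite mem_index_iota => /andP[j0 jk].
apply/implyP => _; rewrite expfz_neq0 // subr_eq0 eq_sym invr_eq1.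
rewrite -(prim_order_dvd (eta_prim X)) -[(2 * _)%N]/k gtnNdvd //.
by apply: (leq_trans jk); rewrite leq_half_double -addnn; lia.
Qed.

(** Fixing the power of x leaves one free index q; N is the net change of Heisenberg degree. *)
Definition Yshift a (N : int) (q : nat) : VT -> VT :=
  tmap (fun u => Em (ext C a) (q%:Z + N) (Ep (ext C a) q u)) (eact a).

Definition Yfin a (N : int) (B : nat) w : VT :=
  Ynorm a *: \sum_(q < B) Yshift a N q w.

Lemma Yshift_lin a N q : lin (Yshift a N q).
Proof. by apply: tmap_lin; [apply: (lin_comp (Em_lin _ _) (Ep_lin _ _)) | apply: eact_lin]. Qed.

Lemma Yfin_lin a N B : lin (Yfin a N B).
Proof. by apply/lin_scale/lin_lsum => q _; apply: Yshift_lin. Qed.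

Lemma Yshift_tn a b : exists2 z : C, z != 0 & forall N q u,
  Yshift a N q (tn b u) = z *: tn (a + b) (Em (ext C a) (q%:Z + N) (Ep (ext C a) q u)).
Proof.
have [z z0 E] := eact_ub tauM tau_eta a b; exists z => // N q u.
rewrite /Yshift !tnE tmapE ?E; first exact: (linZ (tens_linr _)).
- exact: (lin_comp (Em_lin _ _) (Ep_lin _ _)).
- exact: eact_lin.
Qed.

(* Comparing powers of x in Y(e^a, x) (u \otimes b). *)
Lemma Ycoef_exponent a b (n : int) (p q : nat) :
  let aC := ext C a in
  (form (proj0 aC) (ext C b) ==
    (- (n%:~R / k%:R) - form aC aC / 2)
      - (form (proj0 aC) (proj0 aC) / 2 - form aC aC / 2)
      - p%:R / k%:R + q%:R / k%:R)
  = (p%:Z == q%:Z + (- n - Sv a a - Sv a b *+ 2)).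
Proof.
move=> aC; rewrite form_proj0 !form_proj0_ext.
have k2 : k%:R = 2 * v%:R :> C by rewrite /kper natrM.
have vC := vF X C.
rewrite -subr_eq0 -[RHS]subr_eq0 -[RHS](intr_eq0 C).
rewrite -[RHS](mulIr_eq0 _ (mulIf (x := (k%:R)^-1) _)) ?invr_eq0 ?kF //.
congr (_ == 0); rewrite k2.
by rewrite mulr2n !(intrB, intrD, mulrNz) -!pmulrn; field.
Qed.

(** Comparing exponents of x forces p = q + N, so the sum over pairs collapses to a line, cut off
    where E^+ annihilates u. *)
Lemma Ymode_fin a b n (B : nat) u :
  (forall q : nat, (B <= q)%N -> Ep (ext C a) q u = 0) ->
  Ymode a n (tn b u) = Yfin a (- n - Sv a a - Sv a b *+ 2) B (tn b u).
Proof.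
move=> uB; rewrite /Ymode /Ycoef /Yfin; congr (_ *: _).
set N := - n - _ - _.
pose F (pq : nat * nat) : VT := if pq.1%:Z == pq.2%:Z + N
  then tens (Em (ext C a) pq.1 (Ep (ext C a) pq.2 u)) (eact a (ub tau b)) else 0.
rewrite (eq_fsbigr F); last first.
  move=> pq _; rewrite !tnE tmapE.
  - rewrite xpow_ub; last exact: homog_proj0.
    rewrite Ycoef_exponent /F; case: ifP => // _.
    by rewrite (lin0 (eact_lin _)) (lin0 (tens_linr _)).
  - exact: (lin_comp (Em_lin (ext C a) pq.1) (Ep_lin (ext C a) pq.2)).
  apply: lin_comp; first exact: eact_lin.
  by apply: xpow_lin; exact: homog_proj0.
(* The absolute value is harmless: [F] vanishes when q + N is negative, as does the corresponding
   coefficient of E^-. *)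
rewrite (fsbigE [seq (absz (q%:Z + N), q) | q <- iota 0 B]) //; first last.
- move=> [p q] _ /mapP nq; rewrite /F /=; case: eqP => // E.
  have [qB|qB] := ltnP q B; last by rewrite uB // (lin0 (Em_lin _ _)) (lin0 (tens_linl _)).
  case: nq; exists q; first by rewrite mem_iota.
  by rewrite -E.
- by rewrite map_inj_uniq ?iota_uniq // => q q' [_ ->].
have -> : iota 0 B = index_iota 0 B by rewrite /index_iota subn0.
rewrite big_map big_mkord.
apply: eq_big => [q|q _]; first by rewrite in_setT.
rewrite /Yshift !tnE tmapE; first last.
- exact: eact_lin.
- exact: (lin_comp (Em_lin _ _) (Ep_lin _ _)).
rewrite /F /=; case: (ltP (q%:Z + N) 0) => qN.
  rewrite ifF; last by apply/eqP; lia.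
  by rewrite Em_neg // (lin0 (tens_linl _)).
by rewrite gez0_abs // eqxx.
Qed.

Lemma emap_lin i : lin (emap tau i).
Proof. by apply: tmap_lin => //; apply: eact_lin. Qed.

Lemma emap_tn i b : exists2 z : C, z != 0 & forall u,
  emap tau i (tn b u) = z *: tn (alphar X i + b) u.
Proof.
have [z z0 E] := eact_ub tauM tau_eta (alphar X i) b; exists z => // u.
rewrite /emap !tnE tmapE ?E //; first exact: (linZ (tens_linr _)).
exact: eact_lin.
Qed.

Definition bm (m : 'rV[int]_d) : L := \sum_r m 0 r *: alphar X r.

(** Among the k powers of nu averaged in the projection, only the k / l_i multiples of l_i
    contribute, whence 1 / l_i. *)
Lemma form_lam_bm i m :
  form (proj0 (lam i)) (ext C (bm m)) = (m 0 i)%:~R / (len X i)%:R.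
Proof.
have extbm : ext C (bm m) = \sum_r (m 0 r)%:~R *: ext C (alphar X r).
  rewrite /bm; apply/rowP => j; rewrite !mxE !summxE rmorph_sum; apply: eq_bigr => r _.
  by rewrite !mxE rmorphM.
rewrite extbm form_sumr (bigD1 i) //= formZr.
have E r : form (proj0 (lam i)) (ext C (alphar X r)) =
    (r == i)%:R / (len X i)%:R.
  rewrite /proj0 formZl form_suml.
  under eq_bigr do rewrite form_nu_lam.
  case: (eqVneq r i) => [->|_] /=; last by rewrite big1 ?mulr0 ?mul0r.
  have := sum_eta i 0; rewrite dvdn0 => E.
  rewrite [\sum_(_ < _) _](_ : _ = (Mper i)%:R); last first.
    by rewrite -E; apply: eq_bigr => j _; rewrite mul0r oppr0 expr0z; case: ifP.
  have M0 : ((Mper i)%:R : C) != 0 by rewrite pnatr_eq0 -lt0n Mper_gt0.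
  have l0 : ((len X i)%:R : C) != 0 by rewrite pnatr_eq0 -lt0n len_gt0.
  by rewrite -(Mper_len i) natrM; field; rewrite M0 l0.
rewrite E eqxx mul1r big1 ?addr0 // => r ri.
by rewrite formZr E (negPf ri) mul0r mulr0.
Qed.

(** On charge m the power of x has exponent m_i / l_i, so the constant term selects the coefficient
    of E^+ of index (k / l_i) m_i. *)
Lemma DeltaTc_tn i m u : DeltaTc tau i m (tn (bm m) u) = tn (bm m) (Dlam i (m 0 i) u).
Proof.
rewrite /DeltaTc /DeltaT /Dlam (linZ (tn_lin _)); congr (_ *: _).
pose F (q : nat) : VT := if q%:Z == (Mper i)%:Z * m 0 i
  then tn (bm m) (Ep (lam i) q u) else 0.
have l0 : ((len X i)%:R : C) != 0 by rewrite pnatr_eq0 -lt0n len_gt0.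
rewrite (eq_fsbigr F); last first.
  move=> q _; rewrite !tnE tmapE.
  - rewrite xpow_ub; last exact: homog_proj0.
    rewrite form_lam_bm add0r /F.
    have -> : ((m 0 i)%:~R / (len X i)%:R == q%:R / k%:R :> C) =
        (q%:Z == (Mper i)%:Z * m 0 i).
      rewrite eqr_div ?kF // -(eqr_int C) rmorphM /= -!pmulrn.
      rewrite -(Mper_len i) natrM mulrA (inj_eq (mulIf l0)).
      by rewrite eq_sym mulrC.
    by case: ifP => _; rewrite ?tnE // (lin0 (tens_linr _)).
  - exact: (Ep_lin (lam i) q%:Z).
  by apply: xpow_lin; exact: homog_proj0.
(* For a negative entry no index q qualifies and both sides vanish. *)
have [c0|c0] := ltP ((Mper i)%:Z * m 0 i) 0.
  rewrite fsbig1 => [|q _]; last by rewrite /F ifF //; apply/eqP; lia.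
  by rewrite Ep_neg // (lin0 (tn_lin _)).
rewrite (@fsbigTE _ _ _ _ [fset absz ((Mper i)%:Z * m 0 i)]%fset) => [|q]; last first.
  by rewrite inE /F => qc; rewrite ifF //; apply/eqP => E; rewrite -E eqxx in qc.
by rewrite big_seq_fset1 /F gez0_abs // eqxx.
Qed.

End TwistedModes.

(** * The components of the principal subspace *)

Section PrincipalSubspace.
Variables (C : numClosedFieldType) (X : latticeData C).
Local Notation D := (rkL X).
Local Notation d := (ncyc X).
Local Notation s := (nuP X).
Local Notation k := (kper X).
Local Notation v := (vper X).
Local Notation L := 'rV[int]_D.
Variable tau : Lhat X -> C.
Hypothesis tauM : forall a b : Lhat X, Nset X a.2 -> Nset X b.2 ->
  tau (Lhat_nu_mul a b) = tau a * tau b.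
Hypothesis tau_eta : tau (1, 0) = eta X.
Local Notation VT := (VT tau).
Local Notation Snu := (Snu X).
Implicit Types (a b : L) (u : Snu) (c : seq 'I_D) (m : 'rV[int]_d).

Definition bsum c : L := \sum_(i <- c) alpha i.
Definition vecs c : seq 'rV[C]_D := [seq ext C (alpha i) | i <- c].
Definition modesum (t : seq ('I_D * int)) : int := \sum_(x <- t) x.2.

Lemma Sv_quad a b : Sv (a + b) (a + b) = Sv a a + Sv b b + Sv a b *+ 2.
Proof. by rewrite SvDl !SvDr (SvC b a) mulr2n; ring. Qed.

Lemma Yfin_FS i c n (N : int) (B : nat) u : FS (vecs c) n u ->
  exists2 u', FS (vecs (i :: c)) (n + N) u' &
    Yfin (alpha i) N B (tn tau (bsum c) u) = tn tau (bsum (i :: c)) u'.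
Proof.
move=> Fu; have [z z0 E] := Yshift_tn tauM tau_eta (alpha i) (bsum c).
exists (Ynorm (alpha i) *: \sum_(q < B) z *:
  Em (ext C (alpha i)) (q%:Z + N) (Ep (ext C (alpha i)) q u)).
  apply/lspanZ/lspan_sum => q _ _; apply: lspanZ.
  have -> : n + N = n - q%:Z + (q%:Z + N) by ring.
  exact/Em_FS/Ep_FS.
rewrite /Yfin (linZ (tn_lin _ _)) (lin_sum (tn_lin _ _)); congr (_ *: _).
by apply: eq_bigr => q _; rewrite E (linZ (tn_lin _ _)) /bsum big_cons.
Qed.

Lemma Ymode_FS i c n (n' : int) (B : nat) u : FS (vecs c) n u -> n < B%:Z ->
  Ymode (alpha i) n' (tn tau (bsum c) u) =
  Yfin (alpha i) (- n' - Sv (alpha i) (alpha i) - Sv (alpha i) (bsum c) *+ 2) B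
    (tn tau (bsum c) u).
Proof.
move=> Fu nB; apply: Ymode_fin => q Bq.
by apply: (FS_neg _ (Ep_FS _ q Fu)); lia.
Qed.

Lemma mono_FS t : exists2 u,
  FS (vecs (unzip1 t)) (- modesum t - Sv (bsum (unzip1 t)) (bsum (unzip1 t))) u &
  mono tau t = tn tau (bsum (unzip1 t)) u.
Proof.
elim: t => [|[i n] t [u Fu E]].
  exists (svac X); last by rewrite tnE /svac /ub wordE uwordE /bsum big_nil.
  by rewrite /modesum /bsum !big_nil Sv0r oppr0 subr0; apply: FS_vac.
have -> : unzip1 ((i, n) :: t) = i :: unzip1 t by [].
rewrite [mono _ _]/= E; set n0 := (X in FS _ X _) in Fu.
(* Coefficients of E^+ of index above the degree n0 annihilate u. *)
rewrite (Ymode_FS i n (B := (absz n0).+1) Fu); last by lia.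
have [u' Fu' ->] := Yfin_FS i (- n - Sv (alpha i) (alpha i)
   - Sv (alpha i) (bsum (unzip1 t)) *+ 2) (absz n0).+1 Fu.
exists u'; last reflexivity.
have -> : - modesum ((i, n) :: t) -
    Sv (bsum (i :: unzip1 t)) (bsum (i :: unzip1 t)) =
  n0 + (- n - Sv (alpha i) (alpha i) - Sv (alpha i) (bsum (unzip1 t)) *+ 2).
  rewrite /n0 /modesum /bsum !big_cons Sv_quad [X in X + _ - _]/=.
  by ring.
exact: Fu'.
Qed.

(** The triangularity is in the degree of the vector acted on: a mode equals a coefficient of E^- up
    to terms in which E^+ has lowered that degree. *)
Lemma FS_mono c n u : FS (vecs c) n u ->
  lspan [set w | exists2 t, unzip1 t = c /\
    - modesum t = n + Sv (bsum c) (bsum c) & w = mono tau t] (tn tau (bsum c) u).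
Proof.
elim: c n u => [|i c IHc] n u.
  apply: (lspan_lin_ind (tn_lin _ _)) => _ [t [t0 tn] <-]; apply: mem_lspan.
  case: t t0 tn => // _ /= <-; exists [::].
    by split=> //; rewrite /bsum /modesum !big_nil Sv0r oppr0 addr0.
  by rewrite tnE /svac /ub wordE uwordE /bsum big_nil.
set W := [set w | _].
(* Separating the degree n' of the tail from the index p of the new factor allows an induction on n'
   at fixed total n. *)
suff step n' u' (p : int) : FS (vecs c) n' u' -> n' + p = n ->
    lspan W (tn tau (bsum (i :: c)) (Em (ext C (alpha i)) p u')).
  apply: (lspan_lin_ind (tn_lin _ _)) => _ [[|[a p] t] [//= tc tn] <-] /=.
  case: tc => -> tc; apply: (step (sumn (unzip2 t))%:Z).
    by apply: mem_lspan; exists t.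
  by rewrite -tn; lia.
elim/int_strong_ind: n' u' p => [n' n'0|n' n'0 IHn] u' p Fu np.
  by rewrite (FS_neg n'0 Fu) (lin0 (Em_lin _ _)) (lin0 (tn_lin _ _)); apply: lspan0.
(* The mode index n0 set below is the one whose term q = 0 is the coefficient of E^- of index p. *)
pose B := (absz n').+1; have nB : n' < B%:Z by rewrite /B; lia.
set al := alpha i; set n0 := - p - Sv al al - Sv al (bsum c) *+ 2.
have pE : - n0 - Sv al al - Sv al (bsum c) *+ 2 = p by rewrite /n0; ring.
have YW : lspan W (Yfin al p B (tn tau (bsum c) u')).
  have /lspan_family[r [rc ->]] : lspan [set mono tau t | t in
      [set t | unzip1 t = c /\ - modesum t = n' + Sv (bsum c) (bsum c)]]
      (tn tau (bsum c) u').
    have := IHc _ _ Fu; apply: lspan_sub => _ [t tc ->].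
    by apply: mem_lspan; exists t.
  rewrite (lin_sum (Yfin_lin al p B)).
  elim: r rc => [|x r IHr] rc; first by rewrite big_nil; apply: lspan0.
  rewrite big_cons; apply: lspanD; last by apply: IHr => y yr; apply: rc; right.
  have [xc xn] := rc x (or_introl erefl).
  rewrite (linZ (Yfin_lin al p B)); apply/lspanZ/mem_lspan.
  exists ((i, n0) :: x.2).
    split; first by rewrite -xc.
    rewrite /modesum big_cons opprD -/(modesum _) xn /bsum big_cons -/(bsum c).
    by rewrite Sv_quad -/al -np /n0 /=; ring.
  have [w Fw Ew] := mono_FS x.2.
  rewrite -[mono tau (_ :: _)]/(Ymode (alpha i) n0 (mono tau x.2)) Ew xc.
  move: Fw; rewrite xn xc addrK => Fw.
  by rewrite (Ymode_FS i n0 Fw nB) pE.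
have [z z0 E] := Yshift_tn tauM tau_eta al (bsum c).
(* The term q = 0 is isolated; the others fall under the induction hypothesis, and the nonzero
   scalars are divided out. *)
move: YW; rewrite /Yfin big_ord_recl => YW.
have {}YW := lspanZ (Ynorm al)^-1 YW.
move: YW; rewrite scalerA mulVf ?Ynorm_neq0 // scale1r => YW.
have {}YW : lspan W (Yshift al p 0 (tn tau (bsum c) u')).
  rewrite -[Yshift _ _ _ _](addrK (\sum_(q < absz n')
     Yshift al p (lift ord0 q) (tn tau (bsum c) u'))).
  apply: lspanB; first exact: YW.
  apply: lspan_sum => q _ _; rewrite E; apply: lspanZ.
  have -> : al + bsum c = bsum (i :: c) by rewrite /bsum big_cons.
  apply: (IHn (n' - (lift ord0 q : nat)%:Z)); first by rewrite lift0; lia.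
    exact: Ep_FS.
  by rewrite -np; ring.
move: YW; rewrite E add0r Ep0 => /(lspanZ z^-1).
by rewrite scalerA mulVf // scale1r /bsum big_cons.
Qed.

Lemma add_deltaE m r r' : (m + delta_mx 0 r) 0 r' = m 0 r' + (r' == r)%:Z.
Proof. by rewrite !mxE eqxx; case: (r' == r). Qed.

Lemma bm_delta m r : bm (m + delta_mx 0 r) = bm m + alphar X r.
Proof.
rewrite /bm (bigD1 r) //= [in RHS](bigD1 r) //= add_deltaE eqxx.
rewrite scalerDl scale1r -!addrA; congr (_ + _); rewrite addrC; congr (_ + _).
by apply: eq_bigr => r' r'r; rewrite add_deltaE (negPf r'r) addr0.
Qed.

Lemma bm0 : bm (0 : 'rV[int]_d) = 0.
Proof. by rewrite /bm big1 // => r _; rewrite mxE scale0r. Qed.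

Definition chg c : 'rV[int]_d :=
  \row_r (count (fun i => i \in porbit s (rep X r)) c)%:Z.

Lemma charge_chg t : charge t = chg (unzip1 t).
Proof. by apply/rowP => r; rewrite !mxE count_map. Qed.

Lemma mem_porbit_rep r0 r j :
  (((s ^+ j)%g (rep X r0)) \in porbit s (rep X r)) = (r == r0).
Proof.
apply/porbitP/eqP => [[j' E]|->]; last by exists j.
(* The exponent v j - j undoes the power j, as nu has order v. *)
have E' : (s ^+ (j' + (v * j - j)))%g (rep X r) = rep X r0.
  rewrite expgD permM -E -permM -expgD subnKC; last by rewrite leq_pmull ?v_gt0.
  by rewrite expgM expg_order expg1n perm1.
by have := cycle_pow_eq r r0 (j' + (v * j - j)); rewrite E' eqxx => /esym/andP[/eqP].
Qed.

Lemma chg_cons r j c : chg ((s ^+ j)%g (rep X r) :: c) = chg c + delta_mx 0 r.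
Proof.
apply/rowP => r'; rewrite add_deltaE !mxE /= mem_porbit_rep.
by rewrite PoszD addrC.
Qed.

Lemma chg_nil : chg [::] = 0.
Proof. by apply/rowP => r; rewrite !mxE. Qed.

(** Replacing every basis element by its orbit representative changes the sum by an element of N, so
    the charge alone determines the line in U_T. *)
Lemma bsum_bm c : Nset X (bsum c - bm (chg c)).
Proof.
elim: c => [|i c IHc].
  by rewrite /bsum big_nil chg_nil bm0 subrr; apply: Nset0.
have [r [j ->]] := cycle_cover i.
rewrite chg_cons bm_delta /bsum big_cons -/(bsum c) -nu_alpha.
rewrite [_ + bsum c]addrC opprD addrACA.
by apply: NsetD => //; apply: Nset_nu.
Qed.

Lemma Sv_coset a b : Nset X (a - b) -> Sv a a = Sv b b.
Proof.
move=> Nab; rewrite -[a](subrK b) addrC Sv_quad (Nset_Sv b Nab).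
by rewrite (Nset_Sv (a - b) Nab) mul0rn !addr0.
Qed.

Lemma Fock_cons r p m n u : Fock m n u ->
  Fock (m + delta_mx 0 r) (n + (Mper r * p)%N) (hd (r, p) u).
Proof.
apply: (lspan_lin_ind (hd_lin _)) => _ [t [tm tn] <-]; apply: mem_lspan.
exists ((r, p) :: t) => //; split=> [r'|].
  by rewrite add_deltaE -tm /cnt /= [r == r']eq_sym PoszD addrC.
by rewrite /wd big_cons -/(wd t) /= -tn PoszD addrC.
Qed.

(** Passing to orbit representatives only rescales the coefficients of E^-, and those of index not
    divisible by [Mper r] vanish. *)
Lemma FS_Fock c n u : FS (vecs c) n u -> Fock (chg c) n u.
Proof.
apply: lspan_sub => _ [t [tc <-] <-] {n u}.
elim: c t tc => [|i c IHc] [|[a p] t] //= tc.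
  by apply: mem_lspan; exists [::] => //; split=> [r|]; rewrite ?chg_nil ?mxE // /wd big_nil.
case: tc => -> tc; have [r [j ->]] := cycle_cover i.
rewrite chg_cons -nu_alpha ext_nu Em_nu -/(alphar X r); apply: lspanZ.
have [Mp|Mp] := boolP (Mper r %| p)%N; last by rewrite Em_support //; apply: lspan0.
rewrite -(divnK Mp) mulnC [(_ + sumn _)%N]addnC PoszD.
exact/Fock_cons/IHc.
Qed.

Definition reps (t : seq ('I_d * nat)) : seq 'I_D := [seq rep X x.1 | x <- t].

Lemma chg_reps m n t : shape m n t -> chg (reps t) = m.
Proof.
move=> [tm _]; apply/rowP => r; rewrite mxE -tm count_map; congr Posz.
by apply: eq_count => x /=; have := mem_porbit_rep x.1 r 0; rewrite expg0 perm1 eq_sym.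
Qed.

Lemma bsum_reps t : bsum (reps t) = bm (chg (reps t)).
Proof.
elim: t => [|x t IHt]; first by rewrite chg_nil bm0 /bsum big_nil.
have := chg_cons x.1 0 (reps t); rewrite expg0 perm1 /bsum /= => ->.
by rewrite bm_delta -IHt big_cons addrC.
Qed.

Lemma hmd_FS t : FS (vecs (reps t)) (wd t)%:Z (hmd t).
Proof.
apply: mem_lspan.
exists [seq (ext C (alphar X x.1), (Mper x.1 * x.2)%N) | x <- t].
  split; first by rewrite /vecs /reps /unzip1 -!map_comp.
  by rewrite /unzip2 -map_comp /wd sumnE big_map.
by elim: t => [|x t IHt]; [reflexivity|rewrite [RHS]/= -IHt; reflexivity].
Qed.

(** One inclusion expands monomials and normalizes the orbit elements; the other inverts the
    triangular system on words of representatives only. *)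
Lemma WgrE m (n : int) : Wgr tau m n%:~R =
  tn tau (bm m) @` Fock m (n - Sv (bm m) (bm m)).
Proof.
have kQ : (k%:R : rat) != 0 by apply: kF.
have wtE t : (k%:R * (wt t - wt_vac X) = n%:~R) <-> - modesum t = n.
  rewrite /wt addrK mulrN mulr_sumr.
  rewrite (eq_bigr (fun x => (x.2)%:~R)) => [|x _]; last by rewrite mulrC divfK.
  rewrite -rmorph_sum /= -/(modesum t) -mulrNz.
  by split=> [/eqP|->//]; rewrite eqr_int => /eqP.
rewrite -(lspan_image _ (tn_lin _ _)); apply/seteqP; split.
  apply: lspan_sub => _ [t [-> tm /wtE tn]].
  have [u Fu ->] := mono_FS t; rewrite tn in Fu.
  rewrite charge_chg in tm.
  have Nc := bsum_bm (unzip1 t); rewrite tm in Nc.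
  have [z _ ->] := tn_coset tauM tau_eta Nc; apply: lspanZ.
  rewrite (lspan_image _ (tn_lin _ _)); exists u => //.
  by rewrite -(Sv_coset Nc) -tm; apply: FS_Fock.
apply: lspan_sub => _ [_ [t st <-] <-].
have := FS_mono (hmd_FS t).
rewrite bsum_reps (chg_reps st); apply: lspan_sub => _ [t' [tc tn] ->].
apply: mem_lspan; exists t'; split=> //.
  by rewrite charge_chg tc (chg_reps st).
by apply/wtE; rewrite tn; have [_ ->] := st; rewrite subrK.
Qed.

End PrincipalSubspace.

(** * Dimensions of subspaces *)

Section Dimension.
Variables (C : fieldType).

Definition subsp (V : lmodType C) (W : set V) :=
  W 0 /\ forall (c : C) x y, W x -> W y -> W (c *: x + y).

Lemma lspan_subsp (V : lmodType C) (X : set V) : subsp (lspan X).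
Proof. by split=> [|c x y]; [apply: lspan0|apply: lspan_lin]. Qed.

Section OneSpace.
Variables (V : lmodType C) (W : set V).

Lemma subsp_sum (I : Type) (r : seq I) (c : I -> C) (x : I -> V) :
  subsp W -> (forall i, W (x i)) -> W (\sum_(i <- r) c i *: x i).
Proof.
move=> [W0 WD] Wx; elim: r => [|i r IHr]; first by rewrite big_nil.
by rewrite big_cons; apply: WD.
Qed.

Lemma linear_on0 (f : V -> V) : subsp W -> linear_on W f -> f 0 = 0.
Proof.
move=> [W0 _] lf; apply: (addIr (f 0)); rewrite add0r.
by rewrite -{1}[f 0]scale1r -lf // scale1r addr0.
Qed.

Lemma linear_on_sum (f : V -> V) (I : Type) (r : seq I) (c : I -> C) (x : I -> V) :
  subsp W -> linear_on W f -> (forall i, W (x i)) ->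
  f (\sum_(i <- r) c i *: x i) = \sum_(i <- r) c i *: f (x i).
Proof.
move=> sW lf Wx; elim: r => [|i r IHr].
  by rewrite !big_nil (linear_on0 sW).
by rewrite !big_cons lf ?IHr //; apply: subsp_sum.
Qed.

Lemma lspan_range (I : finType) (b : I -> V) x : lspan (range b) x ->
  exists c : I -> C, x = \sum_i c i *: b i.
Proof.
move=> /lspan_family[s [_ ->]]; elim: s => [|p s [c IHs]].
  by exists (fun=> 0); rewrite big_nil big1 // => i _; rewrite scale0r.
exists (fun i => (if i == p.2 then p.1 else 0) + c i).
rewrite big_cons IHs; under [RHS]eq_bigr do rewrite scalerDl.
rewrite big_split /=; congr (_ + _); rewrite (bigD1 p.2) //= eqxx big1 ?addr0 //.
by move=> i /negPf ->; rewrite scale0r.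
Qed.

(** With more free vectors than generators, the coefficient matrix has a nonzero kernel row, which
    is a forbidden relation. *)
Lemma free_le_span n n' (b : 'I_n -> V) (b' : 'I_n' -> V) :
  is_basis W b -> W `<=` lspan (range b') -> (n <= n')%N.
Proof.
move=> [Wb fb _] Wb'.
have bE i : {c : 'I_n' -> C | b i = \sum_j c j *: b' j}.
  by apply/cid/lspan_range/Wb'/Wb.
pose A := \matrix_(i < n, j < n') sval (bE i) j.
rewrite leqNgt; apply/negP => nn'.
have K0 : kermx A != 0.
  rewrite -mxrank_eq0 mxrank_ker subn_eq0 -ltnNge.
  exact: leq_ltn_trans (rank_leq_col A) nn'.
pose x := nz_row (kermx A).
have xA : x *m A = 0 by apply/sub_kermxP/nz_row_sub.
have x0 : x != 0 by rewrite nz_row_eq0.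
case/negP: x0; apply/eqP/rowP => i; rewrite [RHS]mxE.
apply: (fb (x 0)); under eq_bigr => i' _ do rewrite (svalP (bE i')) scaler_sumr.
rewrite exchange_big big1 // => j _.
under eq_bigr do rewrite scalerA.
rewrite -scaler_suml; have /matrixP/(_ 0 j) := xA; rewrite !mxE.
by under eq_bigr do rewrite mxE; move=> ->; rewrite scale0r.
Qed.

(** [dimS] chooses some size of a basis; all bases have the same size. *)
Lemma dimS_basis n (b : 'I_n -> V) : is_basis W b -> dimS W = n.
Proof.
move=> bW; rewrite /dimS; set P := [set n | _].
have [b' bW'] : P (xget 0%N P) by apply: (@xgetPex _ _ P); exists n, b.
have [_ _ sb] := bW; have [_ _ sb'] := bW'.
by apply/eqP; rewrite eqn_leq (free_le_span bW' sb) (free_le_span bW sb').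
Qed.

Lemma basis_exists (I : finType) (g : I -> V) : subsp W ->
  (forall x, W (g x)) -> W `<=` lspan (range g) ->
  exists n (b : 'I_n -> V), is_basis W b.
Proof.
move=> sW Wg Ws.
pose P n := `[< exists b : 'I_n -> V, (forall i, W (b i)) /\ W `<=` lspan (range b) >].
have exP : exists n, P n.
  exists #|I|; apply/asboolP; exists (fun i => g (enum_val i)); split=> // x /Ws.
  apply: lspan_sub => _ [y _ <-]; apply: mem_lspan.
  by exists (enum_rank y) => //; rewrite enum_rankK.
case: (ex_minnP exP) => n /asboolP[b [Wb bs]] nmin; exists n, b; split=> // c c0 i.
apply/eqP; apply: contraT => ci.
case: n b Wb bs nmin c c0 i ci => [|n] b Wb bs nmin c c0 i ci; first by case: i ci.
suff /nmin : P n by rewrite ltnn.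
apply/asboolP; exists (fun j => b (lift i j)); split=> // x /bs.
apply: lspan_sub => _ [j _ <-].
case: (unliftP i j) => [j' ->|->]; first by apply: mem_lspan; exists j'.
have -> : b i = \sum_(j' < n) (- (c i)^-1 * c (lift i j')) *: b (lift i j').
  move: c0; rewrite (bigD1_ord i) //= => /eqP; rewrite addr_eq0 => /eqP E.
  apply: (scalerI ci); rewrite E scaler_sumr -sumrN; apply: eq_bigr => j' _.
  by rewrite scalerA mulrA mulrN divff // mulN1r scaleNr.
by apply: lspan_sum => j' _ _; apply/lspanZ/mem_lspan; exists j'.
Qed.

Lemma dimS_0 : W = [set 0] -> dimS W = 0%N.
Proof.
move=> W0; pose b (i : 'I_0) : V := 0.
apply: (@dimS_basis 0 b); split=> [[]|c _ []|x] //.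
by rewrite W0 => ->; apply: lspan0.
Qed.

End OneSpace.

(** Images of a basis of W1 and chosen lifts of a basis of W3 together form a basis of W2. *)
Lemma dimS_short_exact (V : lmodType C) (W1 W2 W3 : set V) (f g : V -> V) :
  subsp W1 -> subsp W2 ->
  short_exact W1 W2 W3 f g ->
  (exists n (b : 'I_n -> V), is_basis W1 b) ->
  (exists n (b : 'I_n -> V), is_basis W3 b) ->
  dimS W2 = (dimS W1 + dimS W3)%N.
Proof.
move=> sW1 sW2 [lf lg finj fker gim] [n1 [b1 B1]] [n3 [b3 B3]].
rewrite (dimS_basis B1) (dimS_basis B3).
have [Wb1 fb1 sb1] := B1; have [Wb3 fb3 sb3] := B3.
have fW x : W1 x -> (W2 `&` [set w | g w = 0]) (f x) by rewrite -fker => Wx; exists x.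
have rE j : {r : V | W2 r /\ g r = b3 j}.
  by apply: cid; have := Wb3 j; rewrite -gim => -[r Wr gr]; exists r.
pose b (i : 'I_(n1 + n3)) : V :=
  match split i with inl i => f (b1 i) | inr j => sval (rE j) end.
have bl i : b (lshift n3 i) = f (b1 i) by rewrite /b (unsplitK (inl i)).
have br j : b (rshift n1 j) = sval (rE j) by rewrite /b (unsplitK (inr j)).
have Wr j : W2 (sval (rE j)) by case: (svalP (rE j)).
have gr j : g (sval (rE j)) = b3 j by case: (svalP (rE j)).
have Wb i : W2 (b i).
  rewrite /b; case: (split i) => // i'; by case: (fW _ (Wb1 i')).
apply: (@dimS_basis _ _ _ b); split=> // [c|w Ww].
  move=> E; have cr j : c (rshift n1 j) = 0.
    apply: (fb3 (fun j => c (rshift n1 j))).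
    have := linear_on_sum (index_enum 'I_(n1 + n3)) c sW2 lg Wb; rewrite E.
    rewrite (linear_on0 sW2 lg) big_split_ord /= big1 ?add0r => [|i _]; last first.
      by rewrite bl; have [_ ->] := fW _ (Wb1 i); rewrite scaler0.
    by under eq_bigr do rewrite br gr.
  have cl i : c (lshift n3 i) = 0.
    apply: (fb1 (fun i => c (lshift n3 i))); apply: finj.
    - exact: subsp_sum.
    - exact: sW1.1.
    rewrite (linear_on_sum _ _ sW1 lf Wb1) (linear_on0 sW1 lf) -[RHS]E big_split_ord /=.
    rewrite [X in _ = _ + X]big1 ?addr0 => [|j _]; last by rewrite cr scale0r.
    by apply: eq_bigr => i' _; rewrite bl.
  by move=> i; case: (splitP i) => j Ej;
    [rewrite (_ : i = lshift n3 j) ?cl|rewrite (_ : i = rshift n1 j) ?cr];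
    rewrite //; apply: val_inj.
have W3g : W3 (g w) by rewrite -gim; exists w.
have [dd Ed] := lspan_range (sb3 _ W3g).
(* A lift of g w, so that w - w' is in the kernel of g, the image of f. *)
pose w' := \sum_j dd j *: sval (rE j).
have Ww' : W2 w' by apply: subsp_sum.
have gw' : g w' = g w.
  rewrite (linear_on_sum _ _ sW2 lg Wr) Ed.
  by apply: eq_bigr => j _; rewrite gr.
have : (W2 `&` [set w | g w = 0]) (w - w').
  rewrite -[w - w']addrC -scaleN1r; split; first exact: sW2.2.
  by rewrite /= lg // gw' scaleN1r addNr.
rewrite -fker => -[x Wx Ex].
have [ee Ee] := lspan_range (sb1 _ Wx).
rewrite -[w](subrK w') -Ex Ee (linear_on_sum _ _ sW1 lf Wb1).
apply: lspanD; apply: lspan_sum => j _ _; apply/lspanZ/mem_lspan.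
  by exists (lshift n3 j).
by exists (rshift n1 j).
Qed.

End Dimension.

(** * The exact sequence *)

Section ExactSequence.
Variables (C : numClosedFieldType) (X : latticeData C).
Local Notation D := (rkL X).
Local Notation d := (ncyc X).
Local Notation k := (kper X).
Local Notation v := (vper X).
Variable tau : Lhat X -> C.
Hypothesis tauM : forall a b : Lhat X, Nset X a.2 -> Nset X b.2 ->
  tau (Lhat_nu_mul a b) = tau a * tau b.
Hypothesis tau_eta : tau (1, 0) = eta X.
Implicit Types (m : 'rV[int]_d) (n : int).

Local Notation WE := (WgrE tauM tau_eta).

Definition lower_weight i m n : int :=
  n + Sv (alphar X i) (alphar X i) - Sv (alphar X i) (bm m) *+ 2.

(** Once the weights of e_b are removed, source and target have the same Heisenberg degree, and
    e_(alpha^(i)) becomes a multiple of the inclusion [Fock_sub]. *)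
Lemma lower_weightE i m n :
  lower_weight i m n - Sv (bm (m - delta_mx 0 i)) (bm (m - delta_mx 0 i))
  = n - Sv (bm m) (bm m).
Proof.
rewrite /lower_weight -[in bm m](subrK (delta_mx 0 i) m) bm_delta.
set b := bm _; set a := alphar X i.
by rewrite Sv_quad SvDr (SvC b a) !mulr2n; ring.
Qed.

Lemma Wgr_short_exact i m n :
  short_exact (Wgr tau (m - delta_mx 0 i) (lower_weight i m n)%:~R)
    (Wgr tau m n%:~R) (Wgr tau m (n - (Mper i)%:Z * m 0 i)%:~R)
    (emap tau i) (DeltaTc tau i m).
Proof.
rewrite !WE lower_weightE [n - _ * _ - _]addrAC.
set b := bm m; set b' := bm _; set n0 := n - _.
have [z z0 Ez] := emap_tn tauM tau_eta i b'.
have bE : alphar X i + b' = b by rewrite addrC /b' -bm_delta subrK.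
rewrite bE in Ez; split.
- by move=> c x y _ _; apply: emap_lin.
- move=> c _ _ [u Fu <-] [u' Fu' <-].
  apply: etrans (congr1 (DeltaTc tau i m) (esym (tn_lin tau b c u u'))) _.
  apply: (etrans (@DeltaTc_tn C X tau i m (c *: u + u'))).
  rewrite (Dlam_lin i (m 0 i) c u u'); apply: etrans (tn_lin tau b _ _ _) _.
  exact: (esym (f_equal2 (fun x y => c *: x + y)
    (@DeltaTc_tn C X tau i m u) (@DeltaTc_tn C X tau i m u'))).
- move=> _ _ [u Fu <-] [u' Fu' <-]; rewrite !Ez => /(scalerI z0).
  by move=> /(tn_inj tauM tau_eta) ->.
- apply/seteqP; split.
    move=> _ [_ [u Fu <-] <-]; rewrite Ez -(linZ (tn_lin tau b)); split.
      by exists (z *: u) => //; apply/lspanZ/(Fock_sub Fu).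
    by rewrite /= DeltaTc_tn (linZ (Dlam_lin _ _)) (Dlam_sub Fu) scaler0 (lin0 (tn_lin _ _)).
  move=> _ [[u Fu <-]]; rewrite /= DeltaTc_tn => Du.
  have {}Du : Dlam i (m 0 i) u = 0.
    by apply: (tn_inj tauM tau_eta (b := b)); rewrite Du (lin0 (tn_lin _ _)).
  exists (tn tau b' (z^-1 *: u)).
    by exists (z^-1 *: u) => //; apply/lspanZ/(Dlam_ker Fu Du).
  by rewrite Ez -(linZ (tn_lin tau b)) scalerA mulfV // scale1r.
rewrite -Dlam_image; apply/seteqP; split.
  by move=> _ [_ [u Fu <-] <-]; rewrite DeltaTc_tn; exists (Dlam i (m 0 i) u) => //; exists u.
move=> _ [_ [u Fu <-] <-]; exists (tn tau b u); first by exists u.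
by rewrite DeltaTc_tn.
Qed.

(** The charge fixes the number of factors and the degree bounds their indices, so finitely many
    words span. *)
Lemma Wgr_basis m n : exists r (b : 'I_r -> VT tau), is_basis (Wgr tau m n%:~R) b.
Proof.
rewrite WE -(lspan_image _ (tn_lin _ _)); set n0 := n - _.
pose N := (\sum_r absz (m 0%R r))%N.
pose B := (absz n0).+1.
pose T : finType := N.-tuple ('I_d * 'I_B).
pose sq (t : T) : seq ('I_d * nat) := [seq (x.1, val x.2) | x <- t].
(* Tuples of the wrong shape go to 0, which keeps the family inside the component. *)
pose g (t : T) : VT tau :=
  if `[< shape m n0 (sq t) >] then tn tau (bm m) (hmd (sq t)) else 0.
apply: (@basis_exists _ _ _ T g); first exact: lspan_subsp.
  move=> t; rewrite /g; case: asboolP => st; last exact: lspan0.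
  by apply: mem_lspan; exists (hmd (sq t)) => //; apply: mem_lspan; exists (sq t).
rewrite (lspan_image _ (tn_lin _ _)) => _ [u Fu <-].
move: u Fu; apply: (lspan_lin_ind (tn_lin _ _)) => _ [t st <-].
have [tm tn0] := st.
have tN : size t == N.
  apply/eqP; rewrite /N (eq_bigr (fun r => cnt r t)) => [|r _]; last by rewrite -tm.
  elim: t {st tm tn0} => [|x t IHt]; first by rewrite big1.
  rewrite /= IHt /cnt /= [RHS]big_split /= [in RHS](bigD1 x.1) //= eqxx.
  by rewrite [X in (_ + X + _)%N]big1 // => r; rewrite eq_sym => /negPf ->.
have tB x : x \in t -> (x.2 < B)%N.
  move=> xt; rewrite /B ltnS -tn0 absz_nat.
  have := Mper_gt0 x.1; rewrite /wd (perm_big _ (perm_to_rem xt)) big_cons.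
  move=> M0; apply: leq_trans (leq_addr _ _).
  by rewrite leq_pmull.
have tBE : size [seq (x.1, inord x.2 : 'I_B) | x <- t] == N by rewrite size_map.
apply: mem_lspan; exists (Tuple tBE) => //; rewrite /g.
have -> : sq (Tuple tBE) = t.
  rewrite /sq /= -map_comp -[RHS]map_id; apply/eq_in_map => -[r p] /tB /= pB.
  by rewrite inordK.
by rewrite asboolT.
Qed.

Lemma dimS_Wgr i m n : dimS (Wgr tau m n%:~R) =
  addn (dimS (Wgr tau m (n - (Mper i)%:Z * m 0 i)%:~R))
       (dimS (Wgr tau (m - delta_mx 0 i) (lower_weight i m n)%:~R)).
Proof.
rewrite addnC; apply: (dimS_short_exact _ _ (Wgr_short_exact i m n)).
- exact: lspan_subsp.
- exact: lspan_subsp.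
- exact: Wgr_basis.
- exact: Wgr_basis.
Qed.

Lemma Sv_ge0 (a b : 'rV[int]_D) : (forall j, 0 <= a 0 j) ->
  (forall j, 0 <= b 0 j) -> 0 <= Sv a b.
Proof.
have mulmx_ge0 p q r (A : 'M[int]_(p, q)) (B : 'M[int]_(q, r)) :
    (forall i j, 0 <= A i j) -> (forall i j, 0 <= B i j) ->
    forall i j, 0 <= (A *m B) i j.
  by move=> A0 B0 i j; rewrite mxE; apply: sumr_ge0 => l _; rewrite mulr_ge0.
move=> a0 b0; apply: sumr_ge0 => j _; rewrite /form /bform.
apply: (mulmx_ge0) => [i1 i2|i1 i2]; last by rewrite mxE (ord1 i2).
apply: (mulmx_ge0) => [i3 i4|i3 i4]; last by rewrite mxE intz gram_ge0.
apply: (mulmx_ge0) => [i5 i6|i5 i6]; first by rewrite (ord1 i5).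
by rewrite !mxE.
Qed.

Lemma bm_ge0 m : (forall r, 0 <= m 0 r) -> forall j, 0 <= bm m 0 j.
Proof.
move=> m0 j; rewrite /bm summxE; apply: sumr_ge0 => r _.
by rewrite !mxE mulr_ge0.
Qed.

Lemma Fock0 m n : ~ (exists t, shape m n t) -> Fock m n = [set 0].
Proof.
move=> sh; apply/seteqP; split=> [u|_ ->]; last exact: lspan0.
move=> Fu; apply: lspan_set0; move: u Fu; apply: lspan_sub => x [t st _].
by case: sh; exists t.
Qed.

(** The test in [chi'] discards only zero components: words have nonnegative charge, and weight at
    least S(b, b) >= 0 since the Gram matrix has nonnegative entries. *)
Lemma chi'_int m n : chi' tau m n%:~R = dimS (Wgr tau m n%:~R).
Proof.
rewrite /chi'; case: ifP => // /negbT mn; rewrite dimS_0 //.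
rewrite WE Fock0; last first.
  move=> [t [tm tn]]; case/negP: mn; apply/andP; split.
    by apply/forallP => r; rewrite -tm.
  have := Sv_ge0 (bm_ge0 (m := m) _) (bm_ge0 (m := m) _) => S0.
  have {}S0 : 0 <= Sv (bm m) (bm m) by apply: S0 => r; rewrite -tm.
  have n0 : 0 <= n by lia.
  by rewrite -(gez0_abs n0) -pmulrn natr_nat.
by apply/seteqP; split=> [_ [_ -> <-]|_ ->]; [|exists 0 => //]; rewrite /= (lin0 (tn_lin _ _)).
Qed.

Lemma chi'_nonint m (x : rat) : x \isn't a Num.int -> chi' tau m x = 0%N.
Proof.
move=> xi; rewrite /chi' ifF //; apply/negP => /andP[_ xn].
by case/negP: xi; case/natrP: xn => n ->; rewrite pmulrn intr_int.
Qed.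

Lemma chi'_recursion i m (x : rat) : chi' tau m x =
  addn (chi' tau m (x - ((Mper i)%:Z * m 0 i)%:~R))
    (chi' tau (m - delta_mx 0 i)
      (x + (Sv (alphar X i) (alphar X i) - Sv (alphar X i) (bm m) *+ 2)%:~R)).
Proof.
have [/intrP[n ->]|xi] := boolP (x \is a Num.int).
  by rewrite -intrB -intrD !chi'_int (dimS_Wgr i) /lower_weight addrA.
by rewrite !chi'_nonint ?rpredDr ?rpredBr // ?rpredN intr_int.
Qed.

Lemma Sv_alphar_bm i m :
  Sv (alphar X i) (bm m) = \sum_j m 0 j * Sv (alphar X i) (alphar X j).
Proof.
have SvZr (a b : 'rV[int]_D) c : Sv a (c *: b) = c * Sv a b.
  by rewrite /Sv mulr_sumr; apply: eq_bigr => l _; rewrite formZr.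
rewrite /bm; elim/big_rec2: _ => [|j x y _ <-]; first exact: Sv0r.
by rewrite SvDr SvZr.
Qed.

Lemma kper_form0 (a b : 'rV[int]_D) : k%:R * form0 a b = (Sv a b *+ 2)%:~R.
Proof.
rewrite form0E /kper natrM mulr2n intrD; field; exact: vF.
Qed.

Lemma kper_form0_half (a : 'rV[int]_D) : k%:R * (form0 a a / 2) = (Sv a a)%:~R.
Proof. by rewrite mulrA kper_form0 mulr2n intrD; field. Qed.

Lemma kper_form0_sum i m :
  k%:R * \sum_j (m 0 j)%:~R * form0 (alphar X i) (alphar X j) =
  (Sv (alphar X i) (bm m) *+ 2)%:~R.
Proof.
rewrite Sv_alphar_bm -sumrMnl rmorph_sum mulr_sumr; apply: eq_bigr => j _ /=.
by rewrite mulrCA kper_form0 -mulrnAr rmorphM.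
Qed.

Lemma Mper_ratio i : k%:R / (len X i)%:R = (Mper i)%:R :> rat.
Proof. by rewrite -(Mper_len i) natrM mulfK // pnatr_eq0 -lt0n len_gt0. Qed.

End ExactSequence.

Theorem corollary4p1 (R : realType) (X : latticeData R[i])
    (nuhat : Lhat X -> Lhat X) (tau : Lhat X -> R[i])
    (NM : Nset X = Mset X) (MR : Mset X = Rset X)
    (Hnuhat : is_nuhat nuhat) (Htau : is_tau nuhat tau) :
  (forall (i : 'I_(ncyc X)) (m : 'rV[int]_(ncyc X)) (n : int),
     short_exact
       (Wgr tau (m - delta_mx 0 i)
          (n%:~R + (kper X)%:R * (form0 (alphar X i) (alphar X i) / 2)
           - (kper X)%:R *
             \sum_j (m 0 j)%:~R * form0 (alphar X i) (alphar X j)))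
       (Wgr tau m n%:~R)
       (Wgr tau m (n%:~R - (kper X)%:R / (len X i)%:R * (m 0 i)%:~R))
       (emap tau i)
       (DeltaTc tau i m))
  /\ (forall i : 'I_(ncyc X),
     chi' tau =
     series_add
       (series_subst
          (fun j => if j == i then (kper X)%:R / (len X i)%:R else 0)
          (chi' tau))
       (series_shift i
          ((kper X)%:R * (form0 (alphar X i) (alphar X i) / 2))
          (series_subst
             (fun j => (kper X)%:R * form0 (alphar X j) (alphar X i))
             (chi' tau)))).
Proof.
have [tauM tau_eta _] := Htau; split=> [i m n|i].
  have := Wgr_short_exact tauM tau_eta i m n.
  rewrite /lower_weight intrB intrD intrB intrM -pmulrn.
  by rewrite kper_form0_half kper_form0_sum Mper_ratio.
apply/funext => m; apply/funext => x.
rewrite (chi'_recursion tauM tau_eta i) /series_add /series_shift /series_subst.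
congr addn; apply: (congr1 (chi' tau _)).
  rewrite (bigD1 i) //= eqxx big1 ?addr0 => [|j /negPf ->]; last by rewrite mul0r.
  by rewrite Mper_ratio intrM -pmulrn.
rewrite kper_form0_half -addrA; congr (_ + _).
have -> : \sum_j (kper X)%:R * form0 (alphar X j) (alphar X i) *
    ((m - delta_mx 0 i) 0 j)%:~R = (Sv (alphar X i) (bm (m - delta_mx 0 i)) *+ 2)%:~R :> rat.
  rewrite -kper_form0_sum mulr_sumr; apply: eq_bigr => j _.
  by rewrite /form0 formC mulrAC mulrA.
(* The substitution is evaluated at charge m - eps_i; restoring alpha^(i) costs 2 S(alpha^(i),
   alpha^(i)), which turns the + S of the exact sequence into the - S of the prefactor. *)
rewrite -[in LHS](subrK (delta_mx 0 i) m) bm_delta SvDr -mulrNz -intrB.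
by congr (_%:~R); rewrite !mulr2n; ring.
Qed.
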